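(* Let $A=T(V)/\langle R\rangle$ be a finitely generated nonnegatively graded connected algebra such that its space of relations $R$ is finite dimensional, and assume that $A$ is multi-Koszul. Then the graded algebra $\mathcal{E}xt_A^{\bullet}(k,k)=\mathrm{Ext}_A^{\bullet}(k,k)$ is generated by $\mathrm{Ext}_A^1(k,k)$ and $\mathrm{Ext}_A^2(k,k)$, i.e. $A$ is a $\mathcal{K}_2$ algebra in the sense of Cassidy and Shelton.
   Context: Setting. $k$ is a field. $A=\bigoplus_{n\ge 0}A_n$ is a locally finite dimensional nonnegatively graded connected algebra ($A_0=k$, $\dim A_n<\infty$), written $A=T(V)/\langle R\rangle$, where $V\simeq A_{>0}/(A_{>0}\cdot A_{>0})$ is a positively graded vector space with finite dimensional components, $T(V)$ is its tensor algebra with the grading induced from $V$, and $R\subseteq \bigoplus_{n\ge2}V^{\otimes n}$ is a space of relations: a graded subspace with $R\cap(T(V)_{>0}\otimes R\otimes T(V)+T(V)\otimes R\otimes T(V)_{>0})=0$, $T(V)_{>0}=\bigoplus_{n\ge1}V^{\otimes n}$. $\pi:T(V)\to A$ is the projection. $V^{(n)}=V^{\otimes n}$, $V^{(0)}=k$. For subspaces $W_1,\dots,W_m$ of $T(V)$, $W_1\otimes\dots\otimes W_m$ denotes the subspace of $T(V)$ spanned by products $w_1\cdots w_m$; $R^{(i)}=R\otimes\dots\otimes R$ ($i$ factors), $R^{(0)}=k$. The spaces $J_i\subseteq T(V)$. $J_0=k$, $J_2=R$, $J_{2i+1}=(V\otimes J_{2i})\cap(J_{2i}\otimes V)$ for $i\ge0$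 (so $J_1=V$), and for $i\ge1$ $$J_{2(i+1)}=\Big(\sum_{N\ge1}\ \bigcap_{\bar n,\bar m}V^{(m_1)}\otimes J_{2n_1}\otimes\dots\otimes V^{(m_i)}\otimes J_{2n_i}\otimes V^{(m_{i+1})}\Big)\cap R^{(i+1)},$$ where $\bar n=(n_1,\dots,n_i)$ runs over $i$-tuples of nonnegative integers with sum $i$ and $\bar m=(m_1,\dots,m_{i+1})$ over $(i+1)$-tuples of nonnegative integers with sum $N$. Multi-Koszul algebras. $K_{L-R}(A)_i=A\otimes J_i\otimes A$, with $A$-bimodule maps $\delta_i^b:K_{L-R}(A)_i\to K_{L-R}(A)_{i-1}$: if $i=2j+1$ and $\omega=\sum\bar\omega_{(1)}\omega_{(2)}=\sum\omega'_{(1)}\bar\omega'_{(2)}\in J_{2j+1}$ with $\bar\omega_{(1)},\bar\omega'_{(2)}\in V$, $\omega_{(2)},\omega'_{(1)}\in J_{2j}$, then $\delta_i^b(1\otimes\omega\otimes1)=\sum\bar\omega_{(1)}\otimes\omega_{(2)}\otimes1-\sum1\otimes\omega'_{(1)}\otimes\bar\omega'_{(2)}$; if $i=2j\ge2$, then $J_{2j}\subseteq\bigoplus_{N\ge0}\bigcap_{l=0}^N V^{(l)}\otimes J_{2j-1}\otimes V^{(N-l)}$, and writing $\omega=\sum_N\omega^N$ accordingly and $\omega^N=\sum\omega^{N,l}_{(1)}\omega^{N,l}_{(2)}\omega^{N,l}_{(3)}\in V^{(l)}\otimes J_{2j-1}\otimes V^{(N-l)}$ for each $0\le l\le N$, $\delta_i^b(1\otimes\omega\otimes1)=\sum_N\sum_{l=0}^N\sum\pi(\omega^{N,l}_{(1)})\otimes\omega^{N,l}_{(2)}\otimes\pi(\omega^{N,l}_{(3)})$.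 The left (resp. right) multi-Koszul complex is $K_{L-R}(A)_\bullet\otimes_A k$ (resp. $k\otimes_A K_{L-R}(A)_\bullet$), augmented to $k$. $A$ is multi-Koszul if the augmented left multi-Koszul complex is a resolution of the trivial left module $k$ (equivalently, the right one is a resolution of the trivial right module $k$). $\mathcal{H}om_A(N,N')=\bigoplus_{d\in\mathbb{Z}}\hom_A(N,N'[d])$ ($\hom_A$: degree-preserving $A$-linear maps), and $\mathcal{E}xt$ is its derived functor; under the present hypotheses $\mathcal{E}xt_A^\bullet(k,k)$ is canonically identified with the usual $\mathrm{Ext}_A^\bullet(k,k)$. The algebra structure is the Yoneda product. $A$ is called $\mathcal{K}_2$ if $\mathrm{Ext}_A^\bullet(k,k)$ is generated as an algebra by $\mathrm{Ext}_A^1(k,k)$ and $\mathrm{Ext}_A^2(k,k)$. *)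

(* Defs.v *)
From HB Require Import structures.
From mathcomp Require Import all_boot all_order all_algebra.
From mathcomp Require Import classical_sets.
From mathcomp Require Import finmap monalg.

Set Implicit Arguments.
Unset Strict Implicit.
Unset Printing Implicit Defensive.

Import GRing.Theory.

Local Open Scope classical_set_scope.
Local Open Scope ring_scope.

Definition lspan (S : pzRingType) (M : lmodType S) (X : set M) : set M :=
  [set x | exists2 s : seq (S * M),
     (forall t, t \in s -> X t.2) & x = \sum_(t <- s) t.1 *: t.2].

Definition subalg_generated (k : fieldType) (A : algType k) (s : seq A) : Prop :=
  forall S : {pred A}, GRing.subalg_closed S -> {subset s <= S} ->
    forall x, x \in S.

Definition fg_algebra (k : fieldType) (A : algType k) : Prop :=
  exists s : seq A, subalg_generated s.

(* I indexes a homogeneous basis of V, so that T(V) is the free associative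
   algebra on I: the algebra over k of the monoid of words in I.  Its product
   is the concatenation tensor product. *)
Notation tensor_alg k I := {malg k[{fmonom I}]}.

Section TensorAlgebra.
Context (k : fieldType) (I : choiceType).
Local Notation T := (tensor_alg k I).

Definition gen (i : I) : T := << fmu i >>.

Definition Vsub : set T := lspan (range gen).

Definition tprod (W1 W2 : set T) : set T :=
  lspan [set x * y | x in W1 & y in W2].

Definition tpow (W : set T) (n : nat) : set T :=
  iter n (tprod W) (lspan [set 1]).

Definition sumsp (W1 W2 : set T) : set T :=
  lspan (W1 `|` W2).

(* the sum of the V^(m) over m >= n *)
Definition Tge (n : nat) : set T :=
  lspan (\bigcup_(m in [set m | (n <= m)%N]) tpow Vsub m).

Definition ideal_of (W : set T) : set T :=
  tprod (tprod setT W) setT.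

Section Weight.
Variable deg : I -> nat.

Definition wdeg (w : {fmonom I}) : nat :=
  (\sum_(i <- (w : seq I)) deg i)%N.

Definition hcomp (n : nat) (x : T) : T :=
  \sum_(w <- msupp x | wdeg w == n) << x@_w *g w >>.

Definition Tdeg (n : nat) : set T := [set x | hcomp n x = x].
End Weight.

Record is_relation_space (deg : I -> nat) (R : set T) : Prop := {
  rel_subspace : R = lspan R;
  rel_graded : forall n x, R x -> R (hcomp deg n x);
  rel_ge2 : R `<=` Tge 2;
  rel_minimal : forall x, R x ->
    sumsp (tprod (tprod (Tge 1) R) setT) (tprod (tprod setT R) (Tge 1)) x ->
    x = 0
}.

Section JSpaces.
Variable R : set T.

(* V^(m_1) J_{2n_1} ... V^(m_i) J_{2n_i} V^(m_{i+1}), with JE n for J_{2n} *)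
Definition interleave (JE : nat -> set T) (i : nat)
    (m : i.+1.-tuple nat) (n : i.-tuple nat) : set T :=
  foldr (fun mn W => tprod (tpow Vsub mn.1) (tprod (JE mn.2) W))
        (tpow Vsub (last 0%N m)) (zip m n).

Definition Jstep (JE : nat -> set T) (i : nat) : set T :=
  lspan (\bigcup_(N in [set N | (1 <= N)%N])
    [set x | forall (n : i.-tuple nat) (m : i.+1.-tuple nat),
       sumn n = i -> sumn m = N -> interleave JE m n x])
  `&` tpow R i.+1.

(* Jtab i n is J_{2n} for n <= i; it is not meaningful for n > i. *)
Fixpoint Jtab (i : nat) : nat -> set T :=
  match i with
  | 0 => fun=> lspan [set 1]
  | j.+1 => fun n =>
      if (n <= j)%N then Jtab j n
      else if j is 0 then R else Jstep (Jtab j) j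
  end.

Definition Jeven (i : nat) : set T := Jtab i i.

Definition Jodd (i : nat) : set T :=
  tprod Vsub (Jeven i) `&` tprod (Jeven i) Vsub.

Definition J (i : nat) : set T :=
  if odd i then Jodd i./2 else Jeven i./2.
End JSpaces.

(* A = T(V)/<R>.  The grading of A is the one induced by deg through proj;
   pres_aug is the augmentation A -> A/A_{>0} = k. *)
Record presentation (A : algType k) := Presentation {
  gdeg : I -> nat;
  rels : set T;
  proj : {lrmorphism T -> A};
  pres_aug : {rmorphism A -> k};
  gdeg_gt0 : forall i, (0 < gdeg i)%N;
  gdeg_locfin : forall n, exists s : seq I, forall i, gdeg i = n -> i \in s;
  relP : is_relation_space gdeg rels;
  proj_surj : forall a, exists x, proj x = a;
  proj_ker : forall x, proj x = 0 <-> ideal_of rels x;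
  pres_augE : forall x, pres_aug (proj x) = x@_(@mone {fmonom I})
}.

Section MultiKoszul.
Context (A : algType k) (p : presentation A).
Local Notation R := (rels p).
Local Notation pi := (proj p).
Local Notation aug := (pres_aug p).

(* A (x) T(V) is the free left A-module on the words; tens a x is a (x) x. *)
Local Notation AT := {malg A[{fmonom I}]}.

Definition tens (a : A) (x : T) : AT :=
  \sum_(w <- msupp x) << x@_w *: a *g w >>.

(* A (x) J_i, that is K_{L-R}(A)_i (x)_A k, as a submodule of A (x) T(V) *)
Definition Kleft (i : nat) : set AT := lspan [set tens 1 x | x in J R i].

(* The differential delta^b (x)_A k: under (A (x) J_i (x) A) (x)_A k = A (x) J_i
   the element a (x) w (x) b becomes aug b *: (a (x) w). *)
Definition is_diff_odd (j : nat) (delta : AT -> AT) : Prop :=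
  forall s s' : seq (T * T),
    (forall t, t \in s -> Vsub t.1 /\ Jeven R j t.2) ->
    (forall t, t \in s' -> Jeven R j t.1 /\ Vsub t.2) ->
    \sum_(t <- s) t.1 * t.2 = \sum_(t <- s') t.1 * t.2 ->
    delta (tens 1 (\sum_(t <- s) t.1 * t.2)) =
      \sum_(t <- s) tens (pi t.1) t.2
      - \sum_(t <- s') tens (aug (pi t.2))%:A t.1.

(* j.+1 stands for the j of i = 2j, so that J_{2j-1} is Jodd j; s N l lists
   the terms of the l-th expression of the component omega^N, N < B. *)
Definition is_diff_even (j : nat) (delta : AT -> AT) : Prop :=
  forall (B : nat) (om : nat -> T)
    (s : nat -> nat -> seq (T * T * T)),
    (forall N l, (N < B)%N -> (l <= N)%N ->
       (forall t, t \in s N l ->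
          [/\ tpow Vsub l t.1.1, Jodd R j t.1.2 & tpow Vsub (N - l) t.2]) /\
       \sum_(t <- s N l) t.1.1 * t.1.2 * t.2 = om N) ->
    Jeven R j.+1 (\sum_(N < B) om N) ->
    delta (tens 1 (\sum_(N < B) om N)) =
      \sum_(N < B) \sum_(l < N.+1) \sum_(t <- s N l)
        tens (aug (pi t.2) *: pi t.1.1) t.1.2.

(* delta i : A (x) J_{i+1} -> A (x) J_i; only its restriction to Kleft i.+1
   is meaningful. *)
Definition is_left_diff (delta : nat -> {linear AT -> AT}) : Prop :=
  (forall j, is_diff_odd j (delta j.*2)) /\
  (forall j, is_diff_even j (delta j.*2.+1)).

Definition left_resolution (delta : nat -> {linear AT -> AT}) : Prop :=
  (forall a : A, aug a = 0 <->
     exists2 y, Kleft 1 y & tens a 1 = delta 0%N y) /\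
  (forall i x, Kleft i.+1 x ->
     (delta i x = 0 <-> exists2 y, Kleft i.+2 y & x = delta i.+1 y)).

Definition multi_koszul : Prop :=
  exists2 delta : nat -> {linear AT -> AT},
    is_left_diff delta & left_resolution delta.

Definition Adeg (n : nat) : set A := [set pi x | x in Tdeg (gdeg p) n].
End MultiKoszul.
End TensorAlgebra.

Section Ext.
Context (k : fieldType) (A : algType k) (aug : {rmorphism A -> k}).

Definition projective (M : lmodType A) : Prop :=
  forall (N N' : lmodType A) (g : {linear N -> N'}) (f : {linear M -> N'}),
    (forall y, exists x, g x = y) ->
    exists h : {linear M -> N}, forall x, g (h x) = f x.

(* A-linear maps from M to the trivial module k *)
Local Notation trivhom M := {linear M -> k | (aug \; *%R)}.

Record resolution := Resolution {
  res_mod :> nat -> lmodType A;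
  res_d : forall n, {linear res_mod n.+1 -> res_mod n};
  res_aug : trivhom (res_mod 0%N);
  res_proj : forall n, projective (res_mod n);
  res_surj : forall c, exists x, res_aug x = c;
  res_exact0 : forall x, res_aug x = 0 <-> exists y, x = res_d 0%N y;
  res_exact : forall n x, res_d n x = 0 <-> exists y, x = res_d n.+1 y
}.

(* Ext^n(k,k) is the group of cocycles P_n -> k modulo coboundaries.  HC and
   HM select the morphisms in use: all A-linear maps for Ext, those of Hom_A
   (finite sums of homogeneous maps) for the graded version. *)
Section ExtAlgebra.
Variable P : resolution.
Definition cochain (n : nat) : Type := trivhom (P n).
Variables (HC : forall n, set (cochain n))
          (HM : forall m n, set {linear P m -> P n}).

Definition cocycle (n : nat) (f : cochain n) : Prop :=
  HC f /\ forall x, f (res_d P n x) = 0.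

Definition coboundary (n : nat) : cochain n -> Prop :=
  match n with
  | 0 => fun f => forall x, f x = 0
  | m.+1 => fun f => exists2 g : cochain m, HC g & forall x, f x = g (res_d P m x)
  end.

(* h represents the Yoneda product g.f (up to the sign convention): F is a
   chain map P_{*+m} -> P_* lifting f. *)
Definition yoneda_prod (n m : nat) (g : cochain n) (f : cochain m)
    (h : cochain (n + m)) : Prop :=
  exists F : forall i, {linear P (i + m)%N -> P i},
    [/\ forall i, HM (F i),
        forall x : P m, res_aug P (F 0%N x) = f x,
        forall i (x : P (i.+1 + m)%N),
          F i (res_d P (i + m) x) = res_d P i (F i.+1 x)
      & forall x, h x = g (F n x)].

(* graded subalgebras of Ext(k,k), as families of sets of cocycles which are
   stable under cohomology *)
Record ext_subalgebra (S : forall n, set (cochain n)) : Prop := {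
  exts_cocycle : forall n (f : cochain n), S n f -> cocycle f;
  exts_unit : S 0%N (res_aug P);
  exts_coboundary : forall n (f : cochain n),
    cocycle f -> coboundary f -> S n f;
  exts_linear : forall n (c : k) (f g h : cochain n), S n f -> S n g ->
    (forall x, h x = c * f x + g x) -> S n h;
  exts_prod : forall n m (g : cochain n) (f : cochain m) h,
    S n g -> S m f -> yoneda_prod g f h -> S (n + m)%N h
}.

Definition ext_generated12 : Prop :=
  forall S : (forall n, set (cochain n)), ext_subalgebra S ->
    (forall f : cochain 1, cocycle f -> S 1%N f) ->
    (forall f : cochain 2, cocycle f -> S 2%N f) ->
    forall n (f : cochain n), cocycle f -> S n f.
End ExtAlgebra.

Definition K2_algebra : Prop :=
  forall P : resolution,
    ext_generated12 (fun n => @setT (cochain P n))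
                    (fun m n => @setT {linear P m -> P n}).

Section Graded.
Variable Agr : nat -> set A.

Record is_grading (M : lmodType A) (gr : int -> set M) : Prop := {
  gr_zero : forall d, gr d 0;
  gr_sub : forall d x y, gr d x -> gr d y -> gr d (x - y);
  gr_scale : forall e d a x, Agr e a -> gr d x -> gr (d + e%:Z) (a *: x);
  gr_sum : forall x, exists D : seq int, exists2 c : int -> M,
    (forall d, gr d (c d)) & x = \sum_(d <- D) c d;
  gr_direct : forall (D : seq int) (c : int -> M), uniq D ->
    (forall d, gr d (c d)) -> \sum_(d <- D) c d = 0 ->
    forall d, d \in D -> c d = 0
}.

Definition trivial_gr (d : int) : set k := [set c | d != 0 -> c = 0].

(* The elements of Hom_A(M,N), the direct sum over e of hom_A(M, N[e]).  The
   scalar action s allows N to be the trivial module k. *)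
Definition graded_hom (M : lmodType A) (N : zmodType)
    (s : GRing.Scale.law A N) (gM : int -> set M) (gN : int -> set N)
    (f : {linear M -> N | s}) : Prop :=
  exists D : seq int, exists2 G : int -> {linear M -> N | s},
    (forall e d x, e \in D -> gM d x -> gN (d + e) (G e x)) &
    (forall x, f x = \sum_(e <- D) G e x).

(* Projective objects in graded modules are the graded modules which are
   projective, so this is a projective resolution in graded modules. *)
Record gresolution := GResolution {
  gres_res :> resolution;
  gres_gr : forall n, int -> set (gres_res n);
  gres_grading : forall n, is_grading (@gres_gr n);
  gres_d : forall n d x, gres_gr d x -> gres_gr d (res_d gres_res n x);
  gres_aug : forall d x, gres_gr d x -> trivial_gr d (res_aug gres_res x)
}.

Definition gHC (P : gresolution) (n : nat) : set (cochain P n) :=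
  [set f | graded_hom (@gres_gr P n) trivial_gr f].

Definition gHM (P : gresolution) (m n : nat) : set {linear P m -> P n} :=
  [set f | graded_hom (@gres_gr P m) (@gres_gr P n) f].

Definition graded_ext_generated12 : Prop :=
  forall P : gresolution, ext_generated12 (@gHC P) (@gHM P).

(* The canonical map from graded Ext to Ext is onto and one-to-one. *)
Definition graded_ext_eq_ext : Prop :=
  forall (P : gresolution) (n : nat),
    (forall f : cochain P n, cocycle (fun n => @setT (cochain P n)) f ->
       exists g e : cochain P n,
         [/\ cocycle (@gHC P) g,
             coboundary (fun n => @setT (cochain P n)) e
           & forall x, f x = g x + e x]) /\
    (forall f : cochain P n, cocycle (@gHC P) f ->
       coboundary (fun n => @setT (cochain P n)) f -> coboundary (@gHC P) f).
End Graded.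
End Ext.

(* Main.v *)
From HB Require Import structures.
Require Import Defs.
From mathcomp Require Import all_boot all_order all_algebra.
From mathcomp Require Import boolp classical_sets finmap monalg.

(** Write [J_i] for the spaces [J R i].  Each of them is finite dimensional and
    has a homogeneous basis [b_i].  Minimality of the relations makes the left
    ideal of [T(V)] generated by [R] free on a basis of [R] ([ltfree_rels]), and
    [J_(2j)] lies in [R^(j)] while [J_(2j+1)] lies in [V J_(2j)]; therefore every
    [b_i] is independent over [T(V)] acting on the left ([ltfree_J]).  Hence there
    is only one matrix [M_i] over [T(V)] with [M_i b_i = b_(i+1)], and it is
    homogeneous.  Over the trivial module half of the terms of the multi-Koszul
    differential vanish, and what remains is the complex of free modules with
    matrices [pi(M_i)] ([odd_differential_matrix], [even_differential_matrix]).

    The entries of [M_(2j)] lie in [V].  Those of [M_(2j+1) M_(2j)] lie in [R],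
    because the elements of [J_(2j+2)] belong to [R J_(2j)] and not merely to
    [T(V) J_(2j)] ([Jeven_coproduct]).  It follows that all the entries of
    [pi(M_i)] have augmentation zero: the resolution is minimal and [Ext^i] is
    the dual space of [J_i].

    A functional on [J_(2j)] lifts to a chain map whose components in degrees one
    and two are scalar matrices: for the functional dual to a basis vector, these
    are the coefficients over [b_1] and [b_2] of the corresponding columns of
    [M_(2j)] and [M_(2j+1) M_(2j)] ([scalar_lifts]).  So the product of a class of
    degree one or two with a class of degree [2j] is the restriction of a tensor
    product of functionals along [J_(2j+1) <= V J_(2j)] or
    [J_(2j+2) <= R J_(2j)].  These inclusions being injective, all functionals are
    sums of such restrictions ([coefficient_inverse]), and the algebra is
    generated by induction on the degree ([koszul_ext_generated12]).

    Any other graded projective resolution is homotopy equivalent to this one by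
    maps of degree zero, along which generation is transferred
    ([ext_generated12_transfer]).  Linear maps out of a finitely generated free
    graded module are finite sums of homogeneous ones, so cochains of the minimal
    resolution are graded; by the same homotopy equivalences graded and ordinary
    extensions agree ([graded_ext_comparison]).  Ordinary resolutions are graded
    resolutions over [A] placed in degree zero, which covers the ungraded
    statement ([K2_transfer]). *)

Set Implicit Arguments.
Unset Strict Implicit.
Unset Printing Implicit Defensive.

Import GRing.Theory.

Local Open Scope classical_set_scope.
Local Open Scope ring_scope.

Local Notation gr_ P n := (@gres_gr _ _ _ _ P n).
Local Notation gHC_ P := (@gHC _ _ _ _ P).
Local Notation gHM_ P := (@gHM _ _ _ _ P).
Local Notation all_cochains P := (fun n => @setT (cochain P n)).
Local Notation all_maps P := (fun m n => @setT {linear P m -> P n}).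

(** * Linear maps and projective modules *)

Lemma linear_of_fun (S : pzRingType) (M : lmodType S) (N : zmodType)
    (s : GRing.Scale.law S N) (f : M -> N) :
  linear_for s f -> exists g : {linear M -> N | s}, forall x, g x = f x.
Proof.
move=> fL; pose L := GRing.isLinear.Build S M N s f fL.
pose g : {linear M -> N | s} := HB.pack f L.
by exists g.
Qed.

Section FreeLift.
Context (S : nzRingType) (K : choiceType) (N : lmodType S) (y : K -> N).

Definition free_lift (g : {malg S[K]}) : N := \sum_(w <- msupp g) g@_w *: y w.

Lemma free_liftEw (d : {fset K}) g : (msupp g `<=` d)%fset ->
  free_lift g = \sum_(w <- d) g@_w *: y w.
Proof.
move=> sub; apply: big_fset_incl => // w _ /mcoeff_outdom ->.
by rewrite scale0r.
Qed.

Lemma free_lift_is_linear : linear free_lift.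
Proof.
move=> a g h; pose d := (msupp (a *: g + h) `|` (msupp g `|` msupp h))%fset.
have sub1 : (msupp (a *: g + h) `<=` d)%fset by exact: fsubsetUl.
have sub2 : (msupp g `<=` d)%fset.
  by apply: fsubset_trans (fsubsetUr _ _); exact: fsubsetUl.
have sub3 : (msupp h `<=` d)%fset.
  by apply: fsubset_trans (fsubsetUr _ _); exact: fsubsetUr.
rewrite (free_liftEw sub1) (free_liftEw sub2) (free_liftEw sub3).
rewrite scaler_sumr -big_split /=; apply: eq_bigr => w _.
by rewrite mcoeffD mcoeffZ scalerDl scalerA.
Qed.

HB.instance Definition _ :=
  GRing.isLinear.Build S {malg S[K]} N *:%R free_lift free_lift_is_linear.

Lemma free_liftU w : free_lift << w >> = y w.
Proof.
by rewrite (@free_liftEw [fset w]%fset) ?msuppU_le // big_seq_fset1 mcoeffUU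
  scale1r.
Qed.
End FreeLift.

(** A projective module is a retract of the free module on its own elements,
    over which a lift may be chosen generator by generator.  The target of the
    two maps need only carry a scalar action, so that the trivial module is
    covered. *)
Lemma projective_lift (k : fieldType) (A : algType k) (M N : lmodType A)
    (N' : zmodType) (s : GRing.Scale.law A N')
    (f : {linear M -> N' | s}) (g : {linear N -> N' | s}) :
  projective M -> (forall x, exists y, f x = g y) ->
  exists h : {linear M -> N}, forall x, g (h x) = f x.
Proof.
move=> Mproj /choice[y fy].
have eps_surj x : exists z, free_lift (id : M -> M) z = x.
  by exists << x >>; rewrite free_liftU.
have [t tK] := Mproj _ _ (free_lift (id : M -> M)) idfun eps_surj.
have {tK} tK x : free_lift id (t x) = x := tK x.
exists (free_lift y \o t) => x /=; rewrite -[in RHS](tK x) /free_lift.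
by rewrite !linear_sum; apply: eq_bigr => w _; rewrite !linearZ_LR /= fy.
Qed.

Lemma dependent_choice (X : nat -> Type) (G : forall n, X n -> Prop)
    (Rel : forall n, X n -> X n.+1 -> Prop) (x0 : X 0%N) :
  G 0%N x0 -> (forall n x, G n x -> exists2 y, Rel n x y & G n.+1 y) ->
  exists s : forall n, X n,
    [/\ s 0%N = x0, forall n, G n (s n) & forall n, Rel n (s n) (s n.+1)].
Proof.
move=> G0 step.
have stepS n (u : {x : X n | G n x}) :
    {v : {y : X n.+1 | G n.+1 y} | Rel n (sval u) (sval v)}.
  apply: cid; case: u => x Gx; have [y Rxy Gy] := step n x Gx.
  by exists (exist _ y Gy).
pose s := fix s n : {x : X n | G n x} :=
  if n is m.+1 then sval (stepS m (s m)) else exist _ x0 G0.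
exists (fun n => sval (s n)); split=> // n; first exact: svalP.
exact: (svalP (stepS n (s n))).
Qed.

(** Chain maps out of a complex are built degree by degree; [good] records a
    property, such as being homogeneous, which the lifts can be given. *)
Lemma chain_map_extend (S : pzRingType) (M N : nat -> lmodType S)
    (dM : forall n, {linear M n.+1 -> M n})
    (dN : forall n, {linear N n.+1 -> N n})
    (good : forall n, {linear M n -> N n} -> Prop)
    (a0 : {linear M 0%N -> N 0%N}) :
  (forall n x, dM n (dM n.+1 x) = 0) ->
  (forall n x, dN n x = 0 -> exists y, x = dN n.+1 y) ->
  (forall n (a : {linear M n -> N n}), good n a ->
     (forall x, exists y, a (dM n x) = dN n y) ->
     exists2 b : {linear M n.+1 -> N n.+1}, good n.+1 b &
       forall x, a (dM n x) = dN n (b x)) ->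
  good 0%N a0 -> (forall x, exists y, a0 (dM 0%N x) = dN 0%N y) ->
  exists a : forall n, {linear M n -> N n},
    [/\ a 0%N = a0, forall n, good n (a n)
      & forall n x, a n (dM n x) = dN n (a n.+1 x)].
Proof.
move=> dMM exN lift g0 ex0.
pose G n (a : {linear M n -> N n}) :=
  good n a /\ forall x, exists y, a (dM n x) = dN n y.
pose Rel n (a : {linear M n -> N n}) (b : {linear M n.+1 -> N n.+1}) :=
  forall x, a (dM n x) = dN n (b x).
have [//|n a [ga exa]|a [a0E Ga aE]] := @dependent_choice _ G Rel a0.
  have [b gb bE] := lift n a ga exa; exists b => //; split=> // x.
  by have [|y ->] := exN n (b (dM n.+1 x)); [rewrite -bE dMM linear0|exists y].
by exists a; split=> // n; case: (Ga n).
Qed.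

(** The homotopy at stage [n] lifts the defect [phi n - h (n-1) d], which the
    previous stage makes a cycle. *)
Lemma null_homotopy_extend (S : pzRingType) (M N : nat -> lmodType S)
    (dM : forall n, {linear M n.+1 -> M n})
    (dN : forall n, {linear N n.+1 -> N n})
    (good : forall m n, {linear M m -> N n} -> Prop)
    (phi : forall n, {linear M n -> N n}) :
  (forall n x, dM n (dM n.+1 x) = 0) ->
  (forall n x, dN n x = 0 -> exists y, x = dN n.+1 y) ->
  (forall n x, phi n (dM n x) = dN n (phi n.+1 x)) ->
  (forall n (a : {linear M n -> N n}), good n n a ->
     (forall x, exists y, a x = dN n y) ->
     exists2 b : {linear M n -> N n.+1}, good n n.+1 b &
       forall x, a x = dN n (b x)) ->
  (forall n (h : {linear M n -> N n.+1}), good n n.+1 h ->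
     good n.+1 n.+1 (phi n.+1 \- (h \o dM n))) ->
  good 0%N 0%N (phi 0%N) ->
  (forall x, exists y, phi 0%N x = dN 0%N y) ->
  exists h : forall n, {linear M n -> N n.+1},
    [/\ forall n, good n n.+1 (h n), forall x, phi 0%N x = dN 0%N (h 0%N x)
      & forall n x, phi n.+1 x = dN n.+1 (h n.+1 x) + h n (dM n x)].
Proof.
move=> dMM exN phiE lift good_defect g0 ex0.
have [h0 gh0 h0E] := lift _ _ g0 ex0.
pose G n (h : {linear M n -> N n.+1}) :=
  good n n.+1 h /\ forall x, dN n (h (dM n x)) = phi n (dM n x).
pose Rel n (h : {linear M n -> N n.+1}) (h' : {linear M n.+1 -> N n.+2}) :=
  forall x, phi n.+1 x = dN n.+1 (h' x) + h (dM n x).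
have G0 : G 0%N h0 by split=> // x; rewrite h0E.
have [n h [gh hE]|h [hE0 Gh hE]] := @dependent_choice _ G Rel h0 G0.
  have [x|h' gh' h'E] := lift _ _ (good_defect n h gh).
    by apply: exN; rewrite /= linearB /= hE phiE subrr.
  have h'E2 x : phi n.+1 x = dN n.+1 (h' x) + h (dM n x).
    by rewrite -h'E /= subrK.
  by exists h'; [exact: h'E2|split=> // x; rewrite h'E2 dMM linear0 addr0].
exists h; split=> [n|x|//]; first by case: (Gh n).
by rewrite hE0 h0E.
Qed.

(** * Graded modules *)

Lemma sum_widen (J : eqType) (N : zmodType) (D E : seq J) (c : J -> N) :
  uniq D -> uniq E -> {subset D <= E} -> (forall d, d \notin D -> c d = 0) ->
  \sum_(d <- E) c d = \sum_(d <- D) c d.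
Proof.
move=> uD uE sDE c0; rewrite (bigID (mem D)) /= [X in _ + X]big1 ?addr0.
  rewrite -big_filter; apply: perm_big; apply: uniq_perm; rewrite ?filter_uniq //.
  by move=> d; rewrite mem_filter /= andb_idr // => /sDE.
by move=> d /c0.
Qed.

Lemma sum_by_degree (J H : eqType) (N : zmodType) (r : seq J) (deg : J -> H)
    (F : J -> N) :
  \sum_(j <- r) F j
  = \sum_(d <- undup [seq deg j | j <- r]) \sum_(j <- r | deg j == d) F j.
Proof.
rewrite (exchange_big_dep predT) //= big_seq_cond [RHS]big_seq_cond.
apply: eq_bigr => j; rewrite andbT => jr.
rewrite big_mkcond (bigD1_seq (deg j)) ?undup_uniq ?mem_undup ?map_f //= eqxx.
by rewrite big1 ?addr0 // => e /negPf; rewrite eq_sym => ->.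
Qed.

Definition homogeneous_span (k : fieldType) (A : algType k)
    (Agr : nat -> set A) : Prop :=
  forall a, exists D : seq nat, exists2 c : nat -> A,
    (forall e, Agr e (c e)) & a = \sum_(e <- D) c e.

Section HomogeneousParts.
Context (k : fieldType) (A : algType k) (Agr : nat -> set A) (M : lmodType A).
Context (gr : int -> set M) (G : is_grading Agr gr).

Lemma grD d x y : gr d x -> gr d y -> gr d (x + y).
Proof.
move=> gx gy; rewrite -[y]opprK; apply: (gr_sub G) => //.
by rewrite -sub0r; apply: (gr_sub G) => //; exact: (gr_zero G).
Qed.

Lemma grMn d x n : gr d x -> gr d (x *+ n).
Proof.
by move=> gx; elim: n => [|n IH]; rewrite ?mulr0n ?mulrS; [exact: (gr_zero G)|
  exact: grD].
Qed.

(** The terms vanish outside of the finite set [D], so that two decompositions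
    can be compared term by term over a common set of degrees. *)
Definition hdecomp (x : M) (D : seq int) (c : int -> M) : Prop :=
  [/\ uniq D, forall d, gr d (c d), forall d, d \notin D -> c d = 0
    & x = \sum_(d <- D) c d].

Lemma hdecomp_ex x : exists c, exists D, hdecomp x D c.
Proof.
have [D [c gc ->]] := gr_sum G x.
exists (fun d => c d *+ count_mem d D), (undup D); split=> [|d|d|].
- exact: undup_uniq.
- exact: grMn.
- by rewrite mem_undup => /count_memPn ->; rewrite mulr0n.
- by rewrite -[LHS]big_undup_iterop_count.
Qed.

Lemma hdecomp_widen x D E c :
  hdecomp x D c -> uniq E -> {subset D <= E} -> hdecomp x E c.
Proof.
move=> [uD gc c0 ->] uE sDE; split=> // [d dE|].
  by apply: c0; apply: contra dE => /sDE.
by rewrite [RHS](sum_widen uD).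
Qed.

Lemma hdecomp_unique x D D' c c' :
  hdecomp x D c -> hdecomp x D' c' -> c =1 c'.
Proof.
move=> H H'; pose E := undup (D ++ D').
have [||_ gc c0 xE] := hdecomp_widen (E := E) H; first exact: undup_uniq.
  by move=> d dD; rewrite mem_undup mem_cat dD.
have [||uE gc' c0' xE'] := hdecomp_widen (E := E) H'; first exact: undup_uniq.
  by move=> d dD; rewrite mem_undup mem_cat dD orbT.
have S0 : \sum_(d <- E) (c d - c' d) = 0.
  by rewrite big_split sumrN /= -xE -xE' subrr.
move=> d; apply/eqP; rewrite -subr_eq0; apply/eqP.
have [dE|dE] := boolP (d \in E); last by rewrite c0 // c0' // subr0.
exact: (gr_direct G uE (fun e => gr_sub G (gc e) (gc' e)) S0).
Qed.

Definition hpart (d : int) (x : M) : M := sval (cid (hdecomp_ex x)) d.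

Lemma hpartP x : exists D, hdecomp x D (hpart^~ x).
Proof. exact: (svalP (cid (hdecomp_ex x))). Qed.

Lemma hpart_gr d x : gr d (hpart d x).
Proof. by have [D []] := hpartP x. Qed.

Lemma hpart_eq x D c : hdecomp x D c -> forall d, hpart d x = c d.
Proof. by have [E HE] := hpartP x => /(hdecomp_unique HE). Qed.

Lemma hpart_homog d x e : gr d x -> hpart e x = if e == d then x else 0.
Proof.
move=> gx; pose c e' := if e' == d then x else 0.
apply: (@hpart_eq x [:: d] c); split=> // [d'|d'|].
- by rewrite /c; case: eqP => [->//|_]; exact: (gr_zero G).
- by rewrite inE /c => /negPf ->.
- by rewrite big_seq1 /c eqxx.
Qed.

Lemma hpartD d : {morph hpart d : x y / x + y}.
Proof.
move=> x y; have [D H] := hpartP x; have [D' H'] := hpartP y.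
pose E := undup (D ++ D').
have [||_ gc c0 xE] := hdecomp_widen (E := E) H; first exact: undup_uniq.
  by move=> e eD; rewrite mem_undup mem_cat eD.
have [||uE gc' c0' yE] := hdecomp_widen (E := E) H'; first exact: undup_uniq.
  by move=> e eD; rewrite mem_undup mem_cat eD orbT.
apply: (@hpart_eq _ E (fun e => hpart e x + hpart e y)); split=> // [e|e eE|].
- by apply: grD; exact: hpart_gr.
- by rewrite c0 // c0' // addr0.
- by rewrite big_split /= -xE -yE.
Qed.

Lemma hpart0 d : hpart d 0 = 0.
Proof. by apply: (addIr (hpart d 0)); rewrite -hpartD !add0r. Qed.

Lemma hpart_sum d (J : Type) (r : seq J) (F : J -> M) :
  hpart d (\sum_(j <- r) F j) = \sum_(j <- r) hpart d (F j).
Proof. exact: (big_morph _ (hpartD d) (hpart0 d)). Qed.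

Lemma hpartZ e a : Agr e a ->
  forall d x, hpart (d + e%:Z) (a *: x) = a *: hpart d x.
Proof.
move=> ga d x; have [D [_ _ _ xE]] := hpartP x.
rewrite [LHS](_ : _ = \sum_(d' <- D) hpart (d + e%:Z) (a *: hpart d' x));
  last first.
  by rewrite {1}xE scaler_sumr hpart_sum.
rewrite [in RHS]xE hpart_sum scaler_sumr; apply: eq_bigr => d' _.
rewrite (hpart_homog _ (gr_scale G ga (hpart_gr d' x))).
rewrite (hpart_homog _ (hpart_gr d' x)) (inj_eq (addIr _)).
by case: eqP => // _; rewrite scaler0.
Qed.
End HomogeneousParts.

Definition homog_map (A : pzRingType) (M : lmodType A) (N : zmodType)
    (s : GRing.Scale.law A N) (gM : int -> set M) (gN : int -> set N)
    (f : {linear M -> N | s}) : Prop :=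
  forall d x, gM d x -> gN d (f x).

Section HomogeneousMaps.
Context (k : fieldType) (A : algType k) (Agr : nat -> set A).
Hypothesis Aspan : homogeneous_span Agr.

(** The degree zero part is [x |-> \sum_d (h x_d)_d].  Its additivity comes from
    that of the homogeneous parts; as [A] is spanned by homogeneous elements,
    compatibility with scalars need only be checked on these, which shift the
    degrees of [x] and of [h x] alike. *)
Lemma degree0_part (M N : lmodType A) (gM : int -> set M) (gN : int -> set N)
    (GM : is_grading Agr gM) (GN : is_grading Agr gN) (h : {linear M -> N}) :
  exists2 h0 : {linear M -> N}, homog_map gM gN h0 &
    forall d x, gM d x -> h0 x = hpart GN d (h x).
Proof.
pose D x : seq int := sval (cid (hpartP GM x)).
have DP x : hdecomp gM x (D x) (hpart GM ^~ x) := svalP (cid (hpartP GM x)).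
pose t x d := hpart GN d (h (hpart GM d x)).
pose f x := \sum_(d <- D x) t x d.
have t0 x d : d \notin D x -> t x d = 0.
  by have [_ _ c0 _] := DP x => /c0 tE; rewrite /t tE linear0 hpart0.
have fE x E : uniq E -> {subset D x <= E} -> f x = \sum_(d <- E) t x d.
  by have [uD _ _ _] := DP x => uE sE; rewrite (sum_widen uD uE sE (t0 x)).
have tD x y d : t (x + y) d = t x d + t y d by rewrite /t hpartD linearD hpartD.
have fD x y : f (x + y) = f x + f y.
  pose E := undup (D (x + y) ++ D x ++ D y).
  have uE : uniq E by exact: undup_uniq.
  have s1 : {subset D (x + y) <= E} by move=> d dD; rewrite mem_undup mem_cat dD.
  have s2 : {subset D x <= E}.
    by move=> d dD; rewrite mem_undup !mem_cat dD !orbT.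
  have s3 : {subset D y <= E}.
    by move=> d dD; rewrite mem_undup !mem_cat dD !orbT.
  rewrite (fE _ _ uE s1) (fE _ _ uE s2) (fE _ _ uE s3).
  by rewrite -big_split; apply: eq_bigr => d _.
have f0 : f 0 = 0 by apply: (addIr (f 0)); rewrite -fD !add0r.
have fZ e a x : Agr e a -> f (a *: x) = a *: f x.
  move=> ga; pose E := undup (D (a *: x) ++ [seq d + e%:Z | d <- D x]).
  pose E' := [seq d - e%:Z | d <- E].
  have uE : uniq E by exact: undup_uniq.
  rewrite (@fE _ E) // => [|d dD]; last by rewrite mem_undup mem_cat dD.
  rewrite (@fE _ E') => [|| d dD].
  - rewrite big_map scaler_sumr; apply: eq_bigr => d _.
    by rewrite -{1}[d](subrK e%:Z) /t (hpartZ GM ga) linearZ (hpartZ GN ga).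
  - by rewrite map_inj_uniq //; exact: addIr.
  - apply/mapP; exists (d + e%:Z); last by rewrite addrK.
    by rewrite mem_undup mem_cat (map_f (fun d => d + e%:Z)) ?orbT.
have flin : linear f.
  move=> a x y; rewrite fD; congr (_ + _).
  have [E [c gc ->]] := Aspan a.
  rewrite !scaler_suml (big_morph _ fD f0); apply: eq_bigr => e _.
  exact: fZ (gc e).
have [h0 h0E] := linear_of_fun (s := *:%R) flin.
have h0P d x : gM d x -> h0 x = hpart GN d (h x).
  move=> gx; rewrite h0E (@fE x (undup (d :: D x))) ?undup_uniq //; last first.
    by move=> e eD; rewrite mem_undup inE eD orbT.
  rewrite (@sum_widen _ _ [:: d]) ?undup_uniq //; first last.
  - by move=> e; rewrite inE /t (hpart_homog GM _ gx) => /negPf ->;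
      rewrite linear0 hpart0.
  - by move=> e; rewrite inE => /eqP ->; rewrite mem_undup mem_head.
  by rewrite big_seq1 /t (hpart_homog GM _ gx) eqxx.
by exists h0 => // d x gx; rewrite (h0P d x gx); exact: hpart_gr.
Qed.

Lemma eq_on_homog (M : lmodType A) (N : zmodType) (s : GRing.Scale.law A N)
    (gM : int -> set M) (f g : {linear M -> N | s}) :
  is_grading Agr gM -> (forall d x, gM d x -> f x = g x) -> f =1 g.
Proof.
move=> GM fg x; have [D [c gc ->]] := gr_sum GM x.
by rewrite !linear_sum; apply: eq_bigr => d _; exact: fg (gc d).
Qed.

(** Graded projectivity for modules that are projective and graded: of a lift,
    the degree zero part is again a lift.  The last hypothesis says that the
    maps agree degree by degree; it holds for degree zero maps of graded
    modules and for an augmentation concentrated in degree zero. *)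
Lemma graded_projective_lift (M N : lmodType A) (N' : zmodType)
    (s : GRing.Scale.law A N') (gM : int -> set M) (gN : int -> set N)
    (GM : is_grading Agr gM) (GN : is_grading Agr gN)
    (f : {linear M -> N' | s}) (g : {linear N -> N' | s}) :
  projective M -> (forall x, exists y, f x = g y) ->
  (forall d x y, gM d x -> f x = g y -> f x = g (hpart GN d y)) ->
  exists2 h : {linear M -> N}, homog_map gM gN h & forall x, f x = g (h x).
Proof.
move=> Mproj fg fgd; have [h hE] := projective_lift Mproj fg.
have [h0 h0d h0E] := degree0_part GM GN h; exists h0 => // x.
apply: (@eq_on_homog M N' s gM f (g \o h0)) => // d z gz /=.
by rewrite (h0E d z gz); apply: (fgd d z) => //; rewrite hE.
Qed.

Lemma hpart_homog_map (N N' : lmodType A) (gN : int -> set N)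
    (gN' : int -> set N') (GN : is_grading Agr gN) (GN' : is_grading Agr gN')
    (g : {linear N -> N'}) : homog_map gN gN' g ->
  forall d y, g (hpart GN d y) = hpart GN' d (g y).
Proof.
move=> gd d y; have [D [uD gc c0 yE]] := hpartP GN y.
rewrite (@hpart_eq _ _ _ _ _ GN' (g y) D (fun e => g (hpart GN e y))) //.
split=> // [e|e eD|]; first exact: gd.
  by rewrite c0 // linear0.
by rewrite {1}yE linear_sum.
Qed.

Lemma graded_projective_lift_homog (M N N' : lmodType A) (gM : int -> set M)
    (gN : int -> set N) (gN' : int -> set N') (GM : is_grading Agr gM)
    (GN : is_grading Agr gN) (GN' : is_grading Agr gN')
    (f : {linear M -> N'}) (g : {linear N -> N'}) :
  projective M -> homog_map gM gN' f -> homog_map gN gN' g ->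
  (forall x, exists y, f x = g y) ->
  exists2 h : {linear M -> N}, homog_map gM gN h & forall x, f x = g (h x).
Proof.
move=> Mproj fd gd fg; apply: (graded_projective_lift GM (GN := GN) Mproj fg).
move=> d x y gx fxE.
rewrite (hpart_homog_map GN GN') // -fxE (hpart_homog GN' _ (fd d x gx)).
by rewrite eqxx.
Qed.
End HomogeneousMaps.

(** * Comparison of graded resolutions *)

Lemma linear_sum_ex (S : pzRingType) (M : lmodType S) (N : zmodType)
    (s : GRing.Scale.law S N) (J : Type) (r : seq J) (P : pred J)
    (F : J -> {linear M -> N | s}) :
  exists g : {linear M -> N | s}, forall x, g x = \sum_(j <- r | P j) F j x.
Proof.
elim: r => [|j r [g gE]]; first by exists \0 => x; rewrite big_nil.
have [Pj|nPj] := boolP (P j).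
  by exists (F j \+ g) => x; rewrite big_cons Pj /= gE.
by exists g => x; rewrite big_cons (negPf nPj).
Qed.

Section GradedHom.
Context (k : fieldType) (A : algType k) (M L : lmodType A) (N : zmodType)
  (s : GRing.Scale.law A N).
Context (gM : int -> set M) (gL : int -> set L) (gN : int -> set N).

Lemma graded_hom_comp (f : {linear M -> N | s}) (a : {linear L -> M}) :
  graded_hom gM gN f -> homog_map gL gM a -> graded_hom gL gN (f \o a).
Proof.
move=> [D [G Gd fE]] ad; exists D;
  exists (fun e => G e \o a) => /= [e d x eD gx|x].
  by apply: Gd => //; exact: ad.
exact: fE.
Qed.

Hypothesis gN0 : forall d, gN d 0.
Hypothesis gND : forall d x y, gN d x -> gN d y -> gN d (x + y).

Lemma graded_hom_sum (J : eqType) (r : seq J) (deg : J -> int)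
    (F : J -> {linear M -> N | s}) (f : {linear M -> N | s}) :
  (forall j d x, j \in r -> gM d x -> gN (d + deg j) (F j x)) ->
  (forall x, f x = \sum_(j <- r) F j x) -> graded_hom gM gN f.
Proof.
move=> Fd fE; exists (undup [seq deg j | j <- r]).
have /choice[G GE] e : exists g : {linear M -> N | s},
    forall x, g x = \sum_(j <- r | deg j == e) F j x by exact: linear_sum_ex.
exists G => [e d x _ gx|x].
  rewrite GE big_seq_cond; apply: big_ind => // [y z|j /andP[jr /eqP <-]].
    exact: gND.
  exact: Fd.
by under eq_bigr do rewrite GE; rewrite -sum_by_degree.
Qed.

Lemma graded_hom_add (f g h : {linear M -> N | s}) :
  graded_hom gM gN f -> graded_hom gM gN g -> (forall x, h x = f x + g x) ->
  graded_hom gM gN h.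
Proof.
move=> [D [G Gd fE]] [D' [G' Gd' gE]] hE.
pose deg (j : int + int) := match j with inl d => d | inr d => d end.
pose F (j : int + int) := match j with inl d => G d | inr d => G' d end.
apply: (@graded_hom_sum _ ([seq inl d | d <- D] ++ [seq inr d | d <- D']) deg F).
  move=> j d x; rewrite mem_cat => /orP[] /mapP[e eD ->] gx /=.
    exact: Gd.
  exact: Gd'.
by move=> x; rewrite big_cat !big_map hE fE gE.
Qed.
End GradedHom.

Section Comparison.
Context (k : fieldType) (A : algType k) (aug : {rmorphism A -> k}).
Context (Agr : nat -> set A) (Aspan : homogeneous_span Agr).

Lemma res_dd (P : resolution aug) n x : res_d P n (res_d P n.+1 x) = 0.
Proof. by apply/res_exact; exists x. Qed.

Lemma res_aug_d (P : resolution aug) x : res_aug P (res_d P 0%N x) = 0.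
Proof. by apply/res_exact0; exists x. Qed.

Lemma res_exactE (P : resolution aug) n x :
  res_d P n x = 0 -> exists y, x = res_d P n.+1 y.
Proof. by move/res_exact. Qed.

Lemma res_aug_hpart (P : gresolution aug Agr) d y :
  res_aug P (hpart (gres_grading P 0%N) d y)
  = if d == 0 then res_aug P y else 0.
Proof.
set GP := gres_grading P 0%N;
  have aug0 e : e != 0 -> res_aug P (hpart GP e y) = 0.
  by move=> e0; apply: (gres_aug (hpart_gr GP e y)).
case: (altP (d =P 0)) => [->|]; last exact: aug0.
have [D H] := hpartP GP y.
have [||uE _ _ yE] := hdecomp_widen (E := undup (0 :: D)) H.
- exact: undup_uniq.
- by move=> e eD; rewrite mem_undup inE eD orbT.
have E0 : 0 \in undup (0 :: D) by rewrite mem_undup mem_head.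
rewrite {2}yE linear_sum (bigD1_seq 0 E0 uE) /=.
by rewrite [X in _ + X]big1 ?addr0 // => e; exact: aug0.
Qed.

Lemma graded_comparison (P P' : gresolution aug Agr) :
  exists a : forall n, {linear P n -> P' n},
    [/\ forall n, homog_map (gr_ P n) (gr_ P' n) (a n),
        forall x, res_aug P' (a 0%N x) = res_aug P x
      & forall n x, a n (res_d P n x) = res_d P' n (a n.+1 x)].
Proof.
have [|d x y gx fxE|a0 a0d a0E] :=
  graded_projective_lift Aspan (gres_grading P 0%N) (GN := gres_grading P' 0%N)
    (f := res_aug P) (g := res_aug P') (@res_proj _ _ _ P 0%N).
- by move=> x; have [y] := res_surj P' (res_aug P x); exists y.
- rewrite res_aug_hpart -fxE; case: (altP (d =P 0)) => // d0.
  exact: (gres_aug gx).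
have [|||a [aE ad ac]] := chain_map_extend
  (good := fun n => homog_map (gr_ P n) (gr_ P' n))
  (a0 := a0) (@res_dd P) (@res_exactE P').
- move=> n a ad ex.
  have [| |x|b bd bE] := graded_projective_lift_homog Aspan (gres_grading P n.+1)
    (gres_grading P' n.+1) (gres_grading P' n) (f := a \o res_d P n)
    (g := res_d P' n) (@res_proj _ _ _ P n.+1).
  + by move=> d x gx /=; apply: ad; exact: gres_d.
  + by move=> d x; exact: gres_d.
  + exact: ex.
  by exists b.
- exact: a0d.
- by move=> x; apply/res_exact0; rewrite -a0E res_aug_d.
by exists a; split=> // x; rewrite aE.
Qed.

Lemma graded_null_homotopy (P P' : gresolution aug Agr)
    (phi : forall n, {linear P n -> P' n}) :
  (forall n, homog_map (gr_ P n) (gr_ P' n) (phi n)) ->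
  (forall x, res_aug P' (phi 0%N x) = 0) ->
  (forall n x, phi n (res_d P n x) = res_d P' n (phi n.+1 x)) ->
  exists h : forall n, {linear P n -> P' n.+1},
    [/\ forall n, homog_map (gr_ P n) (gr_ P' n.+1) (h n),
        forall x, phi 0%N x = res_d P' 0%N (h 0%N x)
      & forall n x,
          phi n.+1 x = res_d P' n.+1 (h n.+1 x) + h n (res_d P n x)].
Proof.
move=> phid phi0 phic.
apply: (null_homotopy_extend
  (good := fun m n => homog_map (gr_ P m) (gr_ P' n))
  (@res_dd P) (@res_exactE P') phic) => //.
- move=> n a ad ex.
  apply: (graded_projective_lift_homog Aspan (gres_grading P n)
    (gres_grading P' n.+1) (gres_grading P' n)) => //; first exact: res_proj.
  by move=> d x; exact: gres_d.
- move=> n h hd d x gx /=; apply: (gr_sub (gres_grading P' n.+1)).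
    exact: phid.
  by apply: hd; exact: gres_d.
- by move=> x; apply/res_exact0; exact: phi0.
Qed.

(** Two graded resolutions are homotopy equivalent; this is the half of the
    equivalence which concerns [P]. *)
Lemma graded_homotopy_id (P Q : gresolution aug Agr)
    (a : forall n, {linear P n -> Q n}) (b : forall n, {linear Q n -> P n}) :
  (forall n, homog_map (gr_ P n) (gr_ Q n) (a n)) ->
  (forall n, homog_map (gr_ Q n) (gr_ P n) (b n)) ->
  (forall x, res_aug Q (a 0%N x) = res_aug P x) ->
  (forall x, res_aug P (b 0%N x) = res_aug Q x) ->
  (forall n x, a n (res_d P n x) = res_d Q n (a n.+1 x)) ->
  (forall n x, b n (res_d Q n x) = res_d P n (b n.+1 x)) ->
  exists h : forall n, {linear P n -> P n.+1},
    [/\ forall n, homog_map (gr_ P n) (gr_ P n.+1) (h n),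
        forall x, x = b 0%N (a 0%N x) + res_d P 0%N (h 0%N x)
      & forall n x, x = b n.+1 (a n.+1 x)
          + (res_d P n.+1 (h n.+1 x) + h n (res_d P n x))].
Proof.
move=> ad bd a0 b0 ac bc.
have [||n x|h [hd h0 hE]] :=
    @graded_null_homotopy P P (fun n => idfun \- (b n \o a n)).
- move=> n d x gx /=; apply: (gr_sub (gres_grading P n)) => //.
  by apply: bd; exact: ad.
- by move=> x /=; rewrite linearB /= b0 a0 subrr.
- by rewrite /= linearB /= ac bc.
exists h; split=> // [x|n x].
  by rewrite -h0 /= addrC subrK.
by rewrite -hE /= addrC subrK.
Qed.
End Comparison.

(** * Transfer of generation along a comparison of resolutions *)

Lemma exts_eq (k : fieldType) (A : algType k) (aug : {rmorphism A -> k})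
    (P : resolution aug) (HC : forall n, set (cochain P n))
    (HM : forall m n, set {linear P m -> P n})
    (S : forall n, set (cochain P n)) (SP : ext_subalgebra HC HM S) n
    (f g : cochain P n) : S n f -> f =1 g -> S n g.
Proof.
by move=> Sf fg; apply: (exts_linear SP (c := 0) Sf Sf) => x;
  rewrite mul0r add0r fg.
Qed.

Section Transfer.
Context (k : fieldType) (A : algType k) (aug : {rmorphism A -> k}).
Context (Agr : nat -> set A) (Aspan : homogeneous_span Agr).
Context (P Q : gresolution aug Agr).
Hypothesis Qk : forall n (f : cochain Q n), gHC f.
Hypothesis QP : forall m n (F : {linear Q m -> P n}),
  graded_hom (gr_ Q m) (gr_ P n) F.

Lemma trivial_grD d (x y : k) :
  trivial_gr d x -> trivial_gr d y -> trivial_gr d (x + y).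
Proof. by move=> gx gy d0; rewrite gx // gy // addr0. Qed.

Lemma gHC_add n (f g h : cochain P n) :
  gHC f -> gHC g -> (forall x, h x = f x + g x) -> gHC h.
Proof. by apply: graded_hom_add; [by []|exact: trivial_grD]. Qed.

Lemma gHC_eq n (f g : cochain P n) : gHC f -> f =1 g -> gHC g.
Proof.
by move=> [D [G Gd fE]] fg; exists D; exists G => // x; rewrite -fg.
Qed.

(** With [a : P -> Q] and [b : Q -> P] inverse up to homotopy, the cocycles of
    [Q] whose pullbacks along [a] lie in the given subalgebra form a subalgebra:
    a product of [g] and [f] over [Q], made with a chain map [F], pulls back to
    the product made with [b F a], up to the coboundary coming from the homotopy
    between [a b] and the identity.  Every cocycle of [P] is cohomologous to a
    pullback, namely [f b a], through the other homotopy.  The hypotheses on [Q]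
    guarantee that the chain maps [b F a] and the pullbacks are graded. *)
Theorem ext_generated12_transfer :
  ext_generated12 (all_cochains Q) (all_maps Q) ->
  ext_generated12 (gHC_ P) (gHM_ P).
Proof.
have [a [ad a0 ac]] := graded_comparison Aspan P Q.
have [b [bd b0 bc]] := graded_comparison Aspan Q P.
have [h [hd h0 hE]] := graded_homotopy_id Aspan ad bd a0 b0 ac bc.
have [l [ld l0 lE]] := graded_homotopy_id Aspan bd ad b0 a0 bc ac.
have Pk n (f : cochain Q n) : gHC (f \o a n)
  by exact (graded_hom_comp (Qk f) (ad n)).
move=> Qgen S SP S1 S2.
pose SQ n : set (cochain Q n) :=
  [set f : cochain Q n | (forall x, f (res_d Q n x) = 0) /\ S n (f \o a n)].
have aC n (f : cochain Q n) : (forall x, f (res_d Q n x) = 0) ->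
    cocycle (gHC_ P) (f \o a n).
  by move=> fd; split=> [|x /=]; [exact: Pk|rewrite ac fd].
have SQP : ext_subalgebra (all_cochains Q) (all_maps Q) SQ.
  split.
  - by move=> n f [fd _].
  - split; first by move=> x; exact: res_aug_d.
    by apply: exts_eq SP _ _ _ (exts_unit SP) _ => x /=; rewrite a0.
  - move=> n f [_ fd] fB; split=> //; apply: (exts_coboundary SP);
      first exact: aC.
    case: n f fd fB => [|n] f fd /=; first by move=> f0 x; exact: f0.
    by case=> g _ fE; exists (g \o a n) => [|x /=]; [exact: Pk|rewrite fE ac].
  - move=> n c f g u [fd Sf] [gd Sg] uE; split=> [x|].
      by rewrite uE fd gd mulr0 addr0.
    by apply: (exts_linear SP (c := c) Sf Sg) => x /=; rewrite uE.
  - move=> n m g f u [gd Sg] [fd Sf] [F [_ F0 Fd uE]]; split.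
      by move=> x; rewrite uE Fd; exact: gd.
    have Suv : S (n + m)%N (g \o (a n \o (b n \o (F n \o a (n + m)%N)))).
      apply: (exts_prod SP Sg Sf); exists (fun i => b i \o (F i \o a (i + m)%N)).
      split=> //= [i|x|i x].
      + exact (graded_hom_comp (@QP _ _ (b i \o F i)) (ad (i + m)%N)).
      + by rewrite b0 F0.
      + by rewrite (ac (i + m)%N) Fd bc.
    pose v := g \o (a n \o (b n \o (F n \o a (n + m)%N))).
    have uvE (w : cochain P (n + m)%N) : S (n + m)%N w ->
        (forall x, u (a (n + m)%N x) = w x + v x) ->
          S (n + m)%N (u \o a (n + m)%N).
      move=> Sw uwv; apply: (exts_linear SP (c := 1) Sw Suv) => x /=.
      by rewrite mul1r uwv.
    case: n g u F @v gd Sg F0 Fd uE Suv uvE =>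
      [|n] g u F v gd Sg F0 Fd uE Suv uvE.
      apply: exts_eq SP _ _ _ Suv _ => x /=.
      by rewrite uE [in RHS](l0 (F 0%N (a m x))) linearD /= gd addr0.
    pose w : cochain P (n.+1 + m)%N :=
      (g \o (l n \o (F n \o a (n + m)%N))) \o res_d P (n + m).
    have wE x : w x = g (l n (F n (res_d Q (n + m) (a (n + m).+1 x)))).
      by rewrite /w /= (ac (n + m)%N).
    apply: (uvE w).
      apply: (exts_coboundary SP).
        split=> [|x]; last by rewrite /w /= res_dd !linear0.
        pose c := g \o (l n \o (F n \o res_d Q (n + m))).
        apply: (@gHC_eq _ (c \o a (n + m).+1)).
          exact: Pk.
        by move=> x; rewrite wE.
      exists (g \o (l n \o F n) \o a (n + m)%N) => //; exact: Pk.
    move=> x; rewrite wE uE {1}(lE n (F n.+1 (a (n + m).+1 x))) !linearD /=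
      gd add0r.
    by rewrite Fd addrC.
move=> n f [fH fd].
pose fb : cochain Q n := f \o b n.
have fbd x : fb (res_d Q n x) = 0 by rewrite /fb /= bc fd.
have [_ Sfb] : SQ n fb.
  apply: (Qgen SQ SQP) => [u [_ ud]|u [_ ud]|].
  - by split=> //; apply: S1; exact: aC.
  - by split=> //; apply: S2; exact: aC.
  - by split.
case: n f fH fd @fb fbd Sfb => [|n] f fH fd fb fbd Sfb.
  by apply: exts_eq SP _ _ _ Sfb _ => x;
    rewrite [in RHS](h0 x) linearD /= fd addr0.
pose e : cochain P n.+1 := (f \o h n) \o res_d P n.
have fhH : gHC (f \o h n) by exact (graded_hom_comp fH (hd n)).
have Se : S n.+1 e.
  apply: (exts_coboundary SP); last by exists (f \o h n).
  split=> [|x]; last by rewrite /e /= res_dd !linear0.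
  by apply: graded_hom_comp fhH _ => d x; exact: gres_d.
apply: (exts_linear SP (c := 1) Sfb Se) => x.
by rewrite mul1r {1}(hE n x) !linearD /= fd add0r.
Qed.

(** A cocycle [f] is cohomologous to [f b a], which is graded because it factors
    through [Q].  If a graded [f] is the coboundary of [g], then it is that of
    [g b a + f h], where [h] is the homotopy, and both terms are graded. *)
Theorem graded_ext_comparison n :
  (forall f : cochain P n, cocycle (all_cochains P) f ->
     exists g e : cochain P n,
       [/\ cocycle (gHC_ P) g,
           coboundary (all_cochains P) e
         & forall x, f x = g x + e x]) /\
  (forall f : cochain P n, cocycle (gHC_ P) f ->
     coboundary (all_cochains P) f -> coboundary (gHC_ P) f).
Proof.
have [a [ad a0 ac]] := graded_comparison Aspan P Q.
have [b [bd b0 bc]] := graded_comparison Aspan Q P.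
have [h [hd h0 hE]] := graded_homotopy_id Aspan ad bd a0 b0 ac bc.
have Pk n' (f : cochain Q n') : gHC (f \o a n')
  by exact (graded_hom_comp (Qk f) (ad n')).
split=> f [fH fd].
  exists ((f \o b n) \o a n).
  have gC : cocycle (gHC_ P) ((f \o b n) \o a n).
    by split=> [|x /=]; [exact: Pk|rewrite ac bc fd].
  case: n f {fH} fd gC => [|n] f fd gC.
    exists \0; split=> // x; rewrite {1}(h0 x) linearD /= fd.
    by rewrite addr0.
  exists ((f \o h n) \o res_d P n); split=> //; first by exists (f \o h n).
  by move=> x; rewrite {1}(hE n x) !linearD /= fd add0r.
case: n f fH fd => [//|n] f fH fd [g _ fE].
exists ((g \o b n) \o a n \+ (f \o h n)) => [|x].
  apply: (@gHC_add _ ((g \o b n) \o a n) (f \o h n)) => //.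
  exact (graded_hom_comp fH (hd n)).
by rewrite {1}(hE n x) !linearD /= fd add0r fE ac bc.
Qed.
End Transfer.

Section UngradedTransfer.
Context (k : fieldType) (A : algType k) (aug : {rmorphism A -> k}).

Definition deg0_only (e : nat) : set A := [set a | e != 0%N -> a = 0].

Definition mod_deg0_only (M : lmodType A) (d : int) : set M :=
  [set x | d != 0 -> x = 0].

Lemma mod_deg0_onlyP (M : lmodType A) : is_grading deg0_only (@mod_deg0_only M).
Proof.
split=> [d _ //|d x y gx gy d0|e d a x ga gx de0|x|D c uD gc S0 d dD].
- by rewrite gx // gy // subr0.
- have [e0|e0] := eqVneq e 0%N; last by rewrite (ga e0) scale0r.
  by rewrite gx ?scaler0 //; move: de0; rewrite e0 addr0.
- exists [:: 0], (fun d => if d == 0 then x else 0);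
    last by rewrite big_seq1 eqxx.
  by move=> d /negPf ->.
- have [d0|/gc//] := eqVneq d 0; move: S0 dD; rewrite {}d0 => S0 dD.
  by rewrite -S0 (bigD1_seq 0) //= [X in _ + X]big1 ?addr0.
Qed.

Lemma deg0_only_span : homogeneous_span deg0_only.
Proof.
move=> a; exists [:: 0%N], (fun e => if e == 0%N then a else 0).
  by move=> e /negPf ->.
by rewrite big_seq1.
Qed.

(** Every resolution is graded, over [A] placed in degree zero; all linear
    maps are then homogeneous of degree zero, so the graded comparison
    specializes to the classical one. *)
Definition degree0_resolution (P : resolution aug) : gresolution aug deg0_only.
Proof.
apply: (@GResolution _ _ _ _ P (fun n => @mod_deg0_only (P n))).
- by move=> n; exact: mod_deg0_onlyP.
- by move=> n d x gx d0; rewrite gx // linear0.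
- by move=> d x gx d0; rewrite gx // linear0.
Defined.

Lemma degree0_graded_hom (M : lmodType A) (N : zmodType)
    (s : GRing.Scale.law A N) (gN : int -> set N) (f : {linear M -> N | s}) :
  gN 0 = setT -> (forall d, gN d 0) ->
  graded_hom (@mod_deg0_only M) gN f.
Proof.
move=> gN0 gNd; exists [:: 0]; exists (fun=> f) => [e d x|x];
  last by rewrite big_seq1.
rewrite inE => /eqP -> gx; rewrite addr0.
by have [->|d0] := eqVneq d 0; [rewrite gN0|rewrite (gx d0) linear0].
Qed.

Theorem K2_transfer (Q : resolution aug) :
  ext_generated12 (all_cochains Q) (all_maps Q) ->
  K2_algebra aug.
Proof.
have at0 (X : zmodType) : [set x : X | (0 : int) != 0 -> x = 0] = setT.
  by apply/seteqP; split=> x _ //; rewrite /= eqxx.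
have gk (P : resolution aug) n (f : cochain P n) :
    graded_hom (@mod_deg0_only (P n)) (@trivial_gr k) f.
  by apply: degree0_graded_hom; [exact: at0|].
have gM (P P' : resolution aug) m n (f : {linear P m -> P' n}) :
    graded_hom (@mod_deg0_only (P m)) (@mod_deg0_only (P' n)) f.
  by apply: degree0_graded_hom; [exact: at0|].
move=> Qgen P.
have HCE : (all_cochains P) = gHC_ (degree0_resolution P).
  by apply: functional_extensionality_dep => n; apply/seteqP; split=> f _;
    [exact: gk|].
have HME : (all_maps P)
    = gHM_ (degree0_resolution P).
  apply: functional_extensionality_dep => m.
  apply: functional_extensionality_dep => n.
  by apply/seteqP; split=> f _; [exact: gM|].
suff: ext_generated12 (gHC_ (degree0_resolution P))
    (gHM_ (degree0_resolution P)) by rewrite -HCE -HME.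
have Qk n (f : cochain (degree0_resolution Q) n) : gHC f by exact: gk.
have QP m n (F : {linear degree0_resolution Q m -> degree0_resolution P n}) :
    graded_hom (gr_ (degree0_resolution Q) m)
      (gr_ (degree0_resolution P) n) F by exact: gM.
exact: (ext_generated12_transfer deg0_only_span Qk QP Qgen).
Qed.
End UngradedTransfer.

(** * Subspaces of the tensor algebra *)

Definition subspace (S : pzRingType) (M : lmodType S) (W : set M) : Prop :=
  W 0 /\ forall c x y, W x -> W y -> W (c *: x + y).

Section Subspace.
Context (S : pzRingType) (M : lmodType S).
Implicit Types W X : set M.

Lemma subspaceP W c x y : subspace W -> W x -> W y -> W (c *: x + y).
Proof. by move=> [_]; apply. Qed.

Lemma subspaceD W x y : subspace W -> W x -> W y -> W (x + y).
Proof. by move=> [_ WP] Wx Wy; rewrite -[x]scale1r; exact: WP. Qed.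

Lemma subspaceZ W c x : subspace W -> W x -> W (c *: x).
Proof. by move=> [W0 WP] Wx; rewrite -[_ *: _]addr0; exact: WP. Qed.

Lemma subspaceB W x y : subspace W -> W x -> W y -> W (x - y).
Proof.
by move=> sW Wx Wy; rewrite -scaleN1r; apply: subspaceD => //; exact: subspaceZ.
Qed.

Lemma subspace_sum W (J : Type) (r : seq J) (P : pred J) (F : J -> M) :
  subspace W -> (forall j, P j -> W (F j)) -> W (\sum_(j <- r | P j) F j).
Proof.
move=> sW WF; apply: big_ind => //; first by case: sW.
by move=> x y; exact: subspaceD.
Qed.

Lemma subspace_sum_seq W (J : eqType) (r : seq J) (F : J -> M) :
  subspace W -> (forall j, j \in r -> W (F j)) -> W (\sum_(j <- r) F j).
Proof.
by move=> sW WF; rewrite big_seq_cond; apply: subspace_sum => // j /andP[/WF].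
Qed.

Lemma subspaceI W X : subspace W -> subspace X -> subspace (W `&` X).
Proof.
move=> [W0 WP] [X0 XP]; split=> [|c x y [Wx Xx] [Wy Xy]]; first by split.
by split; [exact: WP|exact: XP].
Qed.

Lemma subspace_lspan X : subspace (lspan X).
Proof.
split=> [|c x y [s sX ->] [t tX ->]]; first by exists [::]; rewrite ?big_nil.
exists ([seq (c * u.1, u.2) | u <- s] ++ t) => [u|].
  by rewrite mem_cat => /orP[/mapP[v /sX Xv ->]|/tX].
rewrite big_cat big_map scaler_sumr; congr (_ + _).
by apply: eq_bigr => u _; rewrite scalerA.
Qed.

Lemma lspan_gen X x : X x -> lspan X x.
Proof.
move=> Xx; exists [:: (1, x)]; last by rewrite big_seq1 scale1r.
by move=> t; rewrite inE => /eqP ->.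
Qed.

Lemma lspan_min W X : subspace W -> X `<=` W -> lspan X `<=` W.
Proof.
move=> sW XW x [s sX ->]; apply: subspace_sum_seq => // t /sX /XW Wt.
exact: subspaceZ.
Qed.

Lemma subspace_preim (N : lmodType S) (f : N -> M) W :
  linear f -> subspace W -> subspace [set x | W (f x)].
Proof.
move=> fL sW; have f0 : f 0 = 0.
  by have := fL (-1) 0 0; rewrite !scaleN1r oppr0 addr0 addNr.
split=> [|c x y Wx Wy] /=; first by rewrite f0; case: sW.
by rewrite fL; exact: subspaceP.
Qed.

Lemma subspace_eq (N : lmodType S) (f g : N -> M) :
  linear f -> linear g -> subspace [set x | f x = g x].
Proof.
move=> fL gL; have sub0 : subspace [set (0 : M)].
  by split=> // c x y -> ->; rewrite scaler0 addr0.
have fgL : linear (fun x => f x - g x).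
  by move=> c x y; rewrite fL gL scalerBr opprD addrACA.
suff -> : [set x | f x = g x] = [set x | [set 0] (f x - g x)].
  exact: subspace_preim.
by apply/seteqP; split=> x /= fg; [rewrite fg subrr|exact: subr0_eq].
Qed.
End Subspace.

Lemma linear_comp (S : pzRingType) (M N L : lmodType S) (f : N -> L)
    (g : M -> N) :
  linear f -> linear g -> linear (fun x => f (g x)).
Proof. by move=> fL gL c x y; rewrite gL fL. Qed.

Lemma linear_fun0 (S : pzRingType) (M N : lmodType S) :
  linear (fun _ : M => 0 : N).
Proof. by move=> c x y; rewrite scaler0 addr0. Qed.

Lemma linear_if (S : pzRingType) (M N : lmodType S) (b : bool) (f : M -> N) :
  linear f -> linear (fun x => if b then f x else 0).
Proof. by case: b => // _; exact: linear_fun0. Qed.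

Section TensorWords.
Context (k : fieldType) (I : choiceType).
Local Notation T := (tensor_alg k I).
Local Notation word := {fmonom I}.
Local Notation one := (@mone word).
Implicit Types (W X Y : set T) (x y z : T) (w : word).

Lemma wordM w w' : << w >> * << w' >> = << mmul w w' >> :> T.
Proof. by rewrite malgM_def fgmulUU mulr1. Qed.

Lemma subspace_words W : subspace W -> (forall w, W << w >>) -> forall x, W x.
Proof.
move=> sW Ww x; rewrite (monalgE x); apply: subspace_sum => // w _.
have -> : << x@_w *g w >> = x@_w *: << w >> :> T.
  apply/malgP => u; rewrite mcoeffU mcoeffZ mcoeffU.
  by case: eqP => _; rewrite ?mulr1 ?mulr0.
exact: subspaceZ.
Qed.

Lemma mull_linear y : linear (fun x => x * y).
Proof. by move=> c u v; rewrite mulrDl -scalerAl. Qed.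

Lemma mcoeff_linear w : linear (fun x : T => x@_w : k^o).
Proof. by move=> c x y; rewrite mcoeffD mcoeffZ. Qed.

Lemma malg_scalerAr (c : k) x y : x * (c *: y) = c *: (x * y).
Proof.
move: x; apply: subspace_words => [|w].
  apply: subspace_eq; first exact: mull_linear.
  apply: (linear_comp (g := fun x => x * y)); last exact: mull_linear.
  by move=> a u v; rewrite scalerDr !scalerA mulrC.
have comm : << w >> * c%:MP = c%:MP * << w >> :> T.
  by rewrite !malgM_def !fgmulUU mulr1 mul1r mulm1 mul1m.
rewrite -[c *: y]mul_malgC -[c *: (_ * y)]mul_malgC !mulrA.
exact: (congr1 (fun z => z * y) comm).
Qed.

Lemma mulr_linear x : linear (fun y => x * y).
Proof. by move=> c u v; rewrite mulrDr malg_scalerAr. Qed.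

Lemma tprod_mem W X x y : W x -> X y -> tprod W X (x * y).
Proof. by move=> Wx Xy; apply: lspan_gen; exists x => //; exists y. Qed.

Lemma subspace_tprod W X : subspace (tprod W X).
Proof. exact: subspace_lspan. Qed.

Lemma tprod_min W X Y : subspace Y -> (forall x y, W x -> X y -> Y (x * y)) ->
  tprod W X `<=` Y.
Proof.
by move=> sY WXY; apply: lspan_min => // _ [x Wx [y Xy <-]]; exact: WXY.
Qed.

Lemma tprodS W W' X X' : W `<=` W' -> X `<=` X' -> tprod W X `<=` tprod W' X'.
Proof.
move=> sW sX; apply: tprod_min; first exact: subspace_tprod.
by move=> x y /sW Wx /sX Xy; exact: tprod_mem.
Qed.

(** Bilinearity of the product, in the form which reduces an inclusion of products
    to generators of the factors. *)
Lemma subspace_mull Y y : subspace Y -> subspace [set x : T | Y (x * y)].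
Proof. exact: subspace_preim (@mull_linear y). Qed.

Lemma subspace_mulr Y x : subspace Y -> subspace [set y : T | Y (x * y)].
Proof. exact: subspace_preim (@mulr_linear x). Qed.

Lemma tprodA W X Y : tprod W (tprod X Y) = tprod (tprod W X) Y.
Proof.
apply/seteqP; split; apply: tprod_min; try exact: subspace_tprod.
- move=> x y Wx; move: y; apply: tprod_min => [|y z Xy Yz].
    by apply: subspace_mulr; exact: subspace_tprod.
  by rewrite /= mulrA; apply: tprod_mem => //; exact: tprod_mem.
- move=> x y Hx Yy; move: x Hx; apply: tprod_min => [|x z Wx Xz].
    by apply: subspace_mull; exact: subspace_tprod.
  by rewrite /= -mulrA; apply: tprod_mem => //; exact: tprod_mem.
Qed.

Local Notation ksub := (lspan [set (1 : T)]).

Lemma ksubP x : ksub x <-> exists c, x = c *: 1.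
Proof.
split=> [|[c ->]]; last first.
  by apply: subspaceZ; [exact: subspace_lspan|exact: lspan_gen].
case=> s s1 ->; exists (\sum_(t <- s) t.1); rewrite scaler_suml.
by apply: eq_big_seq => t /s1 ->.
Qed.

Lemma tprod1l W : subspace W -> tprod ksub W = W.
Proof.
move=> sW; apply/seteqP; split.
  apply: tprod_min => // _ y /ksubP[c ->] Wy.
  by rewrite -scalerAl mul1r; exact: subspaceZ.
by move=> x Wx; rewrite -[x]mul1r; apply: tprod_mem => //; exact: lspan_gen.
Qed.

Lemma tprod1r W : subspace W -> tprod W ksub = W.
Proof.
move=> sW; apply/seteqP; split.
  apply: tprod_min => // y _ Wy /ksubP[c ->].
  by rewrite malg_scalerAr mulr1; exact: subspaceZ.
by move=> x Wx; rewrite -[x]mulr1; apply: tprod_mem => //; exact: lspan_gen.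
Qed.

Lemma tpowS W n : tpow W n.+1 = tprod W (tpow W n). Proof. by []. Qed.

Lemma subspace_tpow W n : subspace (tpow W n).
Proof. by case: n => [|n]; exact: subspace_lspan. Qed.

Lemma tpow1 W : subspace W -> tpow W 1 = W. Proof. exact: tprod1r. Qed.

Lemma tpowSr W n : subspace W -> tpow W n.+1 = tprod (tpow W n) W.
Proof.
move=> sW; elim: n => [|n IH]; first by rewrite tpow1 // tprod1l.
by rewrite tpowS {1}IH tprodA.
Qed.

Lemma tpowD W m n : subspace W -> tprod (tpow W m) (tpow W n) = tpow W (m + n).
Proof.
move=> sW; elim: m => [|m IH]; first by rewrite tprod1l //; exact: subspace_tpow.
by rewrite tpowS -tprodA IH.
Qed.

Lemma subspace_Vsub : subspace (@Vsub k I). Proof. exact: subspace_lspan. Qed.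

(** ** Stripping a letter off a word *)

(** The linear map dual to an injection [f] of words, a left inverse of which
    is [g]: it keeps the words in the image of [f]. *)
Definition strip (f g : word -> word) x : T :=
  [malg w in [fset g u | u in msupp x]%fset => x@_(f w)].

Definition stripl i := strip (mmul (fmu i)) (fun w => FMonom (behead w)).
Definition stripr i :=
  strip (mmul^~ (fmu i)) (fun w => FMonom (rev (behead (rev w)))).

Lemma stripE f g : cancel f g -> forall x w, (strip f g x)@_w = x@_(f w).
Proof.
move=> fK x w; rewrite /strip mcoeffE; case: ifP => // /negP nw.
apply/esym/mcoeff_outdom/negP => fw; apply: nw.
by apply/imfsetP; exists (f w); rewrite ?fK.
Qed.

Lemma striplE i x w : (stripl i x)@_w = x@_(mmul (fmu i) w).
Proof. by apply: stripE => v; apply: val_inj; rewrite /= fmM fmU. Qed.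

Lemma striprE i x w : (stripr i x)@_w = x@_(mmul w (fmu i)).
Proof.
apply: stripE => v; apply: val_inj.
by rewrite /= fmM fmU rev_cat /= revK.
Qed.

Lemma stripl_linear i : linear (stripl i).
Proof.
by move=> c x y; apply/malgP => w;
  rewrite mcoeffD mcoeffZ !striplE mcoeffD mcoeffZ.
Qed.

Lemma stripr_linear i : linear (stripr i).
Proof.
by move=> c x y; apply/malgP => w;
  rewrite mcoeffD mcoeffZ !striprE mcoeffD mcoeffZ.
Qed.

HB.instance Definition _ i :=
  GRing.isLinear.Build k T T *:%R (stripl i) (stripl_linear i).
HB.instance Definition _ i :=
  GRing.isLinear.Build k T T *:%R (stripr i) (stripr_linear i).

Lemma gen_mul_coef1 i x : (gen k i * x)@_one = 0.
Proof.
move: x; apply: subspace_words => [|w].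
  apply: (@subspace_eq _ k^o); last exact: linear_fun0.
  exact: linear_comp (@mcoeff_linear one) (@mulr_linear _).
by rewrite wordM mcoeffU1 fmP fmM fmU fm1.
Qed.

Lemma mul_gen_coef1 i x : (x * gen k i)@_one = 0.
Proof.
move: x; apply: subspace_words => [|w].
  apply: (@subspace_eq _ k^o); last exact: linear_fun0.
  exact: linear_comp (@mcoeff_linear one) (@mull_linear _).
by rewrite wordM mcoeffU1 fmP fmM fmU fm1; case: (w : seq I).
Qed.

Lemma stripl_gen i j x : stripl i (gen k j * x) = if i == j then x else 0.
Proof.
move: x; apply: subspace_words => [|w].
  apply: subspace_eq; last by apply: linear_if.
  exact: linear_comp (@stripl_linear i) (@mulr_linear _).
apply/malgP => v; rewrite striplE wordM mcoeffU1 fmP !fmM !fmU /= eqseq_cons.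
rewrite [j == i]eq_sym; case: eqP => _ /=; last by rewrite mcoeff0.
by rewrite mcoeffU1 fmP.
Qed.

Lemma stripr_gen i j x : stripr i (x * gen k j) = if i == j then x else 0.
Proof.
move: x; apply: subspace_words => [|w].
  apply: subspace_eq; last by apply: linear_if.
  exact: linear_comp (@stripr_linear i) (@mull_linear _).
apply/malgP => v; rewrite striprE wordM mcoeffU1 fmP !fmM !fmU !cats1 eqseq_rcons.
rewrite [j == i]eq_sym; case: (i == j); last by rewrite andbF mcoeff0.
by rewrite andbT mcoeffU1 fmP.
Qed.

Lemma word_cons w j (w' : seq I) : (w : seq I) = j :: w' ->
  << w >> = gen k j * << FMonom w' >> :> T.
Proof.
by move=> wE; rewrite wordM; congr << _ >>; apply: val_inj; rewrite /= fmM fmU wE.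
Qed.

(** Left stripping is a derivation twisted by the augmentation. *)
Lemma striplM i x y : stripl i (x * y) = stripl i x * y + x@_one *: stripl i y.
Proof.
move: x; apply: subspace_words => [|w].
  apply: subspace_eq.
    exact: linear_comp (@stripl_linear i) (@mull_linear _).
  have L1 := linear_comp (@mull_linear y) (@stripl_linear i).
  have L2 : linear (fun x : T => x@_one *: stripl i y).
    by move=> c u v; rewrite mcoeffD mcoeffZ scalerDl scalerA.
  by move=> c u v; rewrite L1 L2 scalerDr addrACA.
case wE: (w : seq I) => [|j w'].
  have -> : << w >> = 1 :> T.
    by congr << _ >>; apply: val_inj; rewrite /= wE fm1.
  rewrite mul1r mcoeff1 eqxx scale1r.
  suff -> : stripl i 1 = 0 by rewrite mul0r add0r.
  by apply/malgP => v; rewrite striplE mcoeff1 mcoeff0 fmP fmM fmU fm1.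
rewrite (word_cons wE) gen_mul_coef1 [X in X * y + _]stripl_gen.
rewrite -[in LHS]mulrA [LHS]stripl_gen.
by case: ifP => _; rewrite ?mul0r scale0r addr0.
Qed.

Lemma stripl_eq0 x : x@_one = 0 -> (forall i, stripl i x = 0) -> x = 0.
Proof.
move=> x1 xs; apply/malgP => w; rewrite mcoeff0.
case wE: (w : seq I) => [|j w'].
  by rewrite (_ : w = one) //; apply: val_inj; rewrite /= wE fm1.
rewrite (_ : w = mmul (fmu j) (FMonom w')) -?striplE ?xs ?mcoeff0 //.
by apply: val_inj; rewrite /= fmM fmU wE.
Qed.

Lemma stripr_eq0 x : x@_one = 0 -> (forall i, stripr i x = 0) -> x = 0.
Proof.
move=> x1 xs; apply/malgP => w; rewrite mcoeff0.
case/lastP wE: (w : seq I) => [|w' j].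
  by rewrite (_ : w = one) //; apply: val_inj; rewrite /= wE fm1.
rewrite (_ : w = mmul (FMonom w') (fmu j)) -?striprE ?xs ?mcoeff0 //.
by apply: val_inj; rewrite /= fmM fmU wE cats1.
Qed.

Lemma mem_gen i : @Vsub k I (gen k i).
Proof. by apply: lspan_gen; exists i. Qed.

Section FiniteAlphabet.
Context (eI : seq I) (eI_uniq : uniq eI) (eI_all : forall i, i \in eI).

Lemma sum_pred1_letter i (F : I -> T) :
  \sum_(j <- eI) (if i == j then F j else 0) = F i.
Proof.
rewrite (bigD1_seq i) //= eqxx big1 ?addr0 // => j.
by rewrite eq_sym => /negPf ->.
Qed.

Lemma stripl_sum x : x@_one = 0 -> x = \sum_(i <- eI) gen k i * stripl i x.
Proof.
move=> x1; apply/eqP; rewrite -subr_eq0; apply/eqP; apply: stripl_eq0 => [|i].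
  rewrite mcoeffB x1 raddf_sum big1 ?subr0 // => i _.
  exact: gen_mul_coef1.
rewrite linearB /= linear_sum /= (eq_bigr _ (fun j _ => stripl_gen _ _ _)).
by rewrite sum_pred1_letter subrr.
Qed.

Lemma stripr_sum x : x@_one = 0 -> x = \sum_(i <- eI) stripr i x * gen k i.
Proof.
move=> x1; apply/eqP; rewrite -subr_eq0; apply/eqP; apply: stripr_eq0 => [|i].
  rewrite mcoeffB x1 raddf_sum big1 ?subr0 // => i _.
  exact: mul_gen_coef1.
rewrite linearB /= linear_sum /= (eq_bigr _ (fun j _ => stripr_gen _ _ _)).
by rewrite sum_pred1_letter subrr.
Qed.

(** Testing membership in [V (x) W] one letter at a time is what makes the tensor
    product with [V] commute with intersections. *)
Lemma tprod_VlP W x : subspace W ->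
  (tprod (@Vsub k I) W x <-> x@_one = 0 /\ forall i, W (stripl i x)).
Proof.
move=> sW; split=> [|[x1 Wx]]; last first.
  rewrite (stripl_sum x1); apply: subspace_sum; first exact: subspace_tprod.
  by move=> i _; apply: tprod_mem; [exact: mem_gen|].
pose Y : set T := [set x : T | x@_one = 0 /\ forall i, W (stripl i x)].
have sY : subspace Y.
  split=> [|c y z [y1 Wy] [z1 Wz]].
    by split=> [|i]; rewrite ?mcoeff0 ?linear0 //; case: sW.
  split=> [|i]; first by rewrite mcoeffD mcoeffZ y1 z1 mulr0 addr0.
  by rewrite linearP; exact: (subspaceP c sW (Wy i) (Wz i)).
move: x; apply: tprod_min => // v y Vv Wy; move: v Vv.
apply: (lspan_min (W := [set v | Y (v * y)])); first exact: subspace_mull.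
move=> _ [j _ <-]; split=> [|i]; first exact: gen_mul_coef1.
by rewrite stripl_gen; case: ifP => // _; case: sW.
Qed.

Lemma tprod_VrP W x : subspace W ->
  (tprod W (@Vsub k I) x <-> x@_one = 0 /\ forall i, W (stripr i x)).
Proof.
move=> sW; split=> [|[x1 Wx]]; last first.
  rewrite (stripr_sum x1); apply: subspace_sum; first exact: subspace_tprod.
  by move=> i _; apply: tprod_mem; [|exact: mem_gen].
pose Y : set T := [set x : T | x@_one = 0 /\ forall i, W (stripr i x)].
have sY : subspace Y.
  split=> [|c y z [y1 Wy] [z1 Wz]].
    by split=> [|i]; rewrite ?mcoeff0 ?linear0 //; case: sW.
  split=> [|i]; first by rewrite mcoeffD mcoeffZ y1 z1 mulr0 addr0.
  by rewrite linearP; exact: (subspaceP c sW (Wy i) (Wz i)).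
move: x; apply: tprod_min => // y v Wy; move: v.
apply: (lspan_min (W := [set v | Y (y * v)])); first exact: subspace_mulr.
move=> _ [j _ <-]; split=> [|i]; first exact: mul_gen_coef1.
by rewrite stripr_gen; case: ifP => // _; case: sW.
Qed.

Local Notation V := (@Vsub k I).

Lemma tprod_VlI W X : subspace W -> subspace X ->
  tprod V W `&` tprod V X = tprod V (W `&` X).
Proof.
move=> sW sX; have sI := subspaceI sW sX; apply/seteqP; split=> x.
  move=> [/(tprod_VlP _ sW)[x1 Wx] /(tprod_VlP _ sX)[_ Xx]].
  by apply/tprod_VlP => //; split=> // i; split.
move/(tprod_VlP _ sI) => [x1 H]; split; apply/tprod_VlP => //; split=> // i;
  by case: (H i).
Qed.

Lemma tprod_VrI W X : subspace W -> subspace X ->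
  tprod W V `&` tprod X V = tprod (W `&` X) V.
Proof.
move=> sW sX; have sI := subspaceI sW sX; apply/seteqP; split=> x.
  move=> [/(tprod_VrP _ sW)[x1 Wx] /(tprod_VrP _ sX)[_ Xx]].
  by apply/tprod_VrP => //; split=> // i; split.
move/(tprod_VrP _ sI) => [x1 H]; split; apply/tprod_VrP => //; split=> // i;
  by case: (H i).
Qed.

(** One side after the other, and on each side one letter at a time. *)
Lemma tprod_tpowI l m W X : subspace W -> subspace X ->
  tprod (tpow V l) (tprod W (tpow V m)) `&` tprod (tpow V l) (tprod X (tpow V m))
  = tprod (tpow V l) (tprod (W `&` X) (tpow V m)).
Proof.
move=> sW sX.
have right : forall W X : set T, subspace W -> subspace X ->
    tprod W (tpow V m) `&` tprod X (tpow V m) = tprod (W `&` X) (tpow V m).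
  elim: m => [|m IH] {sW sX}W {}X sW sX.
    by rewrite !tprod1r //; exact: subspaceI.
  by rewrite tpowS !tprodA IH ?tprod_VrI //; exact: subspace_tprod.
rewrite -right //; elim: l => [|l IH].
  rewrite !tprod1l //; try exact: subspace_tprod.
  by apply: subspaceI; exact: subspace_tprod.
rewrite tpowS -!tprodA tprod_VlI ?IH //; exact: subspace_tprod.
Qed.
End FiniteAlphabet.
End TensorWords.

(** * Families independent over the scalars and over the algebra *)

Section FreeFamilies.
Context (k : fieldType) (T : lalgType k).

Definition scalmx m n (N : 'M[k]_(m, n)) : 'M[T]_(m, n) := map_mx (in_alg T) N.

Definition kfree n (b : 'cV[T]_n) : Prop :=
  forall u : 'rV[k]_n, scalmx u *m b = 0 -> u = 0.

(** Independence over [T] acting on the left: the left ideal generated by the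
    entries is free on them. *)
Definition ltfree n (b : 'cV[T]_n) : Prop :=
  forall u : 'rV[T]_n, u *m b = 0 -> u = 0.

Definition kspan n (b : 'cV[T]_n) : set T :=
  [set x | exists u : 'rV[k]_n, x = \sum_i u 0 i *: b i 0].

Lemma scalmx_mulE m n p (N : 'M[k]_(m, n)) (b : 'M[T]_(n, p)) i j :
  (scalmx N *m b) i j = \sum_l N i l *: b l j.
Proof. by rewrite mxE; apply: eq_bigr => l _; rewrite mxE mulr_algl. Qed.

Lemma scalmxM m n p (N : 'M[k]_(m, n)) (X : 'M[k]_(n, p)) :
  scalmx (N *m X) = scalmx N *m scalmx X.
Proof. exact: map_mxM. Qed.

Lemma scalmx_sum (J : finType) m n (N : J -> 'M[k]_(m, n)) :
  scalmx (\sum_j N j) = \sum_j scalmx (N j).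
Proof. exact: raddf_sum. Qed.

Lemma scalmx1 n : scalmx 1%:M = 1%:M :> 'M[T]_n.
Proof. exact: map_mx1. Qed.

Lemma scalmx0 m n : scalmx 0 = 0 :> 'M[T]_(m, n).
Proof. exact: map_mx0. Qed.

Lemma rV_eq0 (R : pzRingType) m n (A : 'M[R]_(m, n)) :
  (forall i, row i A = 0) -> A = 0.
Proof. by move=> A0; apply/row_matrixP => i; rewrite A0 row0. Qed.

Lemma col_mx_eq0 (R : pzRingType) m n (A : 'M[R]_(m, n)) :
  (forall j, col j A = 0) -> A = 0.
Proof.
move=> A0; apply/matrixP => i j; have /matrixP/(_ i 0) := A0 j.
by rewrite !mxE.
Qed.

Lemma ltfree_inj n (b : 'cV[T]_n) m (U U' : 'M[T]_(m, n)) :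
  ltfree b -> U *m b = U' *m b -> U = U'.
Proof.
move=> bF UU'; apply/eqP; rewrite -subr_eq0; apply/eqP; apply: rV_eq0 => i.
by apply: bF; rewrite -row_mul mulmxBl UU' subrr row0.
Qed.

Lemma kfree_mx n (b : 'cV[T]_n) m (N : 'M[k]_(m, n)) :
  kfree b -> scalmx N *m b = 0 -> N = 0.
Proof.
move=> bF Nb; apply: rV_eq0 => i; apply: bF.
by rewrite /scalmx map_row -row_mul Nb row0.
Qed.

Lemma kspan_gen n (b : 'cV[T]_n) i : kspan b (b i 0).
Proof.
exists (delta_mx 0 i); rewrite (bigD1 i) //= mxE !eqxx scale1r.
rewrite big1 ?addr0 // => j.
by move=> /negPf ji; rewrite mxE ji andbF scale0r.
Qed.

Lemma kspan_mx m n p (b : 'cV[T]_n) (M : 'M[T]_(m, p)) :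
  (forall i j, kspan b (M i j)) ->
  exists N : 'I_p -> 'M[k]_(m, n), forall j, col j M = scalmx (N j) *m b.
Proof.
move=> Mb; have /choice[u uE] (ij : 'I_m * 'I_p) : exists u : 'rV[k]_n,
  M ij.1 ij.2 = \sum_l u 0 l *: b l 0 by exact: Mb.
exists (fun j => \matrix_(i, l) u (i, j) 0 l) => j; apply/matrixP => i z.
rewrite ord1 scalmx_mulE mxE (uE (i, j)); apply: eq_bigr => l _.
by rewrite mxE.
Qed.

(** Transposed, the hypothesis says that the row spaces of the matrices [(N j)^T]
    together span everything, so the identity is a combination of their rows. *)
Lemma joint_right_inverse m n p (N : 'I_p -> 'M[k]_(m, n)) :
  (forall u : 'rV[k]_m, (forall j, u *m N j = 0) -> u = 0) ->
  exists X : 'I_p -> 'M[k]_(n, m), \sum_j N j *m X j = 1%:M.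
Proof.
move=> Ninj; pose S := (\sum_j <<(N j)^T>>)%MS.
have S1 : (1%:M <= S)%MS.
  rewrite submxE mul1mx; apply/eqP; apply: trmx_inj; rewrite trmx0.
  apply: rV_eq0 => i; apply: Ninj => j; rewrite -row_mul -[N j]trmxK -trmx_mul.
  suff -> : (N j)^T *m cokermx S = 0 by rewrite trmx0 row0.
  by apply/eqP; rewrite -submxE (sumsmx_sup j) // genmxE.
have /sub_sumsmxP[U UE] := S1.
have /choice[Y YE] j : exists Y, <<(N j)^T>>%MS = Y *m (N j)^T.
  by apply/submxP; rewrite genmxE.
exists (fun j => (U j *m Y j)^T); apply: trmx_inj; rewrite trmx1 UE raddf_sum /=.
by apply: eq_bigr => j _; rewrite YE trmx_mul trmxK mulmxA.
Qed.

(** A row killed by all of the coefficient matrices kills [M], hence [M *m b].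
    The splitting obtained from its independence serves twice: it makes [M *m b]
    independent over [T], and it makes products of cochains surjective. *)
Lemma coefficient_inverse m n p (a : 'cV[T]_n) (b : 'cV[T]_p)
    (M : 'M[T]_(m, p)) (N : 'I_p -> 'M[k]_(m, n)) :
  (forall j, col j M = scalmx (N j) *m a) -> kfree (M *m b) ->
  exists X : 'I_p -> 'M[k]_(n, m), \sum_j N j *m X j = 1%:M.
Proof.
move=> NE Mb; apply: joint_right_inverse => u uN; apply: Mb.
rewrite mulmxA (_ : scalmx u *m M = 0) ?mul0mx //; apply: col_mx_eq0 => j.
by rewrite colE -mulmxA -colE NE mulmxA -scalmxM uN scalmx0 mul0mx.
Qed.

Lemma ltfree_mul m n p (a : 'cV[T]_n) (b : 'cV[T]_p) (M : 'M[T]_(m, p)) :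
  ltfree a -> ltfree b -> (forall i j, kspan a (M i j)) -> kfree (M *m b) ->
  ltfree (M *m b).
Proof.
move=> aF bF Ma Mb; have [N NE] := kspan_mx Ma.
have [X NX] := coefficient_inverse NE Mb => u; rewrite mulmxA => /bF uM.
have uN j : u *m scalmx (N j) = 0.
  by apply: (ltfree_inj aF); rewrite mul0mx -mulmxA -NE colE mulmxA uM mul0mx.
rewrite -[u]mulmx1 -scalmx1 -NX scalmx_sum mulmx_sumr big1 // => j _.
by rewrite scalmxM mulmxA uN mul0mx.
Qed.

Lemma ltfree_scalmx m p (b : 'cV[T]_p) (N : 'M[k]_(m, p)) :
  ltfree b -> kfree (scalmx N *m b) -> ltfree (scalmx N *m b).
Proof.
have F1 : ltfree (1%:M : 'cV[T]_1) by move=> u; rewrite mulmx1.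
move=> bF; apply: ltfree_mul F1 bF _ => i j; exists (\row_l N i j).
by rewrite big_ord1 !mxE eqxx.
Qed.

Lemma kspan_colmx m n (b : 'cV[T]_n) (x : 'cV[T]_m) :
  (forall i, kspan b (x i 0)) -> exists N : 'M[k]_(m, n), x = scalmx N *m b.
Proof.
move=> xb; have /choice[u uE] i : exists u : 'rV[k]_n,
    x i 0 = \sum_l u 0 l *: b l 0 by exact: xb.
exists (\matrix_(i, l) u i 0 l); apply/matrixP => i z.
by rewrite ord1 scalmx_mulE uE; apply: eq_bigr => l _; rewrite mxE.
Qed.

Lemma subspace_kspan n (b : 'cV[T]_n) : subspace (kspan b).
Proof.
split=> [|c x y [u ->] [v ->]].
  by exists 0; rewrite big1 // => i _; rewrite mxE scale0r.
exists (c *: u + v); rewrite scaler_sumr -big_split; apply: eq_bigr => i _.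
by rewrite !mxE scalerDl scalerA.
Qed.

Lemma kfree_extend n (b : 'cV[T]_n) (x : T) :
  kfree b -> ~ kspan b x -> kfree (col_mx b (x%:M : 'cV_1)).
Proof.
move=> bF nx u; rewrite /scalmx -[u]hsubmxK map_row_mx mul_row_col => uE.
set u1 := lsubmx u in uE *; set u2 := rsubmx u in uE *.
have u1E : (scalmx u1 *m b) 0 0 + u2 0 0 *: x = 0.
  have /matrixP/(_ 0 0) := uE.
  rewrite [X in X = _ -> _]mxE [X in _ = X -> _]mxE => <-; congr (_ + _).
  by rewrite (scalmx_mulE u2) big_ord1 [x%:M _ _]mxE eqxx mulr1n.
have u20 : u2 0 0 = 0.
  apply/eqP/negPn/negP => u2n; apply: nx.
  have -> : x = - (u2 0 0)^-1 *: (scalmx u1 *m b) 0 0.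
    apply/eqP; rewrite -subr_eq0 scaleNr opprK; apply/eqP.
    rewrite -[x](scale1r) -[in LHS](mulVf u2n) -scalerA -scalerDr addrC u1E.
    by rewrite scaler0.
  apply: subspaceZ; first exact: subspace_kspan.
  by exists u1; rewrite scalmx_mulE.
have -> : u1 = 0.
  apply: bF; apply/matrixP => i j; rewrite !ord1 [RHS]mxE -[RHS]u1E u20 scale0r.
  by rewrite addr0.
have -> : u2 = 0 by apply/matrixP => i j; rewrite !ord1 u20 mxE.
exact: row_mx0.
Qed.

(** The size of a free family in [P] is bounded by the number of separating
    functionals, since the matrix of their values has independent rows; so a free
    family can be enlarged only finitely often before it spans [P]. *)
Lemma maximal_kfree (J : Type) (phi : J -> T -> k) (s : seq J) (P : set T) :
  (forall j, scalar (phi j)) ->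
  (forall n (b : 'cV[T]_n) x, (forall i, P (b i 0)) -> kspan b x ->
     (forall l : 'I_(size s), phi (tnth (in_tuple s) l) x = 0) -> x = 0) ->
  exists n, exists b : 'cV[T]_n,
    [/\ forall i, P (b i 0), kfree b & P `<=` kspan b].
Proof.
move=> phiL sep.
have phi_sum l (J' : finType) (F : J' -> k) (x : J' -> T) :
    phi l (\sum_j F j *: x j) = \sum_j F j * phi l (x j).
  have p0 : phi l 0 = 0.
    by have := phiL l (-1) 0 0; rewrite scaler0 addr0 mulN1r addNr.
  have pD : {morph phi l : x y / x + y}.
    by move=> y z; rewrite -[y]scale1r phiL mul1r scale1r.
  rewrite (big_morph _ pD p0); apply: eq_bigr => j _.
  by rewrite -[_ *: _]addr0 phiL p0 addr0.
have bound n (b : 'cV[T]_n) :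
    (forall i, P (b i 0)) -> kfree b -> (n <= size s)%N.
  move=> Pb bF; pose C : 'M[k]_(n, size s) :=
    \matrix_(i, l) phi (tnth (in_tuple s) l) (b i 0).
  suff /eqP <- : row_free C by exact: rank_leq_col.
  rewrite -kermx_eq0; apply/eqP/rV_eq0 => i; set u := row i _.
  have uC : u *m C = 0 by rewrite -row_mul mulmx_ker row0.
  apply: bF; apply/matrixP => a z; rewrite !ord1 scalmx_mulE [RHS]mxE.
  apply: (sep n b) => // [|l]; first by exists u.
  rewrite phi_sum; transitivity ((u *m C) 0 l); last by rewrite uC mxE.
  by rewrite [RHS]mxE; apply: eq_bigr => j _; rewrite [C _ _]mxE.
have grow d n (b : 'cV[T]_n) : (forall i, P (b i 0)) -> kfree b ->
    (size s < n + d)%N -> exists n', exists b' : 'cV[T]_n',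
      [/\ forall i, P (b' i 0), kfree b' & P `<=` kspan b'].
  elim: d n b => [|d IH] n b Pb bF.
    by rewrite addn0 ltnNge (bound _ b).
  have [Pspan _|] := pselect (P `<=` kspan b); first by exists n, b.
  move=> /existsNP[x /not_implyP[Px nx]] lt_s.
  apply: (IH (n + 1)%N (col_mx b x%:M) _ (kfree_extend bF nx)).
    move=> i; rewrite mxE; case: split => j //.
    by rewrite mxE ord1 eqxx mulr1n.
  by rewrite addn1 addSnnS.
apply: (grow (size s).+1 0%N (const_mx 0)) => // [[]//|u _].
by apply/matrixP => i [].
Qed.
End FreeFamilies.

(** * Weights and homogeneous bases *)

Section Weights.
Context (k : fieldType) (I : choiceType) (deg : I -> nat).
Local Notation T := (tensor_alg k I).
Local Notation word := {fmonom I}.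
Implicit Types (W X : set T) (x y : T) (w : word).

Lemma hcompE n x w : (hcomp deg n x)@_w = if wdeg deg w == n then x@_w else 0.
Proof.
rewrite /hcomp raddf_sum /= big_mkcond /=.
have [wx|wx] := boolP (w \in msupp x); last first.
  rewrite (mcoeff_outdom wx) if_same big_seq big1 // => u ux.
  rewrite mcoeffU; case: ifP => // _; case: eqP => [uw|_]; last by rewrite mulr0n.
  by rewrite uw (negPf wx) in ux.
rewrite (bigD1_seq w) //= ?fset_uniq // mcoeffUU big1 ?addr0 // => u.
by move=> /negPf uw; rewrite mcoeffU uw mulr0n if_same.
Qed.

Lemma hcomp_linear n : linear (hcomp deg n : T -> T).
Proof.
move=> c x y; apply/malgP => w; rewrite [LHS]hcompE [RHS]mcoeffD.
rewrite [X in _ = X + _]mcoeffZ [X in _ = _ * X + _]hcompE.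
rewrite [X in _ = _ + X]hcompE; case: ifP => _; last by rewrite mulr0 addr0.
by rewrite mcoeffD mcoeffZ.
Qed.

HB.instance Definition _ n :=
  GRing.isLinear.Build k T T *:%R (hcomp deg n) (hcomp_linear n).

Lemma TdegP n x : Tdeg deg n x <-> forall w, x@_w != 0 -> wdeg deg w = n.
Proof.
split=> [<- w|H]; first by rewrite hcompE; case: (wdeg deg w =P n) => // _ /eqP.
apply/malgP => w; rewrite hcompE; case: (wdeg deg w =P n) => // wn.
by case: (eqVneq x@_w 0) => [//|/H].
Qed.

Lemma Tdeg_hcomp n x : Tdeg deg n (hcomp deg n x).
Proof.
by apply/TdegP => w; rewrite hcompE; case: (wdeg deg w =P n) => // _ /eqP.
Qed.

Lemma subspace_Tdeg n : subspace (@Tdeg k I deg n).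
Proof.
split=> [|c x y xE yE]; rewrite /Tdeg /= ?linear0 //.
by rewrite linearP /= xE yE.
Qed.

Lemma hcomp_id m n x : Tdeg deg m x -> hcomp deg n x = if m == n then x else 0.
Proof.
move/TdegP=> xm; apply/malgP => w; rewrite hcompE.
case: (eqVneq x@_w 0) => [x0|/xm ->]; last by case: ifP; rewrite ?mcoeff0.
by rewrite x0; case: ifP; case: ifP; rewrite ?mcoeff0 ?x0.
Qed.

Lemma wdegM u v : wdeg deg (mmul u v) = (wdeg deg u + wdeg deg v)%N.
Proof. by rewrite /wdeg fmM big_cat. Qed.

Lemma Tdeg_word w : @Tdeg k I deg (wdeg deg w) << w >>.
Proof. by apply/TdegP => u; rewrite mcoeffU1; case: (w =P u) => [->|_ /eqP]. Qed.

Lemma Tdeg1 : @Tdeg k I deg 0 1.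
Proof.
by have := Tdeg_word (@mone word); rewrite /wdeg fm1 big_nil; exact.
Qed.

Lemma TdegM m n x y : Tdeg deg m x -> Tdeg deg n y -> Tdeg deg (m + n) (x * y).
Proof.
move=> /TdegP xm /TdegP yn; apply/TdegP => w; rewrite mcoeff_neq0 => /msuppM_le.
by case=> u [v [ux vy ->]]; rewrite wdegM xm ?yn // mcoeff_neq0.
Qed.

Lemma hcomp_sum x : exists B, x = \sum_(n < B) hcomp deg n x.
Proof.
exists (\max_(w <- msupp x) (wdeg deg w)).+1; apply/malgP => w.
rewrite raddf_sum /=; have [wx|wx] := boolP (w \in msupp x); last first.
  rewrite (mcoeff_outdom wx) big1 // => n _.
  by rewrite hcompE (mcoeff_outdom wx) if_same.
have wB : (wdeg deg w < (\max_(w <- msupp x) (wdeg deg w)).+1)%N.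
  by rewrite ltnS (big_fsetD1 w wx) /= leq_maxl.
rewrite (bigD1 (Ordinal wB)) //= hcompE eqxx big1 ?addr0 // => n nw.
rewrite hcompE; case: eqP => // e.
by case/negP: nw; apply/eqP/val_inj; rewrite /= e.
Qed.

Lemma hcompMr d e x y : Tdeg deg e y ->
  hcomp deg d (x * y) = if (e <= d)%N then hcomp deg (d - e) x * y else 0.
Proof.
move=> ye; move: x; apply: subspace_words => [|w].
  apply: subspace_eq.
    exact: linear_comp (@hcomp_linear d) (@mull_linear k I y).
  apply: linear_if (fun x => hcomp deg (d - e) x * y) _.
  exact: linear_comp (@mull_linear k I y) (@hcomp_linear (d - e)).
rewrite (hcomp_id d (TdegM (Tdeg_word w) ye)) (hcomp_id (d - e) (Tdeg_word w)).
case: leqP => [ed|de]; last by rewrite gtn_eqF // ltn_addl.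
have <- : (wdeg deg w + e == d)%N = (wdeg deg w == d - e)%N.
  by rewrite -[RHS](eqn_add2r e) subnK.
by case: ifP => // _; rewrite mul0r.
Qed.

Definition graded W : Prop := forall n x, W x -> W (hcomp deg n x).

Lemma graded_lspan X : (forall n x, X x -> lspan X (hcomp deg n x)) ->
  graded (lspan X).
Proof.
move=> gX n; apply: (lspan_min (W := [set x | lspan X (hcomp deg n x)])).
  exact: subspace_preim (@hcomp_linear n) (subspace_lspan X).
by move=> x; exact: gX.
Qed.

Lemma gradedI W X : graded W -> graded X -> graded (W `&` X).
Proof. by move=> gW gX n x [/gW Wx /gX Xx]; split. Qed.

Lemma graded_tprod W X : graded W -> graded X -> graded (tprod W X).
Proof.
move=> gW gX; apply: graded_lspan => n _ [x Wx [y Xy <-]].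
have [B yE] := hcomp_sum y; have sWX := @subspace_tprod k I W X.
have -> : hcomp deg n (x * y) = \sum_(m < B) hcomp deg n (x * hcomp deg m y).
  by rewrite {1}yE mulr_sumr linear_sum.
apply: subspace_sum => // m _.
rewrite (hcompMr _ _ (Tdeg_hcomp m y)); case: ifP => _; last by case: sWX.
by apply: tprod_mem; [exact: gW|exact: gX].
Qed.

Lemma graded_ksub : graded (lspan [set 1]).
Proof.
apply: graded_lspan => n _ ->; rewrite (hcomp_id n Tdeg1).
by case: ifP => _; [exact: lspan_gen|case: (subspace_lspan [set (1 : T)])].
Qed.

Lemma Tdeg_gen i : @Tdeg k I deg (deg i) (gen k i).
Proof. by have := Tdeg_word (fmu i); rewrite /wdeg fmU big_seq1; exact. Qed.

Lemma graded_Vsub : graded (@Vsub k I).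
Proof.
apply: graded_lspan => n _ [i _ <-]; rewrite (hcomp_id n (Tdeg_gen i)).
by case: ifP => _; [exact: mem_gen|case: (@subspace_Vsub k I)].
Qed.

Lemma graded_tpow W n : graded W -> graded (tpow W n).
Proof.
move=> gW; elim: n => [|n IH]; first exact: graded_ksub.
exact: graded_tprod.
Qed.

(** ** Finitely supported subspaces *)

Definition finitely_supported W : Prop :=
  exists s : seq word, forall x, W x -> {subset msupp x <= s}.

Lemma finitely_supportedS W X :
  W `<=` X -> finitely_supported X -> finitely_supported W.
Proof. by move=> WX [s sX]; exists s => x /WX /sX. Qed.

Lemma subspace_supported (s : seq word) :
  subspace [set x : T | {subset msupp x <= s}].
Proof.
split=> [w|c x y xs ys w /=]; first by rewrite msupp0 in_fset0.
rewrite -mcoeff_neq0 mcoeffD mcoeffZ.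
have [x0|/negPf x0] := eqVneq x@_w 0; last first.
  by move=> _; apply: xs; rewrite -mcoeff_neq0 x0.
by rewrite x0 mulr0 add0r mcoeff_neq0; exact: ys.
Qed.

Lemma finitely_supported_lspan X :
  finitely_supported X -> finitely_supported (lspan X).
Proof.
case=> s sX; exists s; apply: lspan_min => //; exact: subspace_supported.
Qed.

Lemma finitely_supported_seq (s : seq T) : finitely_supported [set` s].
Proof.
exists (flatten [seq (msupp x : seq word) | x <- s]) => x xs w wx.
by apply/flattenP; exists (msupp x : seq word) => //; apply: map_f.
Qed.

Lemma finitely_supported_tprod W X : finitely_supported W ->
  finitely_supported X -> finitely_supported (tprod W X).
Proof.
move=> [s sW] [t tX]; apply: finitely_supported_lspan.
exists [seq mmul u v | u <- s, v <- t] => _ [x Wx [y Xy <-]] w /msuppM_le.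
case=> u [v [ux vy ->]]; apply: allpairs_f; [exact: sW Wx _ ux|exact: tX Xy _ vy].
Qed.

Lemma finitely_supported_ksub : finitely_supported (lspan [set (1 : T)]).
Proof.
by apply: finitely_supported_lspan; exists (msupp (1 : T)) => x ->.
Qed.

Lemma finitely_supported_tpow W n :
  finitely_supported W -> finitely_supported (tpow W n).
Proof.
move=> sW; elim: n => [|n IH]; first exact: finitely_supported_ksub.
exact: finitely_supported_tprod.
Qed.

Definition homogeneous_basis W n (b : 'cV[T]_n) (g : 'I_n -> nat) : Prop :=
  [/\ forall i, Tdeg deg (g i) (b i 0), kfree b & W = kspan b].

(** A maximal free family of homogeneous elements; the separating functionals are
    the coefficients at the words of a finite support. *)
Lemma homogeneous_basis_ex W :
  subspace W -> graded W -> finitely_supported W ->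
  exists n, exists b : 'cV[T]_n, exists g, homogeneous_basis W b g.
Proof.
move=> sW gW [s sP].
have [||n [b [Wb bF bspan]]] := @maximal_kfree k T word (fun w x => x@_w) s
  [set x | W x /\ exists d, Tdeg deg d x].
- by move=> w; exact: mcoeff_linear.
- move=> n b x Wb xb x0; apply/malgP => w; rewrite mcoeff0.
  have Wx : W x.
    case: xb => u ->; apply: subspace_sum => // i _.
    by apply: subspaceZ => //; case: (Wb i).
  have [wx|/mcoeff_outdom//] := boolP (w \in msupp x).
  have ws := sP x Wx w wx; have := x0 (Ordinal (etrans (index_mem w s) ws)).
  by rewrite (tnth_nth w) /= nth_index.
have /choice[g gE] i : exists d, Tdeg deg d (b i 0) by case: (Wb i).
exists n, b, g; split=> //; apply/seteqP; split=> [x Wx|x [u ->]]; last first.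
  apply: subspace_sum => // i _.
  by apply: subspaceZ => //; case: (Wb i).
have [B ->] := hcomp_sum x; apply: subspace_sum; first exact: subspace_kspan.
move=> m _; apply: bspan; split; first exact: gW.
by exists m; exact: Tdeg_hcomp.
Qed.
End Weights.

Lemma wdeg_size (I : choiceType) (w : {fmonom I}) :
  wdeg (fun=> 1%N) w = size (w : seq I).
Proof. by rewrite /wdeg sum1_size. Qed.

(** * The spaces of relations and the spaces J *)

Section Words.
Context (k : fieldType) (I : choiceType).
Local Notation T := (tensor_alg k I).
Local Notation word := {fmonom I}.
Local Notation one := (@mone word).
Local Notation V := (@Vsub k I).
Implicit Types (W X Y : set T) (x y : T) (w : word).

Definition longer (n : nat) : set T :=
  [set x | forall w, x@_w != 0 -> (n <= size (w : seq I))%N].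

Lemma subspace_longer n : subspace (longer n).
Proof.
split=> [w|c x y xn yn w]; first by rewrite mcoeff0 eqxx.
rewrite mcoeffD mcoeffZ; have [x0|/xn//] := eqVneq x@_w 0.
by rewrite x0 mulr0 add0r; exact: yn.
Qed.

Lemma longer_mul m n x y : longer m x -> longer n y -> longer (m + n) (x * y).
Proof.
move=> xm yn w; rewrite mcoeff_neq0 => /msuppM_le[u [v [ux vy ->]]].
by rewrite fmM size_cat leq_add // ?xm ?yn // mcoeff_neq0.
Qed.

Lemma longer_coef n x w : longer n x -> (size (w : seq I) < n)%N -> x@_w = 0.
Proof. by move=> xn wn; have [//|/xn] := eqVneq x@_w 0; rewrite leqNgt wn. Qed.

Lemma longer_gen i : longer 1 (gen k i).
Proof.
by move=> w; rewrite mcoeffU1; case: (fmu i =P w) => [<-|_ /eqP//]; rewrite fmU.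
Qed.

Lemma longer0 x : longer 0 x. Proof. by []. Qed.

Lemma longer_Vsub : V `<=` longer 1.
Proof.
by apply: lspan_min => [|_ [i _ <-]]; [exact: subspace_longer|exact: longer_gen].
Qed.

Lemma longer_tpow n : tpow V n `<=` longer n.
Proof.
elim: n => [//|n IH]; apply: tprod_min; first exact: subspace_longer.
by move=> x y /longer_Vsub xV /IH yn; exact: (longer_mul xV yn).
Qed.

Lemma Tge_longer n : @Tge k I n `<=` longer n.
Proof.
apply: lspan_min => [|x [m nm /longer_tpow xm] w /xm];
  first exact: subspace_longer.
exact: leq_trans.
Qed.

Lemma tpow_word w : tpow V (size (w : seq I)) << w >>.
Proof.
case: w => s; elim: s => [|i s IH].
  by apply: lspan_gen; rewrite /=; congr << _ >>; apply: val_inj; rewrite /= fm1.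
rewrite (@word_cons k I (FMonom (i :: s)) i s) //.
by apply: tprod_mem; [exact: mem_gen|exact: IH].
Qed.

Lemma longer_Tge n x : longer n x -> Tge n x.
Proof.
move=> xn; rewrite (monalgE x); apply: subspace_sum_seq.
  exact: subspace_lspan.
move=> w; rewrite -mcoeff_neq0 => /xn nw.
have -> : << x@_w *g w >> = x@_w *: << w >> :> T.
  by apply/malgP => u; rewrite mcoeffU mcoeffZ mcoeffU; case: eqP => _;
    rewrite ?mulr1 ?mulr0.
apply: subspaceZ; first exact: subspace_lspan.
by apply: lspan_gen; exists (size (w : seq I)) => //; exact: tpow_word.
Qed.

Lemma mcoeff1M x y : (x * y)@_one = x@_one * y@_one.
Proof. exact: (rmorphM (mcoeff one)). Qed.

Lemma mcoeff_genM i x y :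
  (x * y)@_(fmu i) = x@_(fmu i) * y@_one + x@_one * y@_(fmu i).
Proof.
have E (z : T) : z@_(fmu i) = (stripl i z)@_one by rewrite striplE mulm1.
by rewrite (E (x * y)) striplM mcoeffD mcoeffZ mcoeff1M -(E x) -(E y).
Qed.

Section LengthComponents.
Let len : I -> nat := fun=> 1%N.

Lemma tpow_hcomp n x : tpow V n (hcomp len n x).
Proof.
move: x; apply: subspace_words => [|w].
  exact: subspace_preim (@hcomp_linear k I len n) (@subspace_tpow k I V n).
rewrite (hcomp_id n (Tdeg_word k len w)) wdeg_size.
case: eqP => [<-|_]; first exact: tpow_word.
by case: (@subspace_tpow k I V n).
Qed.
End LengthComponents.

(** ** Explicit tensors *)

Lemma tprod_terms W X x : subspace W -> tprod W X x ->
  exists2 s : seq (T * T), (forall t, t \in s -> W t.1 /\ X t.2)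
    & x = \sum_(t <- s) t.1 * t.2.
Proof.
move=> sW; move: x; apply: (tprod_min (Y := [set x | exists2 s : seq (T * T),
    (forall t, t \in s -> W t.1 /\ X t.2) & x = \sum_(t <- s) t.1 * t.2])).
  split=> [|c _ _ [s sP ->] [t tP ->]]; first by exists [::]; rewrite ?big_nil.
  exists ([seq (c *: u.1, u.2) | u <- s] ++ t) => [u|].
    rewrite mem_cat => /orP[/mapP[v /sP[Wv Xv] ->]|/tP//].
    by split=> //; exact: subspaceZ.
  rewrite big_cat big_map scaler_sumr; congr (_ + _).
  by apply: eq_bigr => u _; rewrite -scalerAl.
move=> x y Wx Xy; exists [:: (x, y)]; last by rewrite big_seq1.
by move=> t; rewrite inE => /eqP ->.
Qed.

Lemma tprod3_terms W X Y x : subspace W -> subspace X ->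
  tprod W (tprod X Y) x ->
  exists2 s : seq (T * T * T),
    (forall t, t \in s -> [/\ W t.1.1, X t.1.2 & Y t.2])
    & \sum_(t <- s) t.1.1 * t.1.2 * t.2 = x.
Proof.
move=> sW sX; move: x; apply: (tprod_min (Y := [set x |
  exists2 s : seq (T * T * T),
    (forall t, t \in s -> [/\ W t.1.1, X t.1.2 & Y t.2])
    & \sum_(t <- s) t.1.1 * t.1.2 * t.2 = x])).
  split=> [|c _ _ [s sP <-] [t tP <-]]; first by exists [::]; rewrite ?big_nil.
  exists ([seq (c *: u.1.1, u.1.2, u.2) | u <- s] ++ t) => [u|].
    rewrite mem_cat => /orP[/mapP[v /sP[Wv Xv Yv] ->]|/tP//].
    by split=> //; exact: subspaceZ.
  rewrite big_cat big_map scaler_sumr; congr (_ + _).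
  by apply: eq_bigr => u _; rewrite /= -!scalerAl.
move=> x y Wx /(tprod_terms sX)[s sP ->].
exists [seq (x, t.1, t.2) | t <- s].
  by move=> _ /mapP[t /sP[Xt Yt] ->].
by rewrite big_map mulr_sumr; apply: eq_bigr => t _; rewrite /= mulrA.
Qed.

Lemma tprod_kspan_mx W m n (b : 'cV[T]_n) (x : 'cV[T]_m) : subspace W ->
  (forall i, tprod W (kspan b) (x i 0)) ->
  exists2 M : 'M[T]_(m, n), (forall i j, W (M i j)) & M *m b = x.
Proof.
move=> sW xW; have row_ex y : tprod W (kspan b) y -> exists2 u : 'rV[T]_n,
    (forall j, W (u 0 j)) & y = \sum_j u 0 j * b j 0.
  move: y; apply: (tprod_min (Y := [set y | exists2 u : 'rV[T]_n,
    (forall j, W (u 0 j)) & y = \sum_j u 0 j * b j 0])).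
    split=> [|c _ _ [u Wu ->] [v Wv ->]].
      exists 0 => [j|]; first by rewrite mxE; case: sW.
      by rewrite big1 // => j _; rewrite mxE mul0r.
    exists (\row_j (c *: u 0 j + v 0 j)) => [j|].
      by rewrite mxE; exact: (subspaceP c sW (Wu j) (Wv j)).
    rewrite scaler_sumr -big_split; apply: eq_bigr => j _ /=.
    by rewrite mxE mulrDl scalerAl.
  move=> w _ Ww [u ->]; exists (\row_j (u 0 j *: w)) => [j|].
    by rewrite mxE; exact: subspaceZ.
  rewrite mulr_sumr; apply: eq_bigr => j _.
  by rewrite mxE malg_scalerAr -scalerAl.
have /choice[u uP] i : exists u : 'rV[T]_n,
    (forall j, W (u 0 j)) /\ x i 0 = \sum_j u 0 j * b j 0.
  by have [u uW xE] := row_ex _ (xW i); exists u.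
exists (\matrix_(i, j) u i 0 j) => [i j|]; first by rewrite mxE; case: (uP i).
apply/matrixP => i z; rewrite ord1 mxE; case: (uP i) => _ ->.
by apply: eq_bigr => j _; rewrite mxE.
Qed.

Section FiniteAlphabet.
Context (eI : seq I) (eI_uniq : uniq eI) (eI_all : forall i, i \in eI).

Definition gens : 'cV[T]_(size eI) := \col_i gen k (tnth (in_tuple eI) i).

Lemma ltfree_gens : ltfree gens.
Proof.
move=> u u0; apply/rowP => i; rewrite [RHS]mxE.
have: stripr (tnth (in_tuple eI) i) ((u *m gens) 0 0) = 0.
  by rewrite u0 mxE linear0.
rewrite mxE linear_sum (eq_bigr (fun j => if i == j then u 0 j else 0)).
  rewrite (bigD1 i) //= eqxx big1 ?addr0 // => j.
  by rewrite eq_sym => /negPf ->.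
move=> j _; have -> : gens j 0 = gen k (tnth (in_tuple eI) j) by rewrite mxE.
transitivity (if tnth (in_tuple eI) i == tnth (in_tuple eI) j then u 0 j else 0).
  exact: stripr_gen.
have inj_tnth : injective (tnth (in_tuple eI)) by apply/tuple_uniqP.
by rewrite (inj_eq inj_tnth).
Qed.

Lemma kspan_gens : kspan gens = V.
Proof.
apply/seteqP; split=> [_ [u ->]|].
  apply: subspace_sum; first exact: subspace_Vsub.
  move=> i _; apply: subspaceZ; first exact: subspace_Vsub.
  by rewrite mxE; exact: mem_gen.
apply: lspan_min; first exact: subspace_kspan.
move=> _ [i _ <-]; have ilt : (index i eI < size eI)%N by rewrite index_mem.
have <- : gens (Ordinal ilt) 0 = gen k i.
  by rewrite mxE (tnth_nth i) /= nth_index.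
exact: kspan_gen.
Qed.

Lemma finitely_supported_Vsub : finitely_supported V.
Proof.
apply: finitely_supported_lspan; exists [seq fmu i | i <- eI] => _ [i _ <-] w.
by rewrite msuppU1 inE => /eqP ->; apply: map_f.
Qed.
End FiniteAlphabet.
End Words.

Lemma lspan_bigcup (S : pzRingType) (M : lmodType S) (Y : nat -> set M) x :
  (forall N, subspace (Y N)) ->
  lspan (\bigcup_(N in [set N | (1 <= N)%N]) Y N) x ->
  exists B, exists2 om : nat -> M, (forall N, Y N.+1 (om N))
    & x = \sum_(N < B) om N.
Proof.
move=> sY.
suff H : lspan (\bigcup_(N in [set N | (1 <= N)%N]) Y N) `<=` [set x |
    exists B, exists om : nat -> M, [/\ forall N, Y N.+1 (om N),
      forall N, (B <= N)%N -> om N = 0 & x = \sum_(N < B) om N]].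
  by move=> /H[B [om [Yom _ ->]]]; exists B, om.
apply: lspan_min => [|y [[|N] // _ Yy]]; last first.
  exists N.+1, (fun n => if n == N then y else 0); split=> [n|n|].
  - by case: eqP => [->//|_]; case: (sY n.+1).
  - by move/gtn_eqF => ->.
  - rewrite (bigD1 ord_max) //= eqxx big1 ?addr0 // => i.
    by rewrite -val_eqE /= => /negPf ->.
split=> [|c _ _ [B [om [Yom om0 ->]]] [B' [om' [Yom' om0' ->]]]].
  by exists 0%N, (fun=> 0); split=> [N|//|]; rewrite ?big_ord0 //;
    case: (sY N.+1).
pose C := maxn B B'; have widen (u : nat -> M) D : (D <= C)%N ->
    (forall N, (D <= N)%N -> u N = 0) -> \sum_(N < D) u N = \sum_(N < C) u N.
  move=> DC u0; rewrite -!(big_mkord xpredT) [RHS](big_cat_nat (leq0n D) DC) /=.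
  rewrite [X in _ + X]big_nat_cond [X in _ + X]big1 ?addr0 // => N.
  by rewrite andbT => /andP[/u0].
rewrite (widen om B (leq_maxl _ _) om0) (widen om' B' (leq_maxr _ _) om0').
exists C, (fun N => c *: om N + om' N); split=> [N|N CN|].
- exact: (subspaceP c (sY N.+1) (Yom N) (Yom' N)).
- rewrite om0 ?om0' ?scaler0 ?addr0 //; apply: leq_trans CN.
    exact: leq_maxr.
  exact: leq_maxl.
- by rewrite scaler_sumr -big_split.
Qed.

Section Presentation.
Context (k : fieldType) (I : choiceType) (A : algType k) (p : presentation I A).
Local Notation T := (tensor_alg k I).
Local Notation word := {fmonom I}.
Local Notation one := (@mone word).
Local Notation V := (@Vsub k I).
Local Notation ksub := (lspan [set (1 : T)]).
Local Notation R := (rels p).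
Local Notation deg := (gdeg p).
Local Notation pi := (proj p).

Lemma subspace_rels : subspace R.
Proof. by rewrite (rel_subspace (relP p)); exact: subspace_lspan. Qed.

Lemma longer_rels : R `<=` longer 2.
Proof. by move=> x /(rel_ge2 (relP p)); exact: Tge_longer. Qed.

Lemma longer_ideal : ideal_of R `<=` longer 2.
Proof.
apply: tprod_min => [|x y Hx _]; first exact: subspace_longer.
suff: longer 2 x.
  by move=> x2; have := longer_mul x2 (@longer0 k I y); rewrite addn0; exact.
move: x Hx.
apply: tprod_min => [|x r _ /longer_rels r2]; first exact: subspace_longer.
by have := longer_mul (@longer0 k I x) r2; rewrite add0n; exact.
Qed.

(** A letter whose coefficient vanishes in lifts of the generators of [A] would
    lie outside of the subalgebra they generate, as no relation involves it
    linearly. *)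
Lemma finite_letters : fg_algebra A ->
  exists eI : seq I, uniq eI /\ forall i, i \in eI.
Proof.
case=> s s_gen; have /choice[lift liftE] := proj_surj p.
pose ws : seq word := flatten [seq (msupp (lift a) : seq word) | a <- s].
exists (undup (flatten [seq fmonom_val w | w <- ws])); split;
  first exact: undup_uniq.
move=> i; rewrite mem_undup; apply/negPn/negP => ni.
have lift0 a : a \in s -> (lift a)@_(fmu i) = 0.
  move=> sa; apply/mcoeff_outdom/negP => ia; case/negP: ni.
  apply/flattenP; exists (fmu i : seq I); last by rewrite fmU mem_head.
  apply/map_f/flattenP; exists (msupp (lift a) : seq word) => //.
  exact: map_f.
pose S : {pred A} := [pred a | `[< exists2 x, pi x = a & x@_(fmu i) = 0 >]].
have Sclosed : GRing.subalg_closed S.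
  split=> [|c _ _ /asboolP[x <- x0] /asboolP[y <- y0]
          |_ _ /asboolP[x <- x0] /asboolP[y <- y0]].
  - apply/asboolP; exists 1; first by rewrite rmorph1.
    by rewrite mcoeff1 fmP fmU fm1.
  - apply/asboolP; exists (c *: x + y); first by rewrite linearP.
    by rewrite mcoeffD mcoeffZ x0 y0 mulr0 addr0.
  - apply/asboolP; exists (x * y); first by rewrite rmorphM.
    by rewrite mcoeff_genM x0 y0 mul0r mulr0 addr0.
have sS : {subset s <= S}.
  by move=> a sa; apply/asboolP; exists (lift a); [exact: liftE|exact: lift0].
have /asboolP[x xi x0] := s_gen S Sclosed sS (pi (gen k i)).
have : ideal_of R (gen k i - x).
  by apply/(proj_ker p); rewrite rmorphB /= xi subrr.
move/longer_ideal/(@longer_coef k I 2 _ (fmu i)); rewrite fmU => /(_ isT).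
rewrite mcoeffB x0 subr0 mcoeffU1 eqxx => /eqP.
by rewrite oner_eq0.
Qed.

Lemma subspace_Jtab j n : subspace (Jtab R j n).
Proof.
elim: j n => [|j IH] n /=; first exact: subspace_lspan.
case: ifP => // _; case: j {IH} => [|j]; first exact: subspace_rels.
by apply: subspaceI; [exact: subspace_lspan|exact: subspace_tpow].
Qed.

Lemma subspace_Jeven j : subspace (Jeven R j).
Proof. exact: subspace_Jtab. Qed.

Lemma subspace_Jodd j : subspace (Jodd R j).
Proof. by apply: subspaceI; exact: subspace_tprod. Qed.

Lemma Jtab_Jeven j n : (n <= j)%N -> Jtab R j n = Jeven R n.
Proof.
elim: j n => [|j IH] n; first by rewrite leqn0 => /eqP ->.
rewrite leq_eqVlt => /orP[/eqP -> //|]; rewrite ltnS => nj.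
by rewrite /= nj IH.
Qed.

Lemma JevenSS j : Jeven R j.+2 = Jstep R (Jtab R j.+1) j.+1.
Proof. by rewrite {1}/Jeven /= ltnn. Qed.

Lemma J_double j : J R j.*2 = Jeven R j.
Proof. by rewrite /J odd_double doubleK. Qed.

Lemma J_doubleS j : J R j.*2.+1 = Jodd R j.
Proof. by rewrite /J /= odd_double /= uphalf_double. Qed.

Lemma Jodd0 : Jodd R 0 = V.
Proof.
rewrite /Jodd tprod1l ?tprod1r; try exact: subspace_Vsub.
by rewrite setIid.
Qed.

Lemma Jeven_tpow j : Jeven R j `<=` tpow R j.
Proof.
case: j => [|[|j]] x //; last by rewrite JevenSS => -[].
by rewrite tpow1 //; exact: subspace_rels.
Qed.

Lemma graded_rels : graded deg R.
Proof. exact: rel_graded (relP p). Qed.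

Lemma graded_interleave JE i (m : i.+1.-tuple nat) (n : i.-tuple nat) :
  (forall j, graded deg (JE j)) -> graded deg (@interleave k I JE i m n).
Proof.
move=> gJE; rewrite /interleave; elim: (zip m n) => [|a l IH] /=.
  by apply: graded_tpow; exact: graded_Vsub.
apply: graded_tprod; first by apply: graded_tpow; exact: graded_Vsub.
exact: graded_tprod.
Qed.

Lemma subspace_interleave JE i (m : i.+1.-tuple nat) (n : i.-tuple nat) :
  subspace (@interleave k I JE i m n).
Proof.
rewrite /interleave; elim: (zip m n) => [|a l IH] /=; first exact: subspace_tpow.
exact: subspace_tprod.
Qed.

Lemma graded_Jtab j n : graded deg (Jtab R j n).
Proof.
elim: j n => [|j IH] n /=; first exact: graded_ksub.
case: ifP => // _; case: j IH => [|j] IH; first exact: graded_rels.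
apply: gradedI; last by apply: graded_tpow; exact: graded_rels.
apply: graded_lspan => d x [N N1 Nx]; apply: lspan_gen; exists N => //.
by move=> n' m sn sm; apply: graded_interleave => //; exact: Nx.
Qed.

Lemma graded_J i : graded deg (J R i).
Proof.
rewrite /J; case: ifP => _; last exact: graded_Jtab.
apply: gradedI; apply: graded_tprod; try exact: graded_Vsub;
  exact: graded_Jtab.
Qed.

Lemma subspace_J i : subspace (J R i).
Proof.
by rewrite /J; case: ifP => _; [exact: subspace_Jodd|exact: subspace_Jeven].
Qed.

(** ** Slices of the even spaces *)

Lemma interleave_tail JE a q : JE 0%N = ksub ->
  foldr (fun mn W => tprod (tpow V mn.1) (tprod (JE mn.2) W))
    (tpow V (last a (nseq q 0%N))) (zip (a :: nseq q 0%N) (nseq q 0%N))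
  `<=` tpow V a.
Proof.
move=> JE0; elim: q a => [|q IH] a /=; first exact: subset_refl.
have sV : subspace (tpow V a) by exact: subspace_tpow.
rewrite JE0 -[X in _ `<=` X](tprod1r sV).
apply: tprodS => //.
rewrite -[X in _ `<=` X](tprod1l (subspace_lspan [set (1 : T)])).
by apply: tprodS => //; exact: IH.
Qed.

Lemma Jstep_slice i N x :
  (forall (n : i.+1.-tuple nat) (m : i.+2.-tuple nat),
     sumn n = i.+1 -> sumn m = N -> interleave (Jtab R i.+1) m n x) ->
  forall l, (l <= N)%N ->
    tprod (tpow V l) (tprod (Jeven R i.+1) (tpow V (N - l))) x.
Proof.
move=> Hx l lN.
(* All of the weight of [n] in the first slot leaves a single factor [J]; the
   first two slots of [m] place it after [l] letters. *)
have := Hx [tuple of i.+1 :: nseq i 0%N] [tuple of l :: (N - l)%N :: nseq i 0%N].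
rewrite /= sumn_nseq mul0n !addn0 subnKC // => /(_ erefl erefl).
rewrite /interleave /=; move: x {Hx}; apply: tprodS => //; apply: tprodS => //.
apply: (@interleave_tail (Jtab R i.+1) (N - l)%N i).
by rewrite Jtab_Jeven.
Qed.

Lemma Jeven_slices i x : Jeven R i.+2 x ->
  exists B, exists2 om : nat -> T,
    (forall N l, (l <= N.+1)%N ->
       tprod (tpow V l) (tprod (Jeven R i.+1) (tpow V (N.+1 - l))) (om N))
    & x = \sum_(N < B) om N.
Proof.
rewrite JevenSS => -[H _]; have [N|B [om omP ->]] := lspan_bigcup _ H.
  split=> [/= n m _ _|c y z Hy Hz /= n m sn sm].
    by case: (subspace_interleave (Jtab R i.+1) m n).
  exact: (subspaceP c (subspace_interleave _ _ _) (Hy n m sn sm) (Hz n m sn sm)).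
exists B, om => // N l lN; exact: Jstep_slice (omP N) l lN.
Qed.

Section FiniteAlphabet.
Context (eI : seq I) (eI_uniq : uniq eI) (eI_all : forall i, i \in eI).

(** The decomposition of an element of an even space which defines the
    differential; that of a relation is the one by length. *)
Lemma Jeven_decomposition j x : Jeven R j.+1 x ->
  exists B, exists2 om : nat -> T,
    (forall N l, (l <= N)%N ->
       tprod (tpow V l) (tprod (Jodd R j) (tpow V (N - l))) (om N))
    & x = \sum_(N < B) om N.
Proof.
case: j => [|j].
  move=> Rx; pose len : I -> nat := fun=> 1%N.
  have x0 : hcomp len 0 x = 0.
    apply/malgP => w; rewrite hcompE mcoeff0 wdeg_size; case: eqP => // w0.
    by apply: (longer_coef (longer_rels Rx)); rewrite w0.
  have [B xE] := hcomp_sum len x.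
  (* The component of length zero is dropped: that of length [N + 1] is the term
     of index [N]. *)
  exists B.-1, (fun N => hcomp len N.+1 x) => [N l lN|].
    rewrite Jodd0 -tpowS tpowD; last exact: subspace_Vsub.
    by rewrite addnS subnKC //; exact: tpow_hcomp.
  case: B xE => [|B]; first by rewrite !big_ord0.
  by rewrite big_ord_recl x0 add0r.
move=> /Jeven_slices[B [om omP xE]]; exists B, om => // N l lN.
(* Adjacent slices, with [J (2j + 2)] after [l] and after [l + 1] letters, share
   the window of [J (2j + 3)]; they place it in [J V] and in [V J]. *)
have H0 := omP N l (leqW lN); have H1 := omP N l.+1 lN.
rewrite subSn // tpowS [X in tprod _ X]tprodA in H0.
rewrite subSS (tpowSr _ (@subspace_Vsub k I)) -tprodA in H1.
rewrite [X in tprod _ X]tprodA in H1.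
have sJ := subspace_Jeven j.+1.
rewrite /Jodd -(tprod_tpowI eI_uniq eI_all); try exact: subspace_tprod.
by split; [exact: H1|exact: H0].
Qed.

Section FiniteRelations.
Hypothesis R_supp : finitely_supported R.

Lemma finitely_supported_Jeven j : finitely_supported (Jeven R j).
Proof.
exact: finitely_supportedS (@Jeven_tpow j) (finitely_supported_tpow j R_supp).
Qed.

Lemma finitely_supported_J i : finitely_supported (J R i).
Proof.
rewrite /J; case: ifP => _; last exact: finitely_supported_Jeven.
apply: finitely_supportedS (@subIsetl _ _ _) _; apply: finitely_supported_tprod.
  exact: finitely_supported_Vsub eI_all.
exact: finitely_supported_Jeven.
Qed.

(** Minimality of the relations: in a left [T]-combination of independent
    relations that vanishes, the constant parts of the coefficients must
    vanish; stripping the first letters reduces to shorter coefficients. *)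
Lemma ltfree_rels n (a : 'cV[T]_n) : kfree a -> R = kspan a -> ltfree a.
Proof.
move=> aF Ra; have Ra_ j : R (a j 0) by rewrite Ra; exact: kspan_gen.
have main B (u : 'rV[T]_n) :
    (forall j w, (u 0 j)@_w != 0 -> (size (w : seq I) < B)%N) ->
    \sum_j u 0 j * a j 0 = 0 -> forall j, u 0 j = 0.
  elim: B u => [|B IH] u uB u0 j.
    by apply/malgP => w; rewrite mcoeff0; apply/eqP/negPn/negP => /uB.
  have const0 l : (u 0 l)@_one = 0.
    pose r := \sum_l (u 0 l)@_one *: a l 0.
    suff r0 : r = 0.
      have /aF/rowP/(_ l) : scalmx T (\row_l (u 0 l)@_one) *m a = 0.
        apply/matrixP => x y; rewrite !ord1 scalmx_mulE [RHS]mxE -[RHS]r0.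
        by apply: eq_bigr => l' _; rewrite mxE.
      by rewrite !mxE.
    apply: (rel_minimal (relP p)).
      apply: subspace_sum; first exact: subspace_rels.
      by move=> l' _; apply: subspaceZ; [exact: subspace_rels|exact: Ra_].
    apply: lspan_gen; left.
    have -> : r = \sum_l ((u 0 l)@_one *: 1 - u 0 l) * a l 0 * 1.
      under eq_bigr => l' _.
        rewrite mulr1 mulrBl -scalerAl mul1r. over.
      by rewrite sumrB u0 subr0.
    apply: subspace_sum; first exact: subspace_tprod.
    move=> l' _; apply: tprod_mem => //; apply: tprod_mem => //.
    apply: longer_Tge => w; rewrite mcoeffB mcoeffZ mcoeff1.
    case: (w =P one) => [->|w1 _]; first by rewrite mulr1 subrr eqxx.
    by rewrite lt0n size_eq0; apply/eqP => w0; apply: w1; apply: val_inj;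
      rewrite /= w0 fm1.
  apply: stripl_eq0 => // i; pose v : 'rV[T]_n := \row_l stripl i (u 0 l).
  have vE l : v 0 l = stripl i (u 0 l) by rewrite mxE.
  rewrite -vE; apply: IH => [l w|].
    by rewrite vE striplE => /uB; rewrite fmM fmU.
  rewrite -[RHS](linear0 (stripl i)) -[in RHS]u0 linear_sum;
    apply: eq_bigr => l _.
  by rewrite vE [RHS]striplM const0 scale0r addr0.
move=> u u0; pose B := (\max_j \max_(w <- msupp (u 0%R j)) size (w : seq I)).+1.
apply/rowP => j; rewrite [RHS]mxE; apply: (main B) => [l w|].
  rewrite mcoeff_neq0 => uw; rewrite ltnS; apply: leq_trans (leq_bigmax l).
  by rewrite (big_fsetD1 w uw) /= leq_maxl.
by have /matrixP/(_ 0 0) := u0; rewrite [in X in X -> _]mxE [X in _ = X -> _]mxE.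
Qed.

Lemma tpow_rels_basis j : exists n, exists2 c : 'cV[T]_n,
  ltfree c & tpow R j = kspan c.
Proof.
have [n0 [a [g [_ aF Ra]]]] :=
  homogeneous_basis_ex subspace_rels graded_rels R_supp.
have aT := ltfree_rels aF Ra.
elim: j => [|j [n [c cT cE]]].
  exists 1%N, 1%:M; first by move=> u; rewrite mulmx1.
  apply/seteqP; split=> [x /ksubP[c ->]|x [u ->]].
    by exists (c%:M); rewrite big_ord1 !mxE eqxx !mulr1n.
  by apply/ksubP; exists (u 0 0); rewrite big_ord1 [1%:M _ _]mxE.
have [n' [c' [g' [_ c'F c'E]]]] := homogeneous_basis_ex
  (@subspace_tpow k I R j.+1) (graded_tpow (n := j.+1) graded_rels)
  (finitely_supported_tpow j.+1 R_supp).
have [M RM Mc] : exists2 M : 'M[T]_(n', n), (forall i l, R (M i l)) & M *m c = c'.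
  apply: tprod_kspan_mx; first exact: subspace_rels.
  by move=> i; rewrite -cE -tpowS c'E; exact: kspan_gen.
exists n', c' => //; rewrite -Mc in c'F *; apply: ltfree_mul aT cT _ c'F => i l.
by rewrite -Ra.
Qed.

Lemma ltfree_Jeven j n (b : 'cV[T]_n) : kfree b -> Jeven R j = kspan b ->
  ltfree b.
Proof.
move=> bF Jb; have [n' [c cT cE]] := tpow_rels_basis j.
have [N bE] : exists N, b = scalmx T N *m c.
  apply: kspan_colmx => i; rewrite -cE; apply: Jeven_tpow.
  by rewrite Jb; exact: kspan_gen.
by rewrite bE in bF *; exact: ltfree_scalmx.
Qed.

Lemma ltfree_Jodd j n (b : 'cV[T]_n) : kfree b -> Jodd R j = kspan b -> ltfree b.
Proof.
move=> bF Jb; have [n' [c [g [_ cF cE]]]] := homogeneous_basis_ex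
  (subspace_Jeven j) (@graded_Jtab j j) (finitely_supported_Jeven j).
have [M VM Mc] : exists2 M : 'M[T]_(n, n'), (forall i l, V (M i l)) & M *m c = b.
  apply: tprod_kspan_mx; first exact: subspace_Vsub.
  move=> i; rewrite -cE.
  have [] : Jodd R j (b i 0) by rewrite Jb; exact: kspan_gen.
  by [].
rewrite -Mc in bF *.
apply: ltfree_mul (ltfree_gens (k := k) eI_uniq) (ltfree_Jeven cF cE) _ bF => i l.
by rewrite (kspan_gens k eI_all).
Qed.

Lemma ltfree_J i n (b : 'cV[T]_n) : kfree b -> J R i = kspan b -> ltfree b.
Proof.
by rewrite /J; case: ifP => _ bF Jb;
  [exact: ltfree_Jodd bF Jb|exact: ltfree_Jeven bF Jb].
Qed.

(** An element of [J (2j + 2)] lies in [T J (2j)] and in [R R^(j)]; comparing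
    the coefficients over a basis of [R^(j)] shows that it lies in [R J (2j)]. *)
Lemma Jeven_coproduct j x : Jeven R j.+1 x -> tprod R (Jeven R j) x.
Proof.
case: j => [|j] Jx; first by rewrite tprod1r //; exact: subspace_rels.
have [n [c cT cE]] := tpow_rels_basis j.+1.
have [m [b [g [_ bF Jb]]]] := homogeneous_basis_ex
  (subspace_Jeven j.+1) (@graded_Jtab j.+1 j.+1) (finitely_supported_Jeven j.+1).
have [N bE] : exists N, b = scalmx T N *m c.
  apply: kspan_colmx => i; rewrite -cE; apply: Jeven_tpow.
  by rewrite Jb; exact: kspan_gen.
have NX : N *m pinvmx N = 1%:M.
  apply: mulmxVp; rewrite -kermx_eq0; apply/eqP; apply: (kfree_mx bF).
  by rewrite bE mulmxA -scalmxM mulmx_ker scalmx0 mul0mx.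
have [t _ tE] : exists2 t : 'rV[T]_m,
    (forall i l, [set: T] (t i l)) & t *m b = x%:M.
  apply: tprod_kspan_mx => // i; rewrite ord1 mxE mulr1n -Jb.
  have [B [om omP ->]] := Jeven_slices Jx.
  apply: subspace_sum => [|l _]; first exact: subspace_tprod.
  have := omP l l.+1 (leqnn _); rewrite subnn tprod1r; last exact: subspace_Jeven.
  by apply: tprodS.
have [r Rr rE] : exists2 r : 'rV[T]_n, (forall i l, R (r i l)) & r *m c = x%:M.
  apply: tprod_kspan_mx; first exact: subspace_rels.
  by move=> i; rewrite ord1 mxE mulr1n -cE -tpowS; exact: Jeven_tpow.
have rt : r = t *m scalmx T N.
  by apply: (ltfree_inj cT); rewrite rE -mulmxA -bE tE.
have tR l : R (t 0 l).
  have -> : t = r *m scalmx T (pinvmx N).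
    by rewrite rt -mulmxA -scalmxM NX scalmx1 mulmx1.
  rewrite mxE; apply: subspace_sum; first exact: subspace_rels.
  move=> l' _; rewrite mxE malg_scalerAr mulr1.
  by apply: subspaceZ; [exact: subspace_rels|exact: Rr].
have -> : x = (t *m b) 0 0 by rewrite tE mxE.
rewrite mxE Jb; apply: subspace_sum; first exact: subspace_tprod.
by move=> l _; apply: tprod_mem => //; exact: kspan_gen.
Qed.
End FiniteRelations.
End FiniteAlphabet.
End Presentation.

(** * Minimal resolutions given by matrices *)

Section MatrixMaps.
Context (k : fieldType) (A : algType k) (aug : {rmorphism A -> k}).

Lemma linear_row_ex (n : nat) (N : lmodType A) (y : 'I_n -> N) :
  exists f : {linear 'rV[A]_n -> N}, forall x, f x = \sum_c x 0 c *: y c.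
Proof.
apply: linear_of_fun => a u v /=; rewrite scaler_sumr -big_split.
by apply: eq_bigr => c _; rewrite !mxE scalerDl scalerA.
Qed.

Lemma projective_row n : projective 'rV[A]_n.
Proof.
move=> N N' g f g_surj; have /choice[y yE] (c : 'I_n) :=
  g_surj (f (delta_mx 0 c)).
have [h hE] := linear_row_ex y; exists h => x.
rewrite hE linear_sum /= [x in RHS]row_sum_delta linear_sum.
by apply: eq_bigr => c _; rewrite !linearZ /= yE.
Qed.

Lemma cochain_row n (f : {linear 'rV[A]_n -> k | aug \; *%R}) x :
  f x = \sum_c aug (x 0 c) * f (delta_mx 0 c).
Proof.
rewrite [x in LHS]row_sum_delta linear_sum; apply: eq_bigr => c _.
by rewrite linearZ.
Qed.

Lemma cochain_row_ex n (e : 'cV[k]_n) :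
  exists f : {linear 'rV[A]_n -> k | aug \; *%R},
    forall x, f x = \sum_c aug (x 0 c) * e c 0.
Proof.
apply: linear_of_fun => a u v /=; rewrite mulr_sumr -big_split.
by apply: eq_bigr => c _; rewrite !mxE rmorphD rmorphM mulrDl mulrA.
Qed.
End MatrixMaps.

Section MatrixResolution.
Context (k : fieldType) (A : algType k) (aug : {rmorphism A -> k}).
Context (n : nat -> nat) (D : forall i, 'M[A]_(n i.+1, n i)).
Context (e : {linear 'rV[A]_(n 0%N) -> k | aug \; *%R}).
Hypothesis e_surj : forall c, exists x, e x = c.
Hypothesis exact0 : forall x, e x = 0 <-> exists y, x = y *m D 0%N.
Hypothesis exactD : forall i (x : 'rV_(n i.+1)),
  x *m D i = 0 <-> exists y, x = y *m D i.+1.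

Definition matrix_resolution : resolution aug :=
  @Resolution k A aug (fun i => 'rV[A]_(n i)) (fun i => mulmxr (D i)) e
    (fun i => @projective_row k A (n i)) e_surj exact0 exactD.

Local Notation Q := matrix_resolution.

Hypothesis aug_alg : forall c : k, aug c%:A = c.
Hypothesis minimal : forall i r c, aug (D i r c) = 0.

Lemma minimal_cocycle i (f : cochain Q i) x : f (res_d Q i x) = 0.
Proof.
rewrite cochain_row big1 // => c _; rewrite /= mxE rmorph_sum big1 ?mul0r //.
by move=> r _; rewrite rmorphM minimal mulr0.
Qed.

Lemma matrix_dd i : D i.+1 *m D i = 0.
Proof.
apply: rV_eq0 => r; rewrite row_mul; apply/exactD; exists (delta_mx 0 r).
by rewrite -rowE.
Qed.

(** The given matrices are kept in degrees zero, one and two.  The complexes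
    shifted by two degrees remain exact, so the third matrix extends upwards. *)
Lemma matrix_chain_map m (F0 : 'M[A]_(n m, n 0%N)) (F1 : 'M[A]_(n m.+1, n 1%N))
    (F2 : 'M[A]_(n m.+2, n 2%N)) :
  F1 *m D 0%N = D m *m F0 -> F2 *m D 1%N = D m.+1 *m F1 ->
  exists F : forall i, {linear Q (i + m)%N -> Q i},
    [/\ forall i (x : Q (i.+1 + m)%N),
          F i (res_d Q (i + m) x) = res_d Q i (F i.+1 x),
        forall x, F 0%N x = x *m F0, forall x, F 1%N x = x *m F1
      & forall x, F 2 x = x *m F2].
Proof.
move=> E0 E1.
have [|||||F [F2E _ FE]] := @chain_map_extend A
  (fun i => Q (i.+2 + m)%N) (fun i => Q i.+2)
  (fun i => res_d Q (i.+2 + m)) (fun i => res_d Q i.+2) (fun _ _ => True)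
  (mulmxr F2).
- by move=> i x; exact: res_dd.
- by move=> i x; exact: res_exactE.
- move=> i a _ ax; have [b bE] := projective_lift
    (f := a \o res_d Q (i.+2 + m)) (g := res_d Q i.+2)
    (@projective_row k A (n (i.+3 + m)%N)) ax.
  by exists b => // x; rewrite bE.
- by [].
- move=> x; apply: res_exactE; rewrite /= -!mulmxA E1.
  by rewrite !mulmxA -(mulmxA x) matrix_dd mulmx0 mul0mx.
pose FF i : {linear Q (i + m)%N -> Q i} :=
  match i with 0%N => mulmxr F0 | 1%N => mulmxr F1 | i'.+2 => F i' end.
exists FF; split=> //= [[|[|i]] x /=|x].
- by rewrite -!mulmxA E0.
- by rewrite F2E /= -!mulmxA E1.
- exact: FE.
- by rewrite F2E.
Qed.

(** Products with a class of degree [m] reach all of degree [m + r] when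
    finitely many chain maps of degree [m] have jointly split components in
    degree [r].  For minimal resolutions no coboundaries interfere. *)
Hypothesis products : forall m r, ~~ odd m -> (r == 1%N) || (r == 2%N) ->
  exists q, exists F : 'I_q -> forall i, {linear Q (i + m)%N -> Q i},
  exists N : 'I_q -> 'M[k]_(n (r + m)%N, n r),
  exists X : 'I_q -> 'M[k]_(n r, n (r + m)%N),
    [/\ forall c i (x : Q (i.+1 + m)%N),
          F c i (res_d Q (i + m) x) = res_d Q i (F c i.+1 x),
        forall c (x : 'rV[A]_(n (r + m)%N)),
          F c r x = x *m scalmx A (N c)
      & \sum_c N c *m X c = 1%:M].

Lemma aug_scalmx m p (x : 'rV[A]_m) (N : 'M[k]_(m, p)) j :
  aug ((x *m scalmx A N) 0 j) = \sum_l aug (x 0 l) * N l j.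
Proof.
rewrite mxE rmorph_sum; apply: eq_bigr => l _.
by rewrite rmorphM [scalmx _ _ _ _]mxE aug_alg.
Qed.

(** Strong induction on the degree.  In degree zero, exactness makes a cochain a
    multiple of the augmentation.  From degree three on, subtracting one or two
    leaves an even degree; all cochains of that degree are in the subalgebra, and
    the splitting in [products] writes the given one as a sum of products. *)
Theorem matrix_ext_generated12 :
  ext_generated12 (all_cochains Q) (all_maps Q).
Proof.
move=> S SP S1 S2.
have cocyc i (f : cochain Q i) : cocycle (all_cochains Q) f.
  by split=> // x; exact: minimal_cocycle.
have S0 i (f : cochain Q i) : (forall x, f x = 0) -> S i f.
  move=> f0; apply: (exts_coboundary SP) => //.
  by case: i f f0 => [|i] f f0 //; exists \0.
suff main i (f : cochain Q i) : S i f by move=> i f _.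
have [B] := ubnP i; elim: B i f => // B IH i f; rewrite ltnS => iB.
have step m r : ~~ odd m -> (r == 1%N) || (r == 2%N) -> (r + m)%N = i -> S i f.
  move=> m_even r12 mri; case: _ / mri f iB => f iB.
  have [q [F [N [X [Fd FE NX]]]]] := products m_even r12.
  have rm : (m < r + m)%N.
    by rewrite -[X in (X < _)%N]add0n ltn_add2r; case/orP: r12 => /eqP ->.
  have /choice[g gE] c :=
    @cochain_row_ex k A aug _ (X c *m (\col_l f (delta_mx 0 l))).
  have Sg c : S r (g c).
    by case/orP: r12 => /eqP r12; move: (g c); rewrite r12 => g';
      [exact: S1|exact: S2].
  have Sh c : S (r + m)%N (g c \o F c r).
    apply: (exts_prod SP (Sg c) (f := res_aug Q \o F c 0%N)).
      by apply: IH; apply: leq_trans rm _.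
    by exists (F c); split.
  have fE x : f x = \sum_c g c (F c r x).
    pose y := \row_l aug (x 0 l); pose v := \col_l f (delta_mx 0 l).
    transitivity ((y *m v) 0 0).
      by rewrite cochain_row mxE; apply: eq_bigr => l _; rewrite !mxE.
    rewrite -[y]mulmx1 -NX mulmx_sumr mulmx_suml summxE; apply: eq_bigr => c _.
    rewrite gE FE -!mulmxA mulmxA [LHS]mxE; apply: eq_bigr => l _.
    rewrite aug_scalmx; congr (_ * _); rewrite mxE.
    by apply: eq_bigr => l' _; rewrite mxE.
  have sumS (P : seq 'I_q) :
      exists2 h, S (r + m)%N h & forall x, h x = \sum_(c <- P) g c (F c r x).
    elim: P => [|c P [h Sh' hE]].
      by exists \0; [exact: S0|move=> x; rewrite big_nil].
    exists ((g c \o F c r) \+ h); last by move=> x; rewrite big_cons /= hE.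
    by apply: (exts_linear SP (c := 1) (Sh c) Sh') => x; rewrite mul1r.
  have [h Sh' hE] := sumS (index_enum 'I_q).
  by apply: exts_eq SP _ _ _ Sh' _ => x; rewrite hE fE.
case: i f iB step => [|[|[|i]]] f iB step.
- have [x1 x1E] := res_surj Q 1.
  apply: (exts_linear SP (c := f x1) (exts_unit SP) (S0 _ \0 _)) => // x.
  have /res_exact0[y yE] : res_aug Q (x - (res_aug Q x)%:A *: x1) = 0.
    by rewrite linearB linearZ /= x1E aug_alg mulr1 subrr.
  have := minimal_cocycle f y; rewrite -yE linearB linearZ /= aug_alg.
  by move/eqP; rewrite subr_eq0 addr0 mulrC => /eqP.
- exact: S1.
- exact: S2.
case odd_i: (odd i); [apply: (step i.+1 2)|apply: (step i.+2 1%N)] => //=.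
  by rewrite odd_i.
by rewrite odd_i.
Qed.
End MatrixResolution.

(** * Gradings of matrix resolutions *)

Section GradedMatrixResolution.
Context (k : fieldType) (A : algType k) (aug : {rmorphism A -> k}).
Context (Az : int -> set A).
Hypothesis Az0 : forall d, Az d 0.
Hypothesis AzB : forall d a b, Az d a -> Az d b -> Az d (a - b).
Hypothesis AzM : forall d e a b, Az d a -> Az e b -> Az (d + e) (a * b).
Hypothesis Az_neg : forall m a, Az (Negz m) a -> a = 0.
Hypothesis Az_direct : forall (D : seq int) (c : int -> A), uniq D ->
  (forall d, Az d (c d)) -> \sum_(d <- D) c d = 0 ->
  forall d, d \in D -> c d = 0.
Let Agr (m : nat) : set A := Az m%:Z.
Hypothesis Aspan : homogeneous_span Agr.
Hypothesis Az_aug : forall d a, d != 0 -> Az d a -> aug a = 0.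

Definition row_gr n (g : 'I_n -> nat) (d : int) : set 'rV[A]_n :=
  [set x | forall c, Az (d - (g c)%:Z) (x 0 c)].

Lemma AzD d a b : Az d a -> Az d b -> Az d (a + b).
Proof.
move=> ga gb; rewrite -[b]opprK; apply: AzB => //.
by rewrite -sub0r; exact: AzB.
Qed.

Lemma row_grading n (g : 'I_n -> nat) : is_grading Agr (row_gr g).
Proof.
split=> [d c|d x y gx gy c|e d a x ga gx c|x|D x uD gx S0 d dD].
- by rewrite mxE.
- by rewrite !mxE; exact: AzB.
- by rewrite mxE addrAC addrC; exact: AzM.
- have /choice[E /choice[y yP]] c : exists E : seq nat, exists y : nat -> A,
      (forall m, Agr m (y m)) /\ x 0 c = \sum_(m <- E) y m.
    by have [E [y gy xE]] := Aspan (x 0 c); exists E, y.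
  pose deg (t : 'I_n * nat) : int := t.2%:Z + (g t.1)%:Z.
  pose z (t : 'I_n * nat) : 'rV[A]_n := y t.1 t.2 *: delta_mx 0 t.1.
  pose r := [seq (c, m) | c <- enum 'I_n, m <- E c].
  exists (undup [seq deg t | t <- r]).
  exists (fun d => \sum_(t <- r | deg t == d) z t) => [d c|].
    rewrite summxE; apply: big_ind => [//|a b|[c' m] /eqP <-]; first exact: AzD.
    rewrite !mxE eqxx /=; case: eqP => [->|_]; last by rewrite mulr0.
    by rewrite mulr1 /deg /= addrK; case: (yP c') => /(_ m).
  rewrite -sum_by_degree /r big_allpairs_dep /= big_enum /=.
  rewrite [x in LHS]row_sum_delta.
  apply: eq_bigr => c _; rewrite /z /= -scaler_suml; congr (_ *: _).
  by case: (yP c).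
- apply/rowP => c; rewrite [RHS]mxE.
  pose u (d : int) := x (d + (g c)%:Z) 0 c.
  have -> : x d 0 c = u (d - (g c)%:Z) by rewrite /u subrK.
  apply: (Az_direct (D := [seq d - (g c)%:Z | d <- D])) => [|d'||].
  + by rewrite map_inj_uniq //; exact: addIr.
  + by have := gx (d' + (g c)%:Z) c; rewrite addrK.
  + rewrite big_map; transitivity ((\sum_(d <- D) x d) 0 c);
      last by rewrite S0 mxE.
    by rewrite summxE; apply: eq_bigr => d' _; rewrite /u subrK.
  + exact: (map_f (fun d => d - (g c)%:Z)).
Qed.

(** The images of the finitely many basis vectors have finitely many homogeneous
    parts; each of them defines a homogeneous map. *)
Lemma row_graded_hom n (g : 'I_n -> nat) (M : lmodType A) (gM : int -> set M)
    (GM : is_grading Agr gM) (f : {linear 'rV[A]_n -> M}) :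
  graded_hom (row_gr g) gM f.
Proof.
have /choice[E /choice[y yP]] c : exists E : seq int, exists y : int -> M,
    (forall d, gM d (y d)) /\ f (delta_mx 0 c) = \sum_(d <- E) y d.
  by have [E [y gy fE]] := gr_sum GM (f (delta_mx 0 c)); exists E, y.
have /choice[F FE] (t : 'I_n * int) : exists F : {linear 'rV[A]_n -> M},
    forall x, F x = x 0 t.1 *: y t.1 t.2.
  apply: linear_of_fun => a u v /=.
  by rewrite !mxE scalerDl scalerA.
pose r := [seq (c, d) | c <- enum 'I_n, d <- E c].
apply: (@graded_hom_sum _ _ _ _ _ _ _ _ _ _ r (fun t => t.2 - (g t.1)%:Z) F).
- exact: gr_zero GM.
- exact: grD GM.
- move=> [c e] d x _ gx; rewrite FE /=; have := gx c.
  have -> : d + (e - (g c)%:Z) = e + (d - (g c)%:Z) by rewrite addrCA.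
  case: (d - _) => m; last first.
    by move/Az_neg->; rewrite scale0r; exact: (gr_zero GM).
  by move=> gxc; apply: (gr_scale GM gxc); case: (yP c).
- move=> x; rewrite /r big_allpairs_dep /= big_enum /=.
  rewrite {1}[x]row_sum_delta linear_sum.
  apply: eq_bigr => c _; rewrite linearZ /=; case: (yP c) => _ ->.
  by rewrite scaler_sumr; apply: eq_bigr => d _; rewrite FE.
Qed.

Lemma row_graded_cochain n (g : 'I_n -> nat)
    (f : {linear 'rV[A]_n -> k | aug \; *%R}) :
  graded_hom (row_gr g) (@trivial_gr k) f.
Proof.
have /choice[F FE] c : exists F : {linear 'rV[A]_n -> k | aug \; *%R},
    forall x, F x = aug (x 0 c) * f (delta_mx 0 c).
  apply: linear_of_fun => a u v /=.
  by rewrite !mxE rmorphD rmorphM mulrDl mulrA.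
apply: (@graded_hom_sum _ _ _ _ _ _ _ _ _ _ (index_enum 'I_n)
  (fun c => - (g c)%:Z) F).
- by [].
- by move=> d x y gx gy d0; rewrite gx // gy // addr0.
- by move=> c d x _ gx d0; rewrite FE (Az_aug d0 (gx c)) mul0r.
- by move=> x; rewrite cochain_row; apply: eq_bigr => c _; rewrite FE.
Qed.

Context (n : nat -> nat) (D : forall i, 'M[A]_(n i.+1, n i)).
Context (e : {linear 'rV[A]_(n 0%N) -> k | aug \; *%R}).
Hypothesis e_surj : forall c, exists x, e x = c.
Hypothesis exact0 : forall x, e x = 0 <-> exists y, x = y *m D 0%N.
Hypothesis exactD : forall i (x : 'rV_(n i.+1)),
  x *m D i = 0 <-> exists y, x = y *m D i.+1.
Context (g : forall i, 'I_(n i) -> nat).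
Hypothesis Dgr : forall i r c, Az ((g r)%:Z - (g c)%:Z) (D i r c).
Hypothesis egr : forall c, e (delta_mx 0 c) != 0 -> g c = 0%N.

Definition graded_matrix_resolution : gresolution aug Agr.
Proof.
apply: (@GResolution _ _ _ _ (matrix_resolution e_surj exact0 exactD)
  (fun i => row_gr (@g i))).
- by move=> i; exact: row_grading.
- move=> i d x gx c /=; rewrite mxE; apply: big_ind => [//|a b|r _];
    first exact: AzD.
  by rewrite -(subrKA (g r)%:Z); exact: AzM.
- move=> d x gx d0 /=; rewrite cochain_row big1 // => c _.
  have [->|/egr gc] := eqVneq (e (delta_mx 0 c)) 0; first by rewrite mulr0.
  by rewrite (Az_aug d0) ?mul0r //; have := gx c; rewrite gc subr0.
Defined.
End GradedMatrixResolution.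

(** * The multi-Koszul complex in terms of matrices *)

Section Presentation.
Context (k : fieldType) (I : choiceType) (A : algType k) (p : presentation I A).
Local Notation T := (tensor_alg k I).
Local Notation word := {fmonom I}.
Local Notation one := (@mone word).
Local Notation V := (@Vsub k I).
Local Notation R := (rels p).
Local Notation deg := (gdeg p).
Local Notation pi := (proj p).
Local Notation aug := (pres_aug p).
Local Notation AT := {malg A[word]}.

Lemma tensE (a : A) (x : T) w : (tens a x)@_w = x@_w *: a.
Proof.
rewrite /tens raddf_sum /=; have [wx|wx] := boolP (w \in msupp x); last first.
  rewrite (mcoeff_outdom wx) scale0r big_seq big1 // => u ux.
  rewrite mcoeffU; case: eqP => [uw|_]; last by rewrite mulr0n.
  by rewrite uw (negPf wx) in ux.
rewrite (bigD1_seq w) //= ?fset_uniq // mcoeffUU big1 ?addr0 // => u.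
by move=> /negPf uw; rewrite mcoeffU uw mulr0n.
Qed.

Lemma tensZ a x : tens a x = a *: tens 1 x :> AT.
Proof.
by apply/malgP => w; rewrite [LHS]tensE [RHS]mcoeffZ tensE -scalerAr mulr1.
Qed.

Lemma tens_linear c (x y : T) :
  tens 1 (c *: x + y) = c%:A *: tens 1 x + tens 1 y :> AT.
Proof.
apply/malgP => w; rewrite [RHS]mcoeffD [X in _ = X + _]mcoeffZ.
rewrite [LHS]tensE [X in _ = _ * X + _]tensE [X in _ = _ + X]tensE.
by rewrite mcoeffD mcoeffZ scalerDl -scalerA mulr_algl.
Qed.

Lemma tens0 : tens 1 (0 : T) = 0 :> AT.
Proof. by apply/malgP => w; rewrite tensE !mcoeff0 scale0r. Qed.

Lemma tens_sum n (u : 'rV[k]_n) (b : 'cV[T]_n) :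
  tens 1 (\sum_c u 0 c *: b c 0) = \sum_c (u 0 c)%:A *: tens 1 (b c 0) :> AT.
Proof.
apply: (big_rec2 (fun x (y : AT) => tens 1 x = y)); first exact: tens0.
by move=> c y x _ xy; rewrite tens_linear xy.
Qed.

(** The free [A]-module on a family, inside of [A (x) T(V)]. *)
Definition iota n (b : 'cV[T]_n) (x : 'rV[A]_n) : AT :=
  \sum_c x 0 c *: tens 1 (b c 0).

Lemma iota_is_linear n (b : 'cV[T]_n) : linear (iota b).
Proof.
move=> a x y; rewrite /iota scaler_sumr -big_split; apply: eq_bigr => c _.
by rewrite !mxE scalerDl scalerA.
Qed.

HB.instance Definition _ n (b : 'cV[T]_n) :=
  GRing.isLinear.Build A 'rV[A]_n AT *:%R (iota b) (iota_is_linear b).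

Lemma iota_coef n (b : 'cV[T]_n) x w :
  (iota b x)@_w = \sum_c x 0 c * ((b c 0)@_w)%:A.
Proof.
rewrite /iota raddf_sum; apply: eq_bigr => c _.
by rewrite /= mcoeffZ tensE.
Qed.

(** Independence of [b] over [k] shows on finitely many words: the matrix of its
    coefficients at them has a right inverse over [k], which also serves over
    [A]. *)
Lemma iota_inj n (b : 'cV[T]_n) : kfree b -> injective (iota b).
Proof.
move=> bF x y xy; apply/eqP; rewrite -subr_eq0; apply/eqP.
have {xy} : iota b (x - y) = 0 by rewrite linearB /= xy subrr.
move: (x - y) => {y}x x0.
pose s : seq word := flatten [seq (msupp (b c 0) : seq word) | c <- enum 'I_n].
pose C : 'M[k]_(n, size s) := \matrix_(c, l) (b c 0)@_(tnth (in_tuple s) l).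
have C_inv : C *m pinvmx C = 1%:M.
  apply: mulmxVp; rewrite -kermx_eq0; apply/eqP/rV_eq0 => i; set u := row i _.
  have uC : u *m C = 0 by rewrite -row_mul mulmx_ker row0.
  apply: bF; apply/matrixP => a z; rewrite !ord1 scalmx_mulE [RHS]mxE.
  apply/malgP => w; rewrite mcoeff0 raddf_sum /=.
  have [ws|ws] := boolP (w \in s).
    have ltw : (index w s < size s)%N by rewrite index_mem.
    transitivity ((u *m C) 0 (Ordinal ltw)); last by rewrite uC mxE.
    rewrite [RHS]mxE; apply: eq_bigr => c _.
    by rewrite mcoeffZ [C _ _]mxE (tnth_nth w) /= nth_index.
  rewrite big1 // => c _; rewrite mcoeffZ mcoeff_outdom ?mulr0 //.
  apply: contra ws => wb; apply/flattenP; exists (msupp (b c 0) : seq word) => //.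
  by apply: map_f; rewrite mem_enum.
have xC : x *m scalmx A C = 0.
  apply/rowP => l; transitivity ((iota b x)@_(tnth (in_tuple s) l)).
    by rewrite iota_coef mxE; apply: eq_bigr => c _; rewrite !mxE.
  by rewrite x0 mcoeff0 mxE.
by rewrite -[x]mulmx1 -scalmx1 -C_inv scalmxM mulmxA xC mul0mx.
Qed.

Lemma Kleft_iota i n (b : 'cV[T]_n) : J R i = kspan b ->
  Kleft p i = [set y | exists x, y = iota b x].
Proof.
move=> Jb; apply/seteqP; split=> [|_ [x ->]]; last first.
  apply: subspace_sum; first exact: subspace_lspan.
  move=> c _; apply: subspaceZ; first exact: subspace_lspan.
  by apply: lspan_gen; exists (b c 0) => //; rewrite Jb; exact: kspan_gen.
apply: lspan_min => [|_ [y Jy <-]].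
  split=> [|a _ _ [x ->] [y ->]]; first by exists 0; rewrite linear0.
  by exists (a *: x + y); rewrite linearP.
move: Jy; rewrite Jb => -[u ->]; exists (\row_c (u 0 c)%:A).
by rewrite tens_sum; apply: eq_bigr => c _; rewrite mxE.
Qed.

(** The relation between an element [x] of a space [J] and the value [X] of the
    differential at [x]: coefficients of [x] over [b] project to those of [X].
    It is additive, so it can be checked term by term in the formula for the
    differential, where no choice of coefficients is given. *)
Definition represented n (b : 'cV[T]_n) (x : T) (X : AT) : Prop :=
  exists2 u : 'rV[T]_n, x = \sum_c u 0 c * b c 0
    & X = \sum_c pi (u 0 c) *: tens 1 (b c 0).

Lemma represented0 n (b : 'cV[T]_n) : represented b 0 0.
Proof.
by exists 0; rewrite big1 // => c _; rewrite mxE ?rmorph0 ?mul0r ?scale0r.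
Qed.

Lemma representedD n (b : 'cV[T]_n) x x' X X' :
  represented b x X -> represented b x' X' -> represented b (x + x') (X + X').
Proof.
move=> [u -> ->] [u' -> ->]; exists (u + u'); rewrite -big_split;
  apply: eq_bigr => c _; rewrite !mxE /=; first by rewrite mulrDl.
by rewrite rmorphD scalerDl.
Qed.

Lemma represented_sum n (b : 'cV[T]_n) (H : eqType) (r : seq H) (F : H -> T)
    (G : H -> AT) :
  (forall h, h \in r -> represented b (F h) (G h)) ->
  represented b (\sum_(h <- r) F h) (\sum_(h <- r) G h).
Proof.
move=> FG; rewrite big_seq_cond [X in represented _ _ X]big_seq_cond.
apply: big_ind2 => [||h /andP[hr _]]; [exact: represented0| |exact: FG].
by move=> x X x' X'; exact: representedD.
Qed.

Lemma represented_mul n (b : 'cV[T]_n) (y z : T) :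
  kspan b z -> represented b (y * z) (tens (pi y) z).
Proof.
case=> u ->; exists (\row_c (u 0 c *: y)).
  rewrite mulr_sumr; apply: eq_bigr => c _.
  by rewrite mxE malg_scalerAr scalerAl.
rewrite tensZ tens_sum scaler_sumr; apply: eq_bigr => c _.
by rewrite mxE scalerA linearZ /= mulr_algr.
Qed.

Lemma aug_Vsub x : V x -> aug (pi x) = 0.
Proof.
by move=> /longer_Vsub x1; rewrite pres_augE; apply: (longer_coef x1);
  rewrite fm1.
Qed.

Lemma aug_tpow l x : (0 < l)%N -> tpow V l x -> aug (pi x) = 0.
Proof.
by move=> l0 /longer_tpow xl; rewrite pres_augE; apply: (longer_coef xl);
  rewrite fm1.
Qed.

Lemma aug_alg (c : k) : aug c%:A = c.
Proof.
have -> : c%:A = pi (c *: 1) by rewrite linearZ rmorph1.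
by rewrite pres_augE mcoeffZ mcoeff1 eqxx mulr1.
Qed.

(** The differential out of an odd term: the second sum in its definition
    vanishes over the trivial module, so that only the decomposition in
    [V J (2j)] remains. *)
Lemma odd_differential_matrix j n m (b : 'cV[T]_n) (b' : 'cV[T]_m) d :
  is_diff_odd p j d -> Jeven R j = kspan b -> Jodd R j = kspan b' ->
  exists M : 'M[T]_(m, n), [/\ forall r c, V (M r c), M *m b = b'
    & forall r, d (tens 1 (b' r 0)) = \sum_c pi (M r c) *: tens 1 (b c 0)].
Proof.
move=> dP Jb Jb'; have b'J r : Jodd R j (b' r 0) by rewrite Jb'; exact: kspan_gen.
have [M VM Mb] : exists2 M : 'M[T]_(m, n), (forall r c, V (M r c)) & M *m b = b'.
  apply: tprod_kspan_mx; first exact: subspace_Vsub.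
  by move=> r; rewrite -Jb; case: (b'J r).
exists M; split=> // r.
have [_ /(tprod_terms (subspace_Jeven p j))[s' s'P s'E]] := b'J r.
pose s := [seq (M r c, b c 0) | c <- index_enum 'I_n].
have sE : b' r 0 = \sum_(t <- s) t.1 * t.2 by rewrite -Mb mxE big_map.
rewrite sE (dP s s') => [||t /s'P//|]; last by rewrite -sE.
  rewrite big_map [X in _ - X]big_seq [X in _ - X]big1 ?subr0 =>
    [|t /s'P[_ /aug_Vsub ->]].
    by apply: eq_bigr => c _; rewrite /= tensZ.
  by rewrite scale0r tensZ scale0r.
by move=> _ /mapP[c _ ->]; split; [exact: VM|rewrite Jb; exact: kspan_gen].
Qed.

Section FiniteAlphabet.
Context (eI : seq I) (eI_uniq : uniq eI) (eI_all : forall i, i \in eI).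

(** The differential out of an even term: over the trivial module only the
    terms with [l = N] contribute, that is a decomposition in [T J (2j + 1)]. *)
Lemma even_differential_matrix j n m (b : 'cV[T]_n) (b' : 'cV[T]_m) d :
  is_diff_even p j d -> Jodd R j = kspan b -> Jeven R j.+1 = kspan b' ->
  exists2 M : 'M[T]_(m, n), M *m b = b'
    & forall r, d (tens 1 (b' r 0)) = \sum_c pi (M r c) *: tens 1 (b c 0).
Proof.
move=> dP Jb Jb'.
have rep r : represented b (b' r 0) (d (tens 1 (b' r 0))).
  have Jr : Jeven R j.+1 (b' r 0) by rewrite Jb'; exact: kspan_gen.
  have [B [om omP xE]] := Jeven_decomposition eI_uniq eI_all Jr.
  have /choice[s sP] (Nl : nat * nat) : exists s : seq (T * T * T),
      (Nl.2 <= Nl.1)%N -> (forall t, t \in s ->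
        [/\ tpow V Nl.2 t.1.1, Jodd R j t.1.2 & tpow V (Nl.1 - Nl.2) t.2])
      /\ \sum_(t <- s) t.1.1 * t.1.2 * t.2 = om Nl.1.
    case: (leqP Nl.2 Nl.1) => [le|_]; last by exists [::].
    have [s sP sE] := tprod3_terms (@subspace_tpow k I V Nl.2)
      (subspace_Jodd p j) (omP Nl.1 Nl.2 le).
    by exists s.
  have sP' N l : (N < B)%N -> (l <= N)%N -> (forall t, t \in s (N, l) ->
        [/\ tpow V l t.1.1, Jodd R j t.1.2 & tpow V (N - l) t.2])
      /\ \sum_(t <- s (N, l)) t.1.1 * t.1.2 * t.2 = om N.
    by move=> _; exact: sP (N, l).
  have := dP B om (fun N l => s (N, l)) sP'.
  rewrite -xE => /(_ Jr) ->; rewrite xE.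
  apply: represented_sum => N _; have [_ <-] := sP (N : nat, N : nat) (leqnn N).
  rewrite big_ord_recr /= [X in represented _ _ (X + _)]big1 ?add0r => [|l _];
    last first.
    rewrite big_seq big1 // =>
      t /(proj1 (sP (N : nat, l : nat) (ltnW (ltn_ord l))))[_ _ /=].
    by move=> /aug_tpow ->; rewrite ?subn_gt0 // scale0r tensZ scale0r.
  apply: represented_sum => t /(proj1 (sP (N : nat, N : nat) (leqnn N)))[_ Jt /=].
  rewrite subnn => /ksubP[c cE].
  have -> : t.1.1 * t.1.2 * t.2 = (c *: t.1.1) * t.1.2.
    by rewrite cE malg_scalerAr mulr1 scalerAl.
  have -> : aug (pi t.2) *: pi t.1.1 = pi (c *: t.1.1).
    by rewrite cE !linearZ /= rmorph1 aug_alg.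
  by apply: represented_mul; rewrite -Jb.
have /choice[u uP] r : exists u : 'rV[T]_n, b' r 0 = \sum_c u 0 c * b c 0 /\
    d (tens 1 (b' r 0)) = \sum_c pi (u 0 c) *: tens 1 (b c 0).
  by have [u uE duE] := rep r; exists u.
exists (\matrix_(r, c) u r 0 c) => [|r].
  apply/matrixP => r z; rewrite ord1 [LHS]mxE; case: (uP r) => -> _.
  by apply: eq_bigr => c _; rewrite mxE.
by case: (uP r) => _ ->; apply: eq_bigr => c _; rewrite mxE.
Qed.

Lemma Vsub_eq0 x : V x -> (forall i, x@_(fmu i) = 0) -> x = 0.
Proof.
move=> Vx x0; have Vlen : Tdeg (fun=> 1%N) 1 x.
  move: x Vx {x0}; apply: lspan_min => [|_ [i _ <-]]; first exact: subspace_Tdeg.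
  exact: (@Tdeg_gen k I (fun=> 1%N) i).
apply/malgP => w; rewrite mcoeff0; have [//|xw] := eqVneq x@_w 0.
have /TdegP/(_ w xw) := Vlen; rewrite wdeg_size.
case wE: (w : seq I) => [|i [|//]] // _.
by rewrite -(x0 i); congr (x@__); apply: val_inj; rewrite /= fmU.
Qed.

Section FiniteRelations.
Hypothesis R_supp : finitely_supported R.

(** There is a matrix over [R] that expresses [b2] by [b0], and matrices over the
    independent family [b0] are unique. *)
Lemma relation_matrix j n0 n1 n2 (b0 : 'cV[T]_n0) (b1 : 'cV[T]_n1)
    (b2 : 'cV[T]_n2) (M : 'M[T]_(n1, n0)) (M' : 'M[T]_(n2, n1)) :
  ltfree b0 -> Jeven R j = kspan b0 -> Jeven R j.+1 = kspan b2 ->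
  M *m b0 = b1 -> M' *m b1 = b2 -> forall r c, R ((M' *m M) r c).
Proof.
move=> b0F Jb0 Jb2 Mb Mb'.
have [N RN Nb] : exists2 N : 'M[T]_(n2, n0),
    (forall r c, R (N r c)) & N *m b0 = b2.
  apply: tprod_kspan_mx; first exact: (subspace_rels p).
  move=> r; rewrite -Jb0; apply: (Jeven_coproduct R_supp).
  by rewrite Jb2; exact: kspan_gen.
suff -> : M' *m M = N by [].
by apply: (ltfree_inj b0F); rewrite Nb -mulmxA Mb.
Qed.

(** Constant entries of the second of two consecutive matrices would give
    linear terms in the relations formed by their product. *)
Lemma even_matrix_minimal n0 n1 n2 (b0 : 'cV[T]_n0) (b1 : 'cV[T]_n1)
    (M : 'M[T]_(n1, n0)) (M' : 'M[T]_(n2, n1)) :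
  kfree b1 -> M *m b0 = b1 -> (forall r c, V (M r c)) ->
  (forall r c, R ((M' *m M) r c)) -> forall r c, (M' r c)@_one = 0.
Proof.
move=> b1F Mb VM RM.
pose C : 'M[k]_(n2, n1) := \matrix_(r, c) (M' r c)@_one.
suff C0 : C = 0 by move=> r c; have /matrixP/(_ r c) := C0; rewrite !mxE.
apply: (kfree_mx b1F); rewrite -Mb mulmxA (_ : scalmx T C *m M = 0) ?mul0mx //.
apply/matrixP => r c; rewrite scalmx_mulE [RHS]mxE; apply: Vsub_eq0 => [|i].
  apply: subspace_sum; first exact: subspace_Vsub.
  by move=> l _; apply: subspaceZ => //; exact: subspace_Vsub.
transitivity (((M' *m M) r c)@_(fmu i)); last first.
  by apply: (longer_coef (longer_rels (RM r c))); rewrite fmU.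
rewrite [(M' *m M) r c]mxE !raddf_sum; apply: eq_bigr => l _ /=.
have M1 : (M l c)@_one = 0.
  by apply: (longer_coef (longer_Vsub (VM l c))); rewrite fm1.
by rewrite mcoeffZ mcoeff_genM M1 mulr0 add0r mxE.
Qed.
End FiniteRelations.

(** Over homogeneous families, a matrix of coefficients which is unique is
    homogeneous. *)
Lemma homogeneous_matrix n m (b : 'cV[T]_n) (b' : 'cV[T]_m) (g : 'I_n -> nat)
    (g' : 'I_m -> nat) (M : 'M[T]_(m, n)) :
  ltfree b -> (forall c, Tdeg deg (g c) (b c 0)) ->
  (forall r, Tdeg deg (g' r) (b' r 0)) -> M *m b = b' ->
  forall r c,
    if (g c <= g' r)%N then Tdeg deg (g' r - g c) (M r c) else M r c = 0.
Proof.
move=> bF bg bg' Mb.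
pose H : 'M[T]_(m, n) := \matrix_(r, c)
  if (g c <= g' r)%N then hcomp deg (g' r - g c) (M r c) else 0.
have MH : M = H.
  apply: (ltfree_inj bF); rewrite Mb; apply/matrixP => r z; rewrite ord1.
  transitivity (hcomp deg (g' r) ((M *m b) r 0)).
    by rewrite Mb; exact/esym/bg'.
  have mulE (N : 'M[T]_(m, n)) : (N *m b) r 0 = \sum_c N r c * b c 0
    by rewrite mxE.
  transitivity (\sum_c hcomp deg (g' r) (M r c * b c 0)).
    by rewrite mulE linear_sum.
  transitivity (\sum_c H r c * b c 0); last by exact/esym/mulE.
  apply: eq_bigr => c _.
  have HE : H r c = if (g c <= g' r)%N then hcomp deg (g' r - g c) (M r c) else 0.
    by rewrite mxE.
  rewrite HE; have := hcompMr (g' r) (M r c) (bg c).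
  by case: ifP => _ // ->; rewrite mul0r.
have HE r c :
    H r c = if (g c <= g' r)%N then hcomp deg (g' r - g c) (M r c) else 0.
  by rewrite mxE.
move=> r c; rewrite MH HE; case: (g c <= g' r)%N; [exact: (Tdeg_hcomp deg)|by []].
Qed.
End FiniteAlphabet.
End Presentation.

(** * Homogeneous bases of a multi-Koszul resolution *)

Section AlgebraGrading.
Context (k : fieldType) (I : choiceType) (A : algType k) (p : presentation I A).
Local Notation T := (tensor_alg k I).
Local Notation R := (rels p).
Local Notation deg := (gdeg p).
Local Notation pi := (proj p).
Local Notation aug := (pres_aug p).

(** The gradings of [A] and of [T], with integers as degrees so that degrees can
    be subtracted. *)
Definition Az (d : int) : set A :=
  match d with Posz m => Adeg p m | Negz _ => [set 0] end.

Definition Tz (d : int) : set T :=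
  match d with Posz m => Tdeg deg m | Negz _ => [set 0] end.

Lemma Az_lift d a : Az d a -> exists x, pi x = a /\ Tz d x.
Proof.
case: d => m /=; first by case=> x xm <-; exists x.
by move=> ->; exists 0; rewrite rmorph0.
Qed.

Lemma pi_Tz d x : Tz d x -> Az d (pi x).
Proof. by case: d => m /=; [move=> xm; exists x|move=> ->; rewrite rmorph0]. Qed.

Lemma subspace_Tz d : subspace (Tz d).
Proof.
case: d => m; first exact: subspace_Tdeg.
by split=> // c x y -> ->; rewrite scaler0 addr0.
Qed.

Lemma Az0 d : Az d 0.
Proof. by rewrite -(rmorph0 pi); apply: pi_Tz; case: (subspace_Tz d). Qed.

Lemma AzB d a b : Az d a -> Az d b -> Az d (a - b).
Proof.
move=> /Az_lift[x [<- xd]] /Az_lift[y [<- yd]]; rewrite -rmorphB.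
by apply: pi_Tz; apply: subspaceB => //; exact: subspace_Tz.
Qed.

Lemma AzM d e a b : Az d a -> Az e b -> Az (d + e) (a * b).
Proof.
case: d => m; last by move=> -> _; rewrite mul0r; exact: Az0.
case: e => l; last by move=> _ ->; rewrite mulr0; exact: Az0.
move=> [x xm <-] [y yl <-]; rewrite -rmorphM -PoszD.
by exists (x * y) => //; exact: TdegM.
Qed.

Lemma Az_neg m a : Az (Negz m) a -> a = 0. Proof. by []. Qed.

Lemma graded_ideal : graded deg (ideal_of R).
Proof.
by apply: graded_tprod => //; apply: graded_tprod => //; exact: graded_rels.
Qed.

Lemma Az_direct (D : seq int) (c : int -> A) : uniq D ->
  (forall d, Az d (c d)) -> \sum_(d <- D) c d = 0 ->
  forall d, d \in D -> c d = 0.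
Proof.
move=> uD gc S0 [m|m] dD; last exact: Az_neg (gc (Negz m)).
have /choice[X XP] d := Az_lift (gc d).
have : ideal_of R (\sum_(d <- D) X d).
  apply/(proj_ker p); rewrite linear_sum -[RHS]S0.
  by apply: eq_bigr => d _; case: (XP d).
move/(graded_ideal m); rewrite linear_sum (bigD1_seq (Posz m)) //= big1 ?addr0.
  have [<- Xm] := XP (Posz m).
  by rewrite (hcomp_id _ Xm) eqxx => /(proj_ker p).
move=> d; case: (XP d) => _; case: d => l /=; last by move=> ->; rewrite linear0.
by move=> Xl ml; rewrite (hcomp_id m Xl); case: eqP => // lm;
  rewrite lm eqxx in ml.
Qed.

Lemma Az_span : homogeneous_span (fun m => Az m%:Z).
Proof.
move=> a; have [x <-] := proj_surj p a; have [B xE] := hcomp_sum deg x.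
exists (index_iota 0 B), (fun m => pi (hcomp deg m x)) => [m|].
  by exists (hcomp deg m x); [exact: Tdeg_hcomp|].
by rewrite {1}xE linear_sum big_mkord.
Qed.

Lemma Az_aug d a : d != 0 -> Az d a -> aug a = 0.
Proof.
case: d => m d0; last by move=> ->; rewrite rmorph0.
case=> x /TdegP xm <-; rewrite pres_augE;
  have [//|/xm] := eqVneq x@_(@mone {fmonom I}) 0.
by rewrite /wdeg fm1 big_nil => m0; rewrite -m0 eqxx in d0.
Qed.
End AlgebraGrading.

Lemma double_or_doubleS i : exists j, i = j.*2 \/ i = j.*2.+1.
Proof.
exists i./2; have [oi|/negPf oi] := boolP (odd i); [right|left];
  by rewrite -{1}(odd_double_half i) oi.
Qed.

Section Koszul.
Context (k : fieldType) (I : choiceType) (A : algType k) (p : presentation I A).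
Local Notation T := (tensor_alg k I).
Local Notation word := {fmonom I}.
Local Notation one := (@mone word).
Local Notation V := (@Vsub k I).
Local Notation R := (rels p).
Local Notation deg := (gdeg p).
Local Notation pi := (proj p).
Local Notation aug := (pres_aug p).
Local Notation AT := {malg A[word]}.

Context (eI : seq I) (eI_uniq : uniq eI) (eI_all : forall i, i \in eI).
Hypothesis R_supp : finitely_supported R.
Context (n : nat -> nat) (b : forall i, 'cV[T]_(n i)).
Context (g : forall i, 'I_(n i) -> nat).
Hypothesis bP : forall i, homogeneous_basis deg (J R i) (b i) (@g i).

Let bF i : kfree (b i). Proof. by case: (bP i). Qed.
Let bJ i : J R i = kspan (b i). Proof. by case: (bP i). Qed.
Let bT i : ltfree (b i).
Proof. exact: (ltfree_J eI_uniq eI_all R_supp (@bF i) (bJ i)). Qed.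

Let b_even j : Jeven R j = kspan (b j.*2).
Proof. by rewrite -bJ J_double. Qed.
Let b_odd j : Jodd R j = kspan (b j.*2.+1).
Proof. by rewrite -bJ J_doubleS. Qed.

Lemma differential_matrices (delta : nat -> {linear AT -> AT}) :
  is_left_diff p delta ->
  exists M : forall i, 'M[T]_(n i.+1, n i),
    [/\ forall i, M i *m b i = b i.+1,
        forall j r c, V (M j.*2 r c)
      & forall i r, delta i (tens 1 (b i.+1 r 0))
          = \sum_c pi (M i r c) *: tens 1 (b i c 0)].
Proof.
move=> [d_odd d_even].
have M_ex i : exists M : 'M[T]_(n i.+1, n i), [/\ M *m b i = b i.+1,
    ~~ odd i -> forall r c, V (M r c)
  & forall r, delta i (tens 1 (b i.+1 r 0))
      = \sum_c pi (M r c) *: tens 1 (b i c 0)].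
  have [j [->|->]] := double_or_doubleS i.
  - have [M [VM Mb dM]] := odd_differential_matrix (d_odd j) (b_even j) (b_odd j).
    by exists M; split.
  - have [M Mb dM] := even_differential_matrix eI_uniq eI_all (d_even j)
      (b_odd j) (b_even j.+1).
    by exists M; split=> //; rewrite /= odd_double.
exists (fun i => sval (cid (M_ex i))); split=> [i|j|i].
- by case: (cid (M_ex i)) => M [].
- case: (cid (M_ex j.*2)) => M [_ VM _] /=; apply: VM; by rewrite odd_double.
- by case: (cid (M_ex i)) => M [].
Qed.

Context (M : forall i, 'M[T]_(n i.+1, n i)).
Hypothesis Mb : forall i, M i *m b i = b i.+1.
Hypothesis VM : forall j r c, V (M j.*2 r c).

Let D i : 'M[A]_(n i.+1, n i) := map_mx pi (M i).

Lemma relations_MM j r c : R ((M j.*2.+1 *m M j.*2) r c).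
Proof.
exact: (relation_matrix R_supp (@bT j.*2) (b_even j) (b_even j.+1)
  (Mb j.*2) (Mb j.*2.+1)).
Qed.

Lemma minimal_D i r c : aug (D i r c) = 0.
Proof.
rewrite mxE pres_augE.
have [j [ij|ij]] := double_or_doubleS i; subst i.
  by have := aug_Vsub p (VM r c); rewrite pres_augE.
exact: (even_matrix_minimal (@bF _) (Mb j.*2) (@VM j) (@relations_MM j)).
Qed.

Lemma homogeneous_D i r c : Az p ((g r)%:Z - (g c)%:Z) (D i r c).
Proof.
have bg i' c' : Tdeg deg (g c') (b i' c' 0) by case: (bP i').
have := homogeneous_matrix (@bT i) (bg i) (bg i.+1) (Mb i) r c.
rewrite mxE; case: leqP => [le Mrc|_ ->]; last by rewrite rmorph0; exact: Az0.
by rewrite subzn //; exists (M i r c).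
Qed.

Section Exactness.
Context (delta : nat -> {linear AT -> AT}).
Hypothesis delta_M : forall i r, delta i (tens 1 (b i.+1 r 0))
  = \sum_c pi (M i r c) *: tens 1 (b i c 0).
Hypothesis delta_res : left_resolution p delta.

Lemma delta_iota i x : delta i (iota (b i.+1) x) = iota (b i) (x *m D i).
Proof.
rewrite {1}/iota linear_sum.
transitivity (\sum_r \sum_c (x 0 r * D i r c) *: (tens 1 (b i c 0) : AT)).
  apply: eq_bigr => r _; rewrite linearZ /= delta_M scaler_sumr.
  by apply: eq_bigr => c _; rewrite scalerA mxE.
rewrite exchange_big /=; apply: eq_bigr => c _.
by rewrite mxE scaler_suml.
Qed.

Lemma exact_D i (x : 'rV_(n i.+1)) :
  x *m D i = 0 <-> exists y, x = y *m D i.+1.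
Proof.
have [_ /(_ i (iota (b i.+1) x))] := delta_res.
rewrite (Kleft_iota (bJ i.+1)) (Kleft_iota (bJ i.+2)) delta_iota => ex.
have {}ex := ex (ex_intro _ x erefl).
split=> [xD|[y xE]].
  have [|_ [y ->] ] := (proj1 ex); first by rewrite xD linear0.
  by rewrite delta_iota => /(iota_inj (@bF i.+1)) xE; exists y.
apply: (iota_inj (@bF i)); rewrite linear0; apply/ex.
by exists (iota (b i.+2) y); [exists y|rewrite delta_iota xE].
Qed.

Lemma iota0_tens (x : 'rV[A]_(n 0%N)) :
  iota (b 0%N) x = tens ((iota (b 0%N) x)@_one) (1 : T).
Proof.
apply/malgP => w; rewrite tensE mcoeff1 /=.
have [->|w1] := eqVneq w one; first by rewrite scale1r.
rewrite scale0r iota_coef big1 // => c _.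
have /ksubP[a ->] : lspan [set (1 : T)] (b 0%N c 0).
  have -> : lspan [set (1 : T)] = kspan (b 0%N) by rewrite -bJ.
  exact: kspan_gen.
by rewrite mcoeffZ mcoeff1 (negPf w1) mulr0 scale0r mulr0.
Qed.

(** Degree zero of the multi-Koszul complex is [A (x) k]: the augmentation reads
    off the coefficient of the empty word. *)
Lemma augmentation_ex : exists e : {linear 'rV[A]_(n 0%N) -> k | aug \; *%R},
  [/\ forall c, exists x, e x = c,
      forall x, e x = 0 <-> exists y, x = y *m D 0%N
    & forall c, e (delta_mx 0 c) != 0 -> g c = 0%N].
Proof.
have [e eE] := cochain_row_ex aug (\col_c (b 0%N c 0)@_one).
have eE' x : e x = aug ((iota (b 0%N) x)@_one).
  rewrite eE iota_coef rmorph_sum; apply: eq_bigr => c _.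
  by rewrite rmorphM aug_alg mxE.
exists e; split=> [c|x|c].
- have [u uE] : kspan (b 0%N) 1 by rewrite -bJ; exact: lspan_gen.
  exists (\row_l (c * u 0 l)%:A); rewrite eE.
  transitivity (c * (1 : T)@_one); last by rewrite mcoeff1 eqxx mulr1.
  rewrite uE raddf_sum mulr_sumr; apply: eq_bigr => l _ /=.
  by rewrite !mxE aug_alg mcoeffZ mulrA.
- have [/(_ ((iota (b 0%N) x)@_one)) ex0 _] := delta_res.
  rewrite eE'; split=> [/ex0|[y xE]].
    rewrite -iota0_tens (Kleft_iota (bJ 1%N)) => -[_ [y ->]].
    by rewrite delta_iota => /(iota_inj (@bF 0%N)) xE; exists y.
  apply/ex0; rewrite -iota0_tens (Kleft_iota (bJ 1%N)).
  by exists (iota (b 1%N) y); [exists y|rewrite delta_iota xE].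
- have -> : e (delta_mx 0 c) = (b 0%N c 0)@_one.
    rewrite eE (bigD1 c) //= !mxE !eqxx rmorph1 mul1r big1 ?addr0 // =>
      l /negPf lc.
    by rewrite !mxE lc rmorph0 mul0r.
  case: (bP 0%N) => /(_ c)/TdegP gc _ _ /gc <-.
  by rewrite /wdeg fm1 big_nil.
Qed.
End Exactness.

Lemma map_scalmx m l (N : 'M[k]_(m, l)) : map_mx pi (scalmx T N) = scalmx A N.
Proof. by apply/matrixP => i j; rewrite !mxE linearZ rmorph1. Qed.

(** Chain maps lifting a cochain of even degree, in degrees up to two, by
    scalar matrices: the coefficients of [M], respectively of the relations
    [M' M], over the bases of [V] and [R]. *)
Lemma scalar_lifts j (c : 'I_(n j.*2)) (N1 : 'M[k]_(n j.*2.+1, n 1%N))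
    (N2 : 'M[k]_(n j.*2.+2, n 2%N)) :
  col c (M j.*2) = scalmx T N1 *m b 1%N ->
  col c (M j.*2.+1 *m M j.*2) = scalmx T N2 *m b 2 ->
  exists N0 : 'M[k]_(n j.*2, n 0%N),
    scalmx A N1 *m D 0%N = D j.*2 *m scalmx A N0 /\
    scalmx A N2 *m D 1%N = D j.*2.+1 *m scalmx A N1.
Proof.
move=> N1E N2E; have [N0 N0E] : exists N0, delta_mx c 0 = scalmx T N0 *m b 0%N.
  apply: kspan_colmx => r; rewrite -bJ mxE; apply/ksubP.
  by exists ((r == c) && (0 == 0 :> 'I_1))%:R; rewrite scaler_nat.
exists N0; rewrite -!map_scalmx -!map_mxM; split; congr (map_mx _ _).
  by apply: (ltfree_inj (@bT 0%N)); rewrite -!mulmxA Mb -N0E -colE.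
by apply: (ltfree_inj (@bT 1%N)); rewrite -!mulmxA Mb -N1E -N2E !colE mulmxA.
Qed.

Section Generation.
Context (e : {linear 'rV[A]_(n 0%N) -> k | aug \; *%R}).
Hypothesis e_surj : forall c, exists x, e x = c.
Hypothesis e_exact : forall x, e x = 0 <-> exists y, x = y *m D 0%N.
Hypothesis D_exact : forall i (x : 'rV_(n i.+1)),
  x *m D i = 0 <-> exists y, x = y *m D i.+1.
Local Notation Q := (matrix_resolution e_surj e_exact D_exact).

(** [M_(2j)] and [M_(2j+1) M_(2j)] carry [b_(2j)] to families independent over
    [k], so that the coefficient matrices of their columns split jointly: this
    is the surjectivity of products. *)
Theorem koszul_ext_generated12 :
  ext_generated12 (all_cochains Q) (all_maps Q).
Proof.
apply: (matrix_ext_generated12 (@aug_alg _ _ _ p) minimal_D) => m r m_even r12.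
have [j mj] : exists j, m = j.*2.
  by exists m./2; rewrite -{1}(odd_double_half m) (negPf m_even).
subst m; have b1V : V = kspan (b 1%N) by rewrite -bJ -(Jodd0 p).
have b2R : R = kspan (b 2%N) by rewrite -bJ.
have [N1 N1E] : exists N1 : 'I_(n j.*2) -> 'M[k]_(n j.*2.+1, n 1%N),
    forall c, col c (M j.*2) = scalmx T (N1 c) *m b 1%N.
  by apply: kspan_mx => r' c; rewrite -b1V; exact: VM.
have [N2 N2E] : exists N2 : 'I_(n j.*2) -> 'M[k]_(n j.*2.+2, n 2),
    forall c, col c (M j.*2.+1 *m M j.*2) = scalmx T (N2 c) *m b 2.
  by apply: kspan_mx => r' c; rewrite -b2R; exact: relations_MM.
have /choice[F FP] c : exists F : forall i, {linear Q (i + j.*2)%N -> Q i},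
    [/\ forall i (x : Q (i.+1 + j.*2)%N),
          F i (res_d Q (i + j.*2) x) = res_d Q i (F i.+1 x),
        forall x, F 1%N x = x *m scalmx A (N1 c)
      & forall x, F 2 x = x *m scalmx A (N2 c)].
  have [N0 [E0 E1]] := scalar_lifts (N1E c) (N2E c).
  have [F [Fd _ F1 F2]] := matrix_chain_map e_surj e_exact D_exact E0 E1.
  by exists F.
have [X1 NX1] := coefficient_inverse N1E
  (ltac:(rewrite Mb; exact: bF) : kfree (M j.*2 *m b j.*2)).
have [X2 NX2] := coefficient_inverse N2E
  (ltac:(rewrite -mulmxA !Mb; exact: bF) :
     kfree ((M j.*2.+1 *m M j.*2) *m b j.*2)).
case/orP: r12 => /eqP ->; exists (n j.*2), F.
  by exists N1, X1; split=> // c; case: (FP c).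
by exists N2, X2; split=> // c; case: (FP c).
Qed.
End Generation.
End Koszul.

Theorem proposition3p30 (k : fieldType) (I : choiceType) (A : algType k)
    (p : presentation I A)
    (A_fg : fg_algebra A)
    (R_fd : exists s : seq (tensor_alg k I), rels p = lspan [set` s]%classic)
    (A_mk : multi_koszul p) :
  [/\ graded_ext_eq_ext (pres_aug p) (Adeg p),
      graded_ext_generated12 (pres_aug p) (Adeg p)
    & K2_algebra (pres_aug p)].
Proof.
have [eI [eI_uniq eI_all]] := finite_letters p A_fg.
have R_supp : finitely_supported (rels p).
  case: R_fd => s ->; apply: finitely_supported_lspan.
  exact: finitely_supported_seq.
have [delta dP dres] := A_mk.
have /choice[B BP] i :
    exists B : {n : nat & ('cV[tensor_alg k I]_n * ('I_n -> nat))%type},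
    homogeneous_basis (gdeg p) (J (rels p) i) (projT2 B).1 (projT2 B).2.
  have [n [b [g bP]]] := homogeneous_basis_ex (subspace_J p i)
    (@graded_J _ _ _ p i) (finitely_supported_J eI_all R_supp i).
  by exists (existT _ n (b, g)).
pose n i := projT1 (B i); pose b i : 'cV_(n i) := (projT2 (B i)).1.
pose g i : 'I_(n i) -> nat := (projT2 (B i)).2.
have bP i : homogeneous_basis (gdeg p) (J (rels p) i) (b i) (@g i) := BP i.
have [M [Mb VM dM]] := differential_matrices eI_uniq eI_all bP dP.
pose D i := map_mx (proj p) (M i).
have [e [e_surj e_exact e_gr]] := augmentation_ex bP dM dres.
have D_exact := exact_D bP dM dres.
have D_min i r c : pres_aug p (D i r c) = 0.
  exact: (minimal_D eI_uniq eI_all R_supp bP Mb VM).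
have D_gr i r c : Az p ((g _ r)%:Z - (g _ c)%:Z) (D i r c).
  exact: (homogeneous_D eI_uniq eI_all R_supp bP Mb).
pose Q := graded_matrix_resolution (@Az0 _ _ _ p) (@AzB _ _ _ p) (@AzM _ _ _ p)
  (@Az_direct _ _ _ p) (@Az_span _ _ _ p) (@Az_aug _ _ _ p)
  e_surj e_exact D_exact D_gr e_gr.
have Qk m (f : cochain Q m) : gHC f.
  exact: (row_graded_cochain (@Az_aug _ _ _ p)).
have QP (P : gresolution (pres_aug p) (Adeg p)) m l (F : {linear Q m -> P l}) :
    graded_hom (gr_ Q m) (gr_ P l) F.
  exact: (row_graded_hom (@Az_neg _ _ _ p) (@g m) (gres_grading P l)).
have Qgen : ext_generated12 (all_cochains Q) (all_maps Q).
  exact: (koszul_ext_generated12 eI_uniq eI_all R_supp bP Mb VM).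
split.
- by move=> P m; exact: (graded_ext_comparison (@Az_span _ _ _ p) P Qk).
- by move=> P; exact: (ext_generated12_transfer (@Az_span _ _ _ p) Qk (QP P)).
- exact: (K2_transfer Qgen).
Qed.
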